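(* Assume (K1) and let $\lambda\in\mathbb{R}\setminus\Sigma$. Then: (1) $\mathbb G_\lambda$ is well-defined on $L^1(\Omega;\delta^\gamma)$ (i.e. the operator $\mathbb G_\lambda$ given on $L^2(\Omega)$ by the spectral series extends uniquely to a continuous operator on $L^1(\Omega;\delta^\gamma)$), and maps continuously - $L^1(\Omega;\mathbb G_0(\delta^\alpha))\to L^1(\Omega;\delta^\alpha)$ for $\alpha>-1-\gamma$; - $L^1(\Omega)\to L^p(\Omega)$ for $p\in[1,\frac n{n-2s})$; - $L^2(\Omega)\to\mathbb H^2_{\mathcal L}(\Omega)$; - $L^{p_0}(\Omega)\to L^{p_1}(\Omega)$ for $p_0\in(1,\frac n{2s})$ and $\frac1{p_1}=\frac1{p_0}-\frac{2s}n$; - $L^q(\Omega)\to L^\infty(\Omega)$ for $q\in(\frac n{2s},+\infty)$; - $\delta^\alpha L^\infty(\Omega)\to\mathbb G_0(\delta^\alpha)L^\infty(\Omega)$ for $\alpha>-1-\gamma$; with operator norms depending only on $\bar\lambda$, $d_\Sigma(\lambda)$ and, where appropriate, on the exponents $p$, $p_0$, $q$, $\alpha$. (2) $\mathbb G_\lambda$ maps continuously - $L^1(\Omega;\delta^\gamma)\to L^p_{\rm loc}(\Omega)$ for $p\in(1,\frac n{n-2s})$; - $L^1(\Omega;\delta^\gamma)\cap L^{p_0}_{\rm loc}(\Omega)\to L^{p_1}_{\rm loc}(\Omega)$ for $p_0\in(1,\frac n{2s})$ and $\frac1{p_1}=\frac1{p_0}-\frac{2s}n$; - $L^1(\Omega;\delta^\gamma)\cap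 L^q_{\rm loc}(\Omega)\to L^\infty_{\rm loc}(\Omega)$ for $q\in(\frac n{2s},+\infty)$. Furthermore, for $f\in L^1(\Omega;\delta^\gamma)\cap L^\infty_{\rm loc}(\Omega)$, $K\Subset K_0\Subset\Omega$ and $u=\mathbb G_\lambda(f)$, $$\|u\|_{L^\infty(K)}\le C(\bar\lambda,d_\Sigma(\lambda),K,K_0)\left(\|f\|_{L^\infty(K_0)}+\|f\delta^\gamma\|_{L^1(\Omega)}\right).$$
   Context: Setting. Let $n\ge1$, $s\in(0,1)$, $\Omega\subset\mathbb{R}^n$ be bounded of class $C^{1,1}$, $\delta(x)=\mathrm{dist}(x,\partial\Omega)$. $\mathcal L$ is a non-negative operator of order $2s$ in $\Omega$ with homogeneous Dirichlet condition; it enters through its Green function. (K1): $\mathcal L$ has a Green function $\mathcal G_0:(\Omega\times\Omega)\setminus\{x=y\}\to(0,\infty)$ with $\mathcal G_0(x,y)=\mathcal G_0(y,x)\asymp |x-y|^{-(n-2s)}\left(\frac{\delta^\gamma(x)\delta^\gamma(y)}{|x-y|^{2\gamma}}\wedge1\right)$ for some $\gamma\in(0,1]$, where $n\ne2s$. Here $f\asymp g$ means $C^{-1}f\le g\le Cf$ for a constant $C>0$, and $a\wedge b=\min\{a,b\}$. Green operator: $\mathbb G_0(f)(x)=\int_\Omega\mathcal G_0(x,y)f(y)\,dy$. It is compact and self-adjoint on $L^2(\Omega)$; standing: there are $0<\lambda_1\le\lambda_2\le\dots\nearrow+\infty$ (repeated according to multiplicity) and an orthonormal basis $(\varphi_j)_{j\ge1}\subset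 C(\overline\Omega)$ of $L^2(\Omega)$ with $\varphi_j=\lambda_j\mathbb G_0(\varphi_j)$, $\varphi_1\ge0$. $\Sigma=\{\lambda_j\}$, and $\mathcal L$ is the inverse of $\mathbb G_0$. Notation. $\langle f,\varphi\rangle=\int_\Omega f\varphi\,dx$. For a weight $w>0$: $L^1(\Omega;w)$ has norm $\|fw\|_{L^1(\Omega)}$; $wL^\infty(\Omega)=\{f:f/w\in L^\infty(\Omega)\}$ has norm $\|f/w\|_{L^\infty(\Omega)}$. $\mathbb H^2_{\mathcal L}(\Omega)=\{v\in L^2(\Omega):\sum_j\lambda_j^2\langle v,\varphi_j\rangle^2<\infty\}$ with norm $(\sum_j\lambda_j^2\langle v,\varphi_j\rangle^2)^{1/2}$. $K\Subset K_0$ means that the closure of $K$ is contained in the interior of $K_0$ (and $K_0\Subset\Omega$ that the closure of $K_0$ is a compact subset of $\Omega$). Lebesgue exponents are understood to be $\ge1$ (empty ranges are vacuous). For $\lambda\in\mathbb R\setminus\Sigma$ and $f\in L^2(\Omega)$, $\mathbb G_\lambda(f)=\sum_{j\ge1}\frac{\langle f,\varphi_j\rangle}{\lambda_j-\lambda}\varphi_j$. $\bar\lambda=\lambda_{I+1}$ with $I=\min\{j:\lambda_j\ge\lambda\text{ and }\lambda_{j+1}>\lambda_j\}$; $d_\Sigma(\lambda)=\min_j|\lambda_j-\lambda|$. All constants may also depend on the fixed data $n,s,\gamma,\Omega$ and on the operator $\mathcal L$. *)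

(* Defs.v *)
From HB Require Import structures.
From mathcomp Require Import all_boot all_order all_algebra.
From mathcomp Require Import all_classical all_reals all_analysis.

Set Implicit Arguments.
Unset Strict Implicit.
Unset Printing Implicit Defensive.

Import Order.TTheory GRing.Theory Num.Theory.
Import numFieldNormedType.Exports.

Local Open Scope classical_set_scope.
Local Open Scope ring_scope.

Definition row_display : measure_display.
Proof. exact: (measure_tuple_display default_measure_display). Qed.

Section measurable_row.
Context (R : realType) (n : nat).

Definition row_coord (i : 'I_n) (x : 'rV[R]_n) : measurableTypeR R :=
  x ord0 i.

Let row0 : g_sigma_preimage row_coord set0.
Proof. exact: sigma_algebra0. Qed.

Let rowC A : g_sigma_preimage row_coord A -> g_sigma_preimage row_coord (~` A).
Proof. exact: sigma_algebraC. Qed.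

Let row_bigcup (F : (set 'rV[R]_n)^nat) :
  (forall i, g_sigma_preimage row_coord (F i)) ->
  g_sigma_preimage row_coord (\bigcup_i (F i)).
Proof. exact: sigma_algebra_bigcup. Qed.

(* The sigma-algebra generated by the coordinates, i.e. the Borel sets of R^n. *)
HB.instance Definition _ := @isMeasurable.Build row_display 'rV[R]_n
  (g_sigma_preimage row_coord) row0 rowC row_bigcup.

Lemma measurable_row_coord (i : 'I_n) :
  measurable_fun [set: 'rV[R]_n] (row_coord i).
Proof.
move=> _ Y mY; rewrite setTI; apply: sub_sigma_algebra => /=.
rewrite -bigcup_seq/=; exists i => /=; first by rewrite mem_index_enum.
by exists Y => //; rewrite setTI.
Qed.

End measurable_row.

Section measurable_row_cons.
Context (R : realType) (n : nat).

Definition row_cons (z : measurableTypeR R * 'rV[R]_n) : 'rV[R]_n.+1 :=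
  \row_i (if unlift ord0 i is Some j then z.2 ord0 j else z.1).

Lemma measurable_row_cons : measurable_fun setT row_cons.
Proof.
have H : (g_sigma_preimage (fun i => @row_coord R n.+1 i \o row_cons)
    `<=` (measurable : set (set (measurableTypeR R * 'rV[R]_n)))).
  apply: smallest_sub; first exact: sigma_algebra_measurable.
  rewrite -bigcup_mkord_ord; apply: bigcup_sub => i _ A [B mB <-].
  suff : measurable_fun setT (@row_coord R n.+1 (inord i) \o row_cons) by exact.
  case: (unliftP ord0 (inord i : 'I_n.+1)) => [j ->|->].
    rewrite (_ : _ \o _ = @row_coord R n j \o snd).
      by apply: measurableT_comp => //; exact: measurable_row_coord.
    by apply/funext => z; rewrite /= /row_coord/row_cons mxE liftK.
  rewrite (_ : _ \o _ = fst); first exact: measurable_fst.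
  by apply/funext => z; rewrite /= /row_coord/row_cons mxE unlift_none.
rewrite g_sigma_preimage_comp in H.
by move=> _ A mA; apply: H; exists A.
Qed.

Definition row_split (x : 'rV[R]_n.+1) : measurableTypeR R * 'rV[R]_n :=
  (x ord0 ord0, \row_j x ord0 (lift ord0 j)).

Lemma row_consK : cancel row_cons row_split.
Proof.
move=> [a v]; rewrite /row_split /row_cons !mxE unlift_none; congr pair.
by apply/rowP => j; rewrite !mxE liftK.
Qed.

Lemma measurable_row_split : measurable_fun setT row_split.
Proof.
apply: measurable_fun_pair; first exact: measurable_row_coord.
have H : (g_sigma_preimage (fun i => @row_coord R n i \o (fun x : 'rV[R]_n.+1 => \row_j x ord0 (lift ord0 j)))
    `<=` (measurable : set (set 'rV[R]_n.+1))).
  apply: smallest_sub; first exact: sigma_algebra_measurable.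
  case: n => [|m]; first by rewrite big_ord0.
  rewrite -bigcup_mkord_ord; apply: bigcup_sub => i _ A [B mB <-].
  have -> : @row_coord R m.+1 (inord i) \o
      (fun x : 'rV[R]_m.+2 => \row_j x ord0 (lift ord0 j)) =
      @row_coord R m.+2 (lift ord0 (inord i)).
    by apply/funext => z; rewrite /row_coord/= mxE.
  exact: measurable_row_coord.
rewrite g_sigma_preimage_comp in H.
by move=> _ A mA; rewrite setTI; apply: H; exists A; rewrite ?setTI.
Qed.

End measurable_row_cons.

Section cons_measure.
Context (R : realType) (n : nat).
Variable mu : {sigma_finite_measure set 'rV[R]_n -> \bar R}.
Local Open Scope ereal_scope.

Definition cons_measure (A : set 'rV[R]_n.+1) : \bar R :=
  (@lebesgue_measure R \x mu) (@row_cons R n @^-1` A).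

Let measurable_preim (A : set 'rV[R]_n.+1) :
  measurable A -> measurable (@row_cons R n @^-1` A).
Proof.
by move=> mA; rewrite -[X in measurable X]setTI; exact: measurable_row_cons.
Qed.

Let cons_measure0 : cons_measure set0 = 0.
Proof. by rewrite /cons_measure preimage_set0 measure0. Qed.

Let cons_measure_ge0 A : 0 <= cons_measure A.
Proof. exact: measure_ge0. Qed.

Let cons_measure_sigma_additive : semi_sigma_additive cons_measure.
Proof.
move=> F mF tF mUF; rewrite /cons_measure preimage_bigcup.
apply: measure_semi_sigma_additive.
- by move=> k; exact: measurable_preim.
- apply/trivIsetP => /= i j _ _ ij; rewrite -preimage_setI.
  by move/trivIsetP : tF => /(_ _ _ _ _ ij) ->//; rewrite preimage_set0.
- by rewrite -preimage_bigcup; exact: measurable_preim.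
Qed.

HB.instance Definition _ := isMeasure.Build _ _ _ cons_measure
  cons_measure0 cons_measure_ge0 cons_measure_sigma_additive.

Let cons_measure_sigma_finite : sigma_finite setT cons_measure.
Proof.
have [F FT Foo] : sigma_finite setT (@lebesgue_measure R \x mu).
  have /sigma_finiteP[F [TF ndF Foo]] := sigma_finiteT (@lebesgue_measure R).
  have /sigma_finiteP[G [TG ndG Goo]] := sigma_finiteT mu.
  exists (fun k => F k `*` G k).
    rewrite -setXTT TF TG predeqE => -[x y]; split.
      move=> [/= [i _ Fix] [k _ Gky]]; exists (maxn i k) => //; split.
      - by move: x Fix; exact/subsetPset/ndF/leq_maxl.
      - by move: y Gky; exact/subsetPset/ndG/leq_maxr.
    by move=> [i _ []/= ? ?]; split; exists i.
  move=> k; have [? ?] := Foo k; have [? ?] := Goo k.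
  split; first exact: measurableX.
  by rewrite product_measure1E// lte_mul_pinfty// ge0_fin_numE.
exists (fun k => @row_split R n @^-1` F k).
  by rewrite -preimage_bigcup -FT preimage_setT.
move=> k; have [mF Fk] := Foo k; split.
  by rewrite -[X in measurable X]setTI; exact: measurable_row_split.
rewrite /cons_measure -comp_preimage.
by rewrite (_ : @row_split R n \o _ = id)//; apply/funext; exact: row_consK.
Qed.

HB.instance Definition _ := Measure_isSigmaFinite.Build _ _ _ cons_measure
  cons_measure_sigma_finite.

End cons_measure.

Fixpoint lebesgue_row (R : realType) (n : nat) :
    {sigma_finite_measure set 'rV[R]_n -> \bar R} :=
  match n with
  | 0 => [the {sigma_finite_measure set 'rV[R]_0 -> \bar R} of
           @dirac _ 'rV[R]_0 0 R]
  | m.+1 => [the {sigma_finite_measure set 'rV[R]_m.+1 -> \bar R} of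
              @cons_measure R m (lebesgue_row R m)]
  end.

Lemma lebesgue_row_box (R : realType) (n : nat) (A : 'I_n -> set R) :
  (forall i, measurable (A i : set (measurableTypeR R))) ->
  lebesgue_row R n [set x | forall i, A i (x ord0 i)] =
  (\prod_(i < n) lebesgue_measure (A i))%E.
Proof.
elim: n A => [|n IHn] A mA /=.
  by rewrite big_ord0 diracE mem_set// => -[].
have mB : measurable [set x : 'rV[R]_n | forall i, A (lift ord0 i) (x ord0 i)].
  rewrite (_ : mkset _ = \bigcap_(i in [set: 'I_n])
      (@row_coord R n i @^-1` A (lift ord0 i))); last first.
    by apply/seteqP; split => x /= H i; [move=> _|]; exact: H.
  apply: fin_bigcap_measurable => // i _.
  rewrite -[X in measurable X]setTI; exact: measurable_row_coord.
rewrite big_ord_recl -IHn// -product_measure1E// /cons_measure.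
congr (_ _); apply/seteqP; split => -[a v] /=.
  move=> H; split; first by have := H ord0; rewrite mxE unlift_none.
  by move=> i; have := H (lift ord0 i); rewrite mxE liftK.
by move=> [Ha Hv] i; rewrite mxE; case: unliftP => [j|] ->.
Qed.

Section euclidean.
Context (R : realType) (n : nat).
Local Notation E := 'rV[R]_n.

Definition dotp (x y : E) : R := \sum_(i < n) x ord0 i * y ord0 i.

(* The library norm on 'rV[R]_n is the sup norm; it induces the same topology. *)
Definition enorm (x : E) : R := Num.sqrt (dotp x x).

Definition frontier (A : set E) : set E := closure A `\` A°.

Definition dist_to (A : set E) (x : E) : R := inf [set enorm (x - y) | y in A].

Definition delta (Om : set E) (x : E) : R := dist_to (frontier Om) x.

(* K ⋐ K0 *)
Definition well_inside (K K0 : set E) : Prop := closure K `<=` K0°.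

(* K0 ⋐ Om *)
Definition compactly_inside (K0 Om : set E) : Prop :=
  compact (closure K0) /\ closure K0 `<=` Om.

Definition C11_function (g : E -> R) : Prop :=
  (forall x, differentiable g x) /\
  exists L : R, forall x y v,
    `|'d g x v - 'd g y v| <= L * enorm (x - y) * enorm v.

(* Near each boundary point Om is the strict epigraph of a C^{1,1} function
   over the hyperplane orthogonal to some unit vector e. The function g is
   defined on R^n, but only its values on that hyperplane are used. *)
Definition C11_open_set (Om : set E) : Prop :=
  open Om /\
  forall z, frontier Om z -> exists (r : R) (e : E) (g : E -> R),
    [/\ 0 < r, enorm e = 1, C11_function g &
        forall x, enorm (x - z) < r ->
          (Om x <-> g (x - dotp x e *: e) < dotp x e)].

End euclidean.

Section function_spaces.
Context (R : realType) (n : nat) (Om : set 'rV[R]_n).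
Local Notation E := 'rV[R]_n.
Local Notation leb := (lebesgue_row R n).

(* For p = +oo the set D need not be measurable: the essential supremum is
   taken with respect to sets contained in measurable null sets. *)
Definition Lpnorm (D : set E) (p : \bar R) (f : E -> R) : \bar R :=
  Lnorm leb p (EFin \o (f \_ D)).

(* Spaces of genuine functions; equality in the space is a.e. equality on Om. *)
Record fspace := FSpace {
  fmem : set (E -> R) ;
  fnorm : (E -> R) -> \bar R }.

Definition normed_by (N : (E -> R) -> \bar R) : fspace :=
  FSpace [set f | measurable_fun Om f /\ (N f < +oo)%E] N.

Definition Lp (p : \bar R) : fspace := normed_by (Lpnorm Om p).

Definition L1w (w : E -> R) : fspace :=
  normed_by (fun f => Lpnorm Om 1%E (fun x => f x * w x)).

Definition wLinf (w : E -> R) : fspace :=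
  normed_by (fun f => Lpnorm Om +oo%E (fun x => f x / w x)).

Definition Lploc (p : \bar R) : set (E -> R) :=
  [set f | measurable_fun Om f /\
    forall K, compact K -> K `<=` Om -> (Lpnorm K p f < +oo)%E].

Definition inner (f g : E -> R) : R := \int[leb]_(x in Om) (f x * g x).

Definition linear_on (X : fspace) (T : (E -> R) -> (E -> R)) : Prop :=
  forall (a : R) f g, fmem X f -> fmem X g ->
    T (fun x => a * f x + g x) = (fun x => a * T f x + T g x) %[ae leb in Om].

Definition bounded_by (C : R) (X Y : fspace) (T : (E -> R) -> (E -> R)) :
  Prop :=
  forall f, fmem X f -> fmem Y (T f) /\ (fnorm Y (T f) <= C%:E * fnorm X f)%E.

(* Continuity X -> L^p_loc(Om), for the seminorms of L^p(K), K compact. *)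
Definition continuous_to_loc (X : fspace) (p : \bar R)
    (T : (E -> R) -> (E -> R)) : Prop :=
  (forall f, fmem X f -> Lploc p (T f)) /\
  forall K, compact K -> K `<=` Om -> exists C : R,
    forall f, fmem X f -> (Lpnorm K p (T f) <= C%:E * fnorm X f)%E.

(* Continuity X ∩ L^p_loc(Om) -> L^q_loc(Om); X ∩ L^p_loc(Om) carries the
   norm of X together with the seminorms of L^p(K0), K0 compact. *)
Definition continuous_loc_to_loc (X : fspace) (p q : \bar R)
    (T : (E -> R) -> (E -> R)) : Prop :=
  (forall f, fmem X f -> Lploc p f -> Lploc q (T f)) /\
  forall K, compact K -> K `<=` Om ->
    exists (K0 : set E) (C : R), [/\ compact K0, K0 `<=` Om &
      forall f, fmem X f -> Lploc p f ->
        (Lpnorm K q (T f) <= C%:E * (fnorm X f + Lpnorm K0 p f))%E].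

End function_spaces.

Section green.
Context (R : realType) (n : nat) (Om : set 'rV[R]_n).
Local Notation E := 'rV[R]_n.
Local Notation leb := (lebesgue_row R n).

Definition green_op (G : E -> E -> R) (f : E -> R) (x : E) : R :=
  \int[leb]_(y in Om) (G x y * f y).

Definition green_kernel_model (s gamma : R) (x y : E) : R :=
  enorm (x - y) `^ (- (n%:R - 2 * s)) *
  Num.min (delta Om x `^ gamma * delta Om y `^ gamma /
           enorm (x - y) `^ (2 * gamma)) 1.

Definition off_diag : set (E * E) :=
  [set z | [/\ Om z.1, Om z.2 & z.1 <> z.2]].

Definition K1 (s gamma : R) (G : E -> E -> R) : Prop :=
  [/\ 0 < gamma <= 1,
      measurable_fun off_diag (fun z => G z.1 z.2),
      forall x y, off_diag (x, y) -> 0 < G x y,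
      forall x y, off_diag (x, y) -> G x y = G y x &
      exists2 C : R, 0 < C & forall x y, off_diag (x, y) ->
        C^-1 * green_kernel_model s gamma x y <= G x y
          <= C * green_kernel_model s gamma x y].

Definition L2_self_adjoint (T : (E -> R) -> (E -> R)) : Prop :=
  forall f g, fmem (Lp Om 2%:E) f -> fmem (Lp Om 2%:E) g ->
    inner Om (T f) g = inner Om f (T g).

Definition L2_compact (T : (E -> R) -> (E -> R)) : Prop :=
  (forall f, fmem (Lp Om 2%:E) f -> fmem (Lp Om 2%:E) (T f)) /\
  forall (f : nat -> E -> R) (M : R),
    (forall k, fmem (Lp Om 2%:E) (f k) /\ (Lpnorm Om 2%:E (f k) <= M%:E)%E) ->
    exists (h : nat -> nat) (u : E -> R),
      [/\ forall k, (h k < h k.+1)%N, fmem (Lp Om 2%:E) u &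
          Lpnorm Om 2%:E (fun x => T (f (h k)) x - u x) @[k --> \oo] --> 0%E].

(* Indices start at 0: lam j and phi j stand for \lambda_{j+1} and
   \varphi_{j+1}. *)
Record green_eigenbasis (G : E -> E -> R) (lam : nat -> R)
    (phi : nat -> E -> R) : Prop := GreenEigenbasis {
  eigen_pos : 0 < lam 0%N ;
  eigen_le : forall j, lam j <= lam j.+1 ;
  eigen_cvgy : lam @ \oo --> +oo ;
  eigen_cont : forall j, {within closure Om, continuous (phi j)} ;
  eigen_orthonormal : forall i j, inner Om (phi i) (phi j) = (i == j)%:R ;
  eigen_total : forall f, fmem (Lp Om 2%:E) f ->
    Lpnorm Om 2%:E
      (fun x => f x - \sum_(j < N) inner Om f (phi j) * phi j x)
      @[N --> \oo] --> 0%E ;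
  eigen_eq : forall j,
    phi j = (fun x => lam j * green_op G (phi j) x) %[ae leb in Om] ;
  eigen_ge0 : forall x, Om x -> 0 <= phi 0%N x }.

Section spectrum.
Variables (lam : nat -> R) (phi : nat -> E -> R).

Definition Sigma : set R := range lam.

Definition H2norm (v : E -> R) : \bar R :=
  ((\sum_(0 <= j <oo) ((lam j) ^+ 2 * (inner Om v (phi j)) ^+ 2)%:E)
    `^ (2^-1))%E.

Definition H2 : fspace R n :=
  FSpace [set v | fmem (Lp Om 2%:E) v /\ (H2norm v < +oo)%E] H2norm.

Definition is_spectral_sum (l : R) (f u : E -> R) : Prop :=
  fmem (Lp Om 2%:E) u /\
  Lpnorm Om 2%:E
    (fun x => u x - \sum_(j < N) inner Om f (phi j) / (lam j - l) * phi j x)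
    @[N --> \oo] --> 0%E.

Definition jump_index (l : R) : set nat :=
  [set j | l <= lam j /\ lam j < lam j.+1].

Definition first_jump (l : R) : nat :=
  xget 0%N [set I | jump_index l I /\
                    forall j, jump_index l j -> (I <= j)%N].

(* \lambda_{I+1} for the least jump index I, which exists since lam tends to
   +oo; the shift of indices by one cancels out. *)
Definition lambda_bar (l : R) : R := lam (first_jump l).+1.

(* The infimum is attained since lam tends to +oo. *)
Definition dist_Sigma (l : R) : R := inf (range (fun j => `|lam j - l|)).

Variable gamma : R.

Definition L1delta : fspace R n := L1w Om (fun x => delta Om x `^ gamma).

Definition is_resolvent (l : R) (T : (E -> R) -> (E -> R)) : Prop :=
  [/\ linear_on Om L1delta T,
      exists C : R, bounded_by C L1delta L1delta T &
      forall f, fmem (Lp Om 2%:E) f -> is_spectral_sum l f (T f)].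

(* The bound is uniform in l: it depends on l only through lambda_bar l and
   dist_Sigma l. *)
Definition resolvent_bounded (X Y : fspace R n) : Prop :=
  exists C : R -> R -> R, forall l T, ~ Sigma l -> is_resolvent l T ->
    bounded_by (C (lambda_bar l) (dist_Sigma l)) X Y T.

End spectrum.
End green.

(* Main.v *)
(* Write N = n - 2s and H(x,y) = |x-y|^N (|x-y| + δ(x) + δ(y))^(2γ). By (K1) the
   Green function is comparable with Phi_1, where
   Phi_t(x,y) = δ(x)^γ δ(y)^γ H(x,y)^(-t). Since H is a quasi-metric, the kernel
   Phi_1 ∘ Phi_t is bounded by a multiple of Phi_t' as soon as t' <= t is close
   enough to t: composing with the Green kernel loses nothing at t = 1 (the 3G
   inequality) and can lower t down to 0 in M steps.

   On L^2 the resolvent satisfies T f = G f + λ T(G f) = G f + λ G(T f). The first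
   identity, used M+1 times, reduces T f to T v with |v| <= C Phi_0 |f|; there the
   spectral gap bounds the L^2 norm of T v, and iterating the second identity M
   times turns this norm into a multiple of Phi_0 |f|. This extends T to
   L^1(Ω;δ^γ), uniquely by truncation, with |T f| <= K Phi_1 |f| a.e., where K
   depends only on bounds for |λ| and d_Σ(λ).

   Every mapping property is therefore one of the integral operator Phi_1. The
   unweighted ones follow from Phi_1 <= |x-y|^(-N), the two weighted ones are dual
   to each other, and the local ones come from splitting f into its restrictions
   to a neighbourhood of the compact set and to the complement. The range
   α > -1-γ only uses |{δ < t}| <= C t. *)

Require Import Defs.
From HB Require Import structures.
From mathcomp Require Import all_boot all_order all_algebra.
From mathcomp Require Import all_classical all_reals all_analysis.
From mathcomp Require Import measurable_realfun ess_sup_inf ring lra.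

Set Implicit Arguments.
Unset Strict Implicit.
Unset Printing Implicit Defensive.

Import Order.TTheory GRing.Theory Num.Theory.
Import numFieldNormedType.Exports.

Local Open Scope classical_set_scope.
Local Open Scope ring_scope.

(** * Integrals and powers *)

(** Three obstacles shape the proof. A datum in L^1(Ω;δ^γ) need not even be integrable, so the Riesz
    bound of Phi_1 alone cannot start an iteration: the boundary weight has to survive each step.
    The family Phi_t keeps the factor δ(x)^γ δ(y)^γ and lowers only the power of H; a step of 1/M is
    affordable because |x-y|^(-(N+(N+2γ)/M)) is still integrable in dimension n. The resolvent is
    specified as any bounded linear extension, acting on functions and not on classes. One extension
    is therefore built explicitly, as a finite iteration ending in an L^2 spectral sum, bounded
    pointwise, and then identified a.e. with every other one. Uniformity in λ enters only through
    |λ| <= |λ-bar| + d_Σ(λ). Only n <> 2s is assumed. The inequality n > 2s is deduced from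
    positivity of the Green operator on L^2, which fails for a kernel that is bounded and small near
    the diagonal. Two devices keep the analysis elementary: a chart function of the boundary has a
    non-zero derivative along some coordinate axis, so strips are measured without rotating
    coordinates, and the critical exponent p1 is reached by splitting a bilinear form instead of
    interpolating between weak estimates. *)

Section integration.
Context d (T : measurableType d) (R : realType).
Variable mu : {sigma_finite_measure set T -> \bar R}.
Local Open Scope ereal_scope.

(** The integral of a non-negative function is a supremum over the simple functions below it, so a
    larger integrand has more competitors. Measurability does not enter, which allows iterated
    integrals to be compared freely. *)
Lemma le_integral_nonneg (D : set T) (f g : T -> \bar R) :
  (forall x, D x -> 0 <= f x) -> (forall x, D x -> f x <= g x) ->
  \int[mu]_(x in D) f x <= \int[mu]_(x in D) g x.
Proof.
move=> f0 fg.
have g0 x : D x -> 0 <= g x by move=> Dx; exact: le_trans (f0 _ Dx) (fg _ Dx).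
rewrite !ge0_integralE//; apply: ereal_sup_le => _ [h hf <-]; exists h => // x.
apply: le_trans (hf x) _; rewrite !patchE; case: ifPn => // /set_mem; exact: fg.
Qed.

Lemma ae_le_integral_nonneg (D : set T) (f g : T -> \bar R) :
  measurable D -> measurable_fun D g ->
  (forall x, D x -> 0 <= f x) -> (forall x, D x -> 0 <= g x) ->
  {ae mu, forall x, D x -> f x <= g x} ->
  \int[mu]_(x in D) f x <= \int[mu]_(x in D) g x.
Proof.
move=> mD mg f0 g0 [N [mN N0 DN]].
(* Raising g to +oo on the exceptional null set makes the inequality hold everywhere and leaves the
   integral unchanged. *)
pose g' x := if x \in N then +oo else g x.
have mg' : measurable_fun D g'.
  apply: measurable_fun_if => //.
    apply: (@measurable_fun_bool _ _ _ _ true).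
    rewrite (_ : _ @^-1` _ = N); first exact: measurableI.
    by apply/seteqP; split => x /=; [move/set_mem|move/mem_set].
  apply: measurable_funS mg => //; exact: subIsetl.
have -> : \int[mu]_(x in D) g x = \int[mu]_(x in D) g' x.
  apply: ge0_ae_eq_integral => //.
  - by move=> x Dx; rewrite /g'; case: ifP => // _; exact: g0.
  - exists N; split => // x; apply: contra_notP => Nx _.
    by rewrite /g' memNset.
apply: le_integral_nonneg => // x Dx; rewrite /g'.
case: ifPn => [_|/negP]; first by rewrite leey.
rewrite inE => Nx; apply: contra_notT Nx => fg; apply: DN => /(_ Dx).
by apply/negP.
Qed.

Lemma integral_nonneg_le_cst (D : set T) (f : T -> \bar R) (c : R) :
  measurable D -> (forall x, D x -> 0 <= f x <= c%:E) ->
  \int[mu]_(x in D) f x <= c%:E * mu D.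
Proof.
move=> mD fc; rewrite -integral_cst//; apply: le_integral_nonneg => x Dx.
  by have /andP[] := fc _ Dx.
by have /andP[] := fc _ Dx.
Qed.

(** Where f does not vanish it is at most some c_k on a set E_k, so f is below the sum of the c_k
    1_(E_k), whose integrals form a geometric series. The sets E_k may overlap. *)
Lemma shell_integral (D : set T) (f : T -> \bar R) (E : (set T)^nat)
    (c m : nat -> R) (B q : R) :
  measurable D -> (forall k, measurable (E k)) ->
  (forall k, (0 <= c k)%R) -> (0 <= q < 1)%R -> (0 <= B)%R ->
  (forall x, D x -> 0 <= f x) ->
  (forall x, D x -> f x != 0 -> exists2 k, E k x & f x <= (c k)%:E) ->
  (forall k, mu (D `&` E k) <= (m k)%:E) ->
  (forall k, (c k * m k <= B * q ^+ k)%R) ->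
  \int[mu]_(x in D) f x <= (B / (1 - q))%:E.
Proof.
move=> mD mE c0 /andP[q0 q1] B0 f0 fE muE cm.
pose g k (x : T) : \bar R := (c k * \1_(E k) x)%:E.
have g0 k x : 0 <= g k x by rewrite lee_fin mulr_ge0.
have mg k : measurable_fun D (g k).
  apply/measurable_EFinP; apply: measurable_funM => //.
apply: (@le_trans _ _ (\int[mu]_(x in D) (\sum_(k <oo) g k x))).
  apply: le_integral_nonneg => // x Dx.
  have [->|fx0] := eqVneq (f x) 0; first exact: nneseries_ge0.
  have [k Ekx fxc] := fE _ Dx fx0.
  apply: le_trans (_ : g k x <= _).
    by rewrite /g indicE mem_set// mulr1.
  have := @nneseries_lim_ge R (fun k => g k x) xpredT 0 k.+1 (fun n _ _ => g0 n x).
  apply: le_trans; rewrite big_nat_recr//= leeDr//.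
  by apply: sume_ge0.
rewrite integral_nneseries//.
apply: lime_le.
  apply: is_cvg_nneseries => n _ _; exact: integral_ge0.
apply: nearW => n.
have H k : \int[mu]_(x in D) g k x <= (B * q ^+ k)%:E.
  rewrite /g; under eq_integral do rewrite EFinM.
  rewrite ge0_integralZl//=; last 2 first.
    by apply/measurable_EFinP.
    by rewrite lee_fin.
  rewrite integral_indic//= setIC.
  apply: (@le_trans _ _ ((c k)%:E * (m k)%:E)).
    by rewrite lee_wpmul2l// lee_fin.
  by rewrite -EFinM lee_fin.
apply: le_trans (lee_sum _ (fun k _ => H k)) _.
rewrite sumEFin lee_fin -mulr_sumr ler_wpM2l//.
rewrite big_mkord.
have q1' : (0 < 1 - q)%R by rewrite subr_gt0.
rewrite -(ler_pM2l q1') mulfV ?gt_eqF//.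
have -> : ((1 - q) * \sum_(i < n) q ^+ i = 1 - q ^+ n)%R.
  by rewrite -opprB mulNr -subrX1 opprB.
by rewrite lerBlDr lerDl exprn_ge0.
Qed.

End integration.

Section tonelli.
Context d1 d2 (T1 : measurableType d1) (T2 : measurableType d2) (R : realType).
Variable m1 : {sigma_finite_measure set T1 -> \bar R}.
Variable m2 : {sigma_finite_measure set T2 -> \bar R}.
Variables (A : set T1) (B : set T2) (F : T1 -> T2 -> \bar R).
Hypotheses (mA : measurable A) (mB : measurable B).
Hypothesis F0 : forall x y, A x -> B y -> (0 <= F x y)%E.
Hypothesis mF : measurable_fun (A `*` B) (fun z => F z.1 z.2).
Local Open Scope ereal_scope.

(** Extension by zero off the product set reduces everything in this section to Tonelli's theorem on
    the whole product space. *)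
Let f := (fun z => F z.1 z.2) \_ (A `*` B).
Let mf : measurable_fun setT f.
Proof. by apply/(measurable_restrictT _ (measurableX mA mB)). Qed.
Let f0 z : 0 <= f z.
Proof. by rewrite /f patchE; case: ifPn => // /set_mem[? ?]; exact: F0. Qed.

Let innerE x : A x -> \int[m2]_y f (x, y) = \int[m2]_(y in B) F x y.
Proof.
move=> Ax; rewrite [RHS]integral_mkcond; apply: eq_integral => y _.
rewrite /f !patchE; congr (if _ then _ else _).
by apply/idP/idP; rewrite !inE => //= -[].
Qed.

Let innerE' y : B y -> \int[m1]_x f (x, y) = \int[m1]_(x in A) F x y.
Proof.
move=> By; rewrite [RHS]integral_mkcond; apply: eq_integral => x _.
rewrite /f !patchE; congr (if _ then _ else _).
by apply/idP/idP; rewrite !inE => //= -[].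
Qed.

Lemma tonelli_in :
  \int[m1]_(x in A) \int[m2]_(y in B) F x y =
  \int[m2]_(y in B) \int[m1]_(x in A) F x y.
Proof.
transitivity (\int[m1]_x \int[m2]_y f (x, y)).
  rewrite [LHS]integral_mkcond; apply: eq_integral => x _.
  rewrite !patchE; case: ifPn => [/set_mem Ax|/negP Ax]; first by rewrite innerE.
  rewrite integral0_eq// => y _; rewrite /f patchE memNset// => -[/= Ax' _].
  by apply: Ax; rewrite inE.
rewrite (fubini_tonelli f mf f0).
rewrite [RHS]integral_mkcond; apply: eq_integral => y _.
rewrite !patchE; case: ifPn => [/set_mem By|/negP By]; first by rewrite innerE'.
rewrite integral0_eq// => x _; rewrite /f patchE memNset// => -[/= _ By'].
by apply: By; rewrite inE.
Qed.

Lemma measurable_integral_in :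
  measurable_fun A (fun x => \int[m2]_(y in B) F x y).
Proof.
have := measurable_fun_fubini_tonelli_F (m2 := m2) f mf f0.
move=> /(measurable_funS measurableT (@subsetT _ A)) H.
apply: eq_measurable_fun H => x /set_mem Ax.
by rewrite /fubini_F innerE.
Qed.

Lemma measurable_fun_slice x : A x -> measurable_fun B (F x).
Proof.
move=> Ax.
have : measurable_fun setT (fun y => f (x, y)).
  by apply: measurableT_comp => //; exact: measurable_pair1.
move=> /(measurable_funS measurableT (@subsetT _ B)) H.
apply: eq_measurable_fun H => y /set_mem By.
by rewrite /f patchE mem_set.
Qed.

End tonelli.

Section powers.
Context (R : realType).
Implicit Types a b c x y z t p q r : R.

Lemma powRDp x r t : 0 < x -> x `^ (r + t) = x `^ r * x `^ t.
Proof. by move=> x0; rewrite powRD// (gt_eqF x0) /= implybT. Qed.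

Lemma powR_exprn x a k : 0 <= x -> (x ^+ k) `^ a = (x `^ a) ^+ k.
Proof.
move=> x0; elim: k => [|k IH]; first by rewrite !expr0 powR1.
by rewrite !exprS powRM ?exprn_ge0// IH.
Qed.

Lemma powR_le x y r : 0 <= r -> 0 <= x -> x <= y -> x `^ r <= y `^ r.
Proof.
by move=> r0 x0 xy; apply: ge0_ler_powR => //; rewrite nnegrE// (le_trans x0).
Qed.

Lemma powRN_le x y r : 0 <= r -> 0 < x -> x <= y -> y `^ (- r) <= x `^ (- r).
Proof.
move=> r0 x0 xy; rewrite !powRN lef_pV2 ?posrE ?powR_gt0//.
  by apply: powR_le => //; exact: ltW.
exact: lt_le_trans xy.
Qed.

Lemma half_pow_le e : 0 < e -> exists k, (2^-1 : R) ^+ k <= e.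
Proof.
move=> e0; exists (Num.bound e^-1).
rewrite exprVn -[leRHS]invrK lef_pV2 ?posrE ?exprn_gt0 ?invr_gt0//.
apply/ltW; apply: lt_le_trans (_ : (Num.bound e^-1)%:R <= _).
  by apply: archi_boundP; rewrite invr_ge0 ltW.
by rewrite -natrX ler_nat ltnW// ltn_expl.
Qed.

Lemma two_pow_ge e : exists k, e <= (2 : R) ^+ k.
Proof.
have [e0|e0] := leP e 0; first by exists 0; rewrite (le_trans e0).
have [k] := @half_pow_le e^-1 (ltac:(by rewrite invr_gt0)).
by rewrite exprVn lef_pV2 ?posrE// ?exprn_gt0// => H; exists k.
Qed.

End powers.

Section layers.
Context d (T : measurableType d) (R : realType).
Variable mu : {sigma_finite_measure set T -> \bar R}.

(** Dyadic shells t 2^(-k-1) <= w < t 2^(-k): from one shell to the next the integrand grows by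
    2^rho and the volume bound shrinks by 2^(-kappa), which leaves the ratio q < 1. The constant
    precedes D and w, so it serves all weights with the same growth bound, in particular all centres
    x at once. *)
Lemma integral_powR_near (A kappa rho : R) : 0 <= A -> 0 < rho < kappa ->
  exists2 C : R, 0 <= C & forall (D : set T) (w : T -> R), measurable D ->
    measurable_fun D w -> (forall x, D x -> 0 <= w x) ->
    (forall t, 0 < t ->
      (mu (D `&` [set x | (w x < t)%R]) <= (A * t `^ kappa)%:E)%E) ->
    forall t, 0 < t ->
    (\int[mu]_(x in D `&` [set x | (w x < t)%R]) (w x `^ (- rho))%:E <=
      (C * t `^ (kappa - rho))%:E)%E.
Proof.
move=> A0 /andP[rho0 rhok].
pose q := (2^-1 : R) `^ (kappa - rho).
have q1 : 0 <= q < 1.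
  rewrite powR_ge0/= /q -[ltRHS](_ : 1 `^ (kappa - rho) = 1); last by rewrite powR1.
  rewrite gt0_ltr_powR ?nnegrE ?subr_gt0//; lra.
exists (A * 2 `^ rho / (1 - q)).
  by rewrite divr_ge0 ?mulr_ge0 ?powR_ge0// subr_ge0; case/andP: q1 => _ /ltW.
move=> D w mD mw w0 muw t t0.
have mDt b : measurable (D `&` [set x | (w x < b)%R]).
  rewrite (_ : [set x | _] = w @^-1` `]-oo, b[%classic); first exact: mw.
  by apply/seteqP; split=> x /=; rewrite in_itv.
pose E k := D `&` (w @^-1` `[t * 2^-1 ^+ k.+1, t * 2^-1 ^+ k[%classic).
rewrite (_ : (A * _ / _ * _) = (A * 2 `^ rho * t `^ (kappa - rho)) / (1 - q)); last by ring.
apply: (@shell_integral _ _ _ mu _ _ E (fun k => (t * 2^-1 ^+ k.+1) `^ (- rho))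
  (fun k => A * (t * 2^-1 ^+ k) `^ kappa)) => //.
- by move=> k; exact: mw.
- by move=> k; exact: powR_ge0.
- by rewrite !mulr_ge0 ?powR_ge0.
- by move=> x _; rewrite lee_fin powR_ge0.
- move=> x [Dx /= wt].
  (* A negative power of 0 is 0 by convention, so the zero set of w contributes nothing. *)
  have [->|wx0] := eqVneq (w x) 0.
    by rewrite powR0 ?eqxx// oppr_eq0 gt_eqF.
  have wp : 0 < w x by rewrite lt_neqAle eq_sym wx0 w0.
  move=> _.
  have exk : exists k, t * 2^-1 ^+ k.+1 <= w x.
    have [k kw] := @half_pow_le R (w x / t) (ltac:(by rewrite divr_gt0)).
    exists k; rewrite mulrC -ler_pdivlMr//; apply: le_trans kw.
    by rewrite exprS ler_piMl ?exprn_ge0//; lra.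
  pose k := ex_minn exk.
  have kP : t * 2^-1 ^+ k.+1 <= w x /\ w x < t * 2^-1 ^+ k.
    rewrite /k; case: ex_minnP => -[|m] mP mmin; split => //.
      by rewrite expr0 mulr1.
    by rewrite ltNge; apply/negP => /mmin; rewrite ltnn.
  exists k.
    by split => //=; rewrite in_itv/=; case: kP => -> ->.
  rewrite lee_fin powRN_le ?(ltW rho0) ?mulr_gt0 ?exprn_gt0//.
  by case: kP.
- move=> k; apply: le_trans (muw (t * 2^-1 ^+ k) _); last first.
    by rewrite mulr_gt0 ?exprn_gt0.
  apply: le_measure; rewrite ?inE//.
    by apply: measurableI => //; exact: mw.
  by move=> x [[_ _] [Dx /=]]; rewrite in_itv/= => /andP[].
- move=> k.
  rewrite !powRM ?exprn_ge0 ?(ltW t0)//; do 2?lra.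
  rewrite !powR_exprn; do 2?lra.
  have h2 : (2^-1 : R) `^ (- rho) = 2 `^ rho.
    by rewrite -powR_inv1// -powRrM mulN1r opprK.
  rewrite /q !powRDp ?invr_gt0// exprMn exprS h2.
  rewrite [leLHS](_ : _ = A * 2 `^ rho * (t `^ kappa * t `^ (- rho)) *
     (((2^-1) `^ kappa) ^+ k * (2 `^ rho) ^+ k))//.
  by ring.
Qed.

(** The same argument with the shells t 2^k <= w < t 2^(k+1): now rho > kappa, and the decay of the
    integrand beats the growth of the volume. *)
Lemma integral_powR_far (A kappa rho : R) : 0 <= A -> 0 <= kappa < rho ->
  exists2 C : R, 0 <= C & forall (D : set T) (w : T -> R), measurable D ->
    measurable_fun D w -> (forall x, D x -> 0 <= w x) ->
    (forall t, 0 < t ->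
      (mu (D `&` [set x | (w x < t)%R]) <= (A * t `^ kappa)%:E)%E) ->
    forall t, 0 < t ->
    (\int[mu]_(x in D `&` [set x | (t <= w x)%R]) (w x `^ (- rho))%:E <=
      (C * t `^ (kappa - rho))%:E)%E.
Proof.
move=> A0 /andP[k0 rhok].
pose q := (2 : R) `^ (kappa - rho).
have q1 : 0 <= q < 1.
  rewrite powR_ge0/= /q -[ltRHS](powRr0 2); apply: lt_le_trans (_ : 2 `^ 0 <= _) => //.
  by rewrite /powR pnatr_eq0/= ltr_expR ltr_pM2r ?ln_gt0 ?ltr1n// subr_lt0.
exists (A * 2 `^ kappa / (1 - q)).
  by rewrite divr_ge0 ?mulr_ge0 ?powR_ge0// subr_ge0; case/andP: q1 => _ /ltW.
move=> D w mD mw w0 muw t t0.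
have mDt b : measurable (D `&` [set x | (b <= w x)%R]).
  rewrite (_ : [set x | _] = w @^-1` `[b, +oo[%classic); first exact: mw.
  by apply/seteqP; split=> x /=; rewrite in_itv/= ?andbT.
have mDt' b : measurable (D `&` [set x | (w x < b)%R]).
  rewrite (_ : [set x | _] = w @^-1` `]-oo, b[%classic); first exact: mw.
  by apply/seteqP; split=> x /=; rewrite in_itv.
pose E k := D `&` (w @^-1` `[t * 2 ^+ k, t * 2 ^+ k.+1[%classic).
rewrite (_ : (A * _ / _ * _) = (A * 2 `^ kappa * t `^ (kappa - rho)) / (1 - q)); last by ring.
have rho0 : 0 < rho by exact: le_lt_trans rhok.
apply: (@shell_integral _ _ _ mu _ _ E (fun k => (t * 2 ^+ k) `^ (- rho))
  (fun k => A * (t * 2 ^+ k.+1) `^ kappa)) => //.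
- by move=> k; exact: mw.
- by move=> k; exact: powR_ge0.
- by rewrite !mulr_ge0 ?powR_ge0.
- by move=> x _; rewrite lee_fin powR_ge0.
- move=> x [Dx /= wt] _.
  have exk : exists k, w x < t * 2 ^+ k.+1.
    have [k kw] := @two_pow_ge R (w x / t).
    exists k; rewrite mulrC -ltr_pdivrMr//; apply: le_lt_trans kw _.
    by rewrite exprS ltr_pMl ?exprn_gt0// ltr1n.
  pose k := ex_minn exk.
  have kP : t * 2 ^+ k <= w x /\ w x < t * 2 ^+ k.+1.
    rewrite /k; case: ex_minnP => -[|m] mP mmin; split => //.
      by rewrite expr0 mulr1.
    by rewrite leNgt; apply/negP => /mmin; rewrite ltnn.
  exists k.
    by split => //=; rewrite in_itv/=; case: kP => -> ->.
  rewrite lee_fin powRN_le ?(ltW rho0) ?mulr_gt0 ?exprn_gt0//.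
  by case: kP.
- move=> k; apply: le_trans (muw (t * 2 ^+ k.+1) _); last first.
    by rewrite mulr_gt0 ?exprn_gt0.
  apply: le_measure; rewrite ?inE//.
    by apply: measurableI => //; exact: mw.
  by move=> x [[_ _] [Dx /=]]; rewrite in_itv/= => /andP[].
- move=> k.
  rewrite !powRM ?exprn_ge0 ?(ltW t0)//.
  rewrite !powR_exprn//.
  rewrite /q !powRDp// exprMn exprS.
  rewrite [leRHS](_ : _ = (t `^ (- rho) * 2 `^ (- rho) ^+ k *
     (A * (t `^ kappa * (2 `^ kappa * 2 `^ kappa ^+ k)))))//.
  by ring.
Qed.

End layers.

(** * Euclidean space *)

Section euclidean_norm.
Context (R : realType) (n : nat).
Local Notation E := 'rV[R]_n.
Implicit Types (x y z v : E) (t : R).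

Lemma dotpC x y : dotp x y = dotp y x.
Proof. by apply: eq_bigr => i _; rewrite mulrC. Qed.

Lemma dotpDl x y z : dotp (x + y) z = dotp x z + dotp y z.
Proof. by rewrite -big_split; apply: eq_bigr => i _; rewrite mxE mulrDl. Qed.

Lemma dotpZl t x z : dotp (t *: x) z = t * dotp x z.
Proof. by rewrite /dotp big_distrr; apply: eq_bigr => i _; rewrite mxE -mulrA. Qed.

Lemma dotpNl x z : dotp (- x) z = - dotp x z.
Proof. by rewrite -scaleN1r dotpZl mulN1r. Qed.

Lemma dotpBl x y z : dotp (x - y) z = dotp x z - dotp y z.
Proof. by rewrite dotpDl dotpNl. Qed.

Lemma dotp_ge0 x : 0 <= dotp x x.
Proof. by apply: sumr_ge0 => i _; rewrite -expr2 sqr_ge0. Qed.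

Lemma enorm_ge0 x : 0 <= enorm x.
Proof. exact: sqrtr_ge0. Qed.

Lemma sqr_enorm x : enorm x ^+ 2 = dotp x x.
Proof. by rewrite sqr_sqrtr// dotp_ge0. Qed.

Lemma enormN x : enorm (- x) = enorm x.
Proof. by rewrite /enorm dotpNl dotpC dotpNl opprK. Qed.

Lemma enormB x y : enorm (x - y) = enorm (y - x).
Proof. by rewrite -enormN opprB. Qed.

Lemma enormZ t x : enorm (t *: x) = `|t| * enorm x.
Proof.
by rewrite /enorm dotpZl dotpC dotpZl mulrA -expr2 sqrtrM ?sqr_ge0// sqrtr_sqr.
Qed.

Lemma dotp_le x y : `|dotp x y| <= enorm x * enorm y.
Proof.
rewrite -(ler_pXn2r (ltn0Sn 1)) ?nnegrE ?mulr_ge0 ?enorm_ge0 ?normr_ge0//.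
rewrite exprMn !sqr_enorm real_normK ?num_real//.
have H (a b : R) : 0 <= a * a * dotp y y - 2 * (a * b * dotp x y) + b * b * dotp x x.
  have := dotp_ge0 (a *: y - b *: x); congr (0 <= _).
  rewrite dotpBl !dotpZl (dotpC y) (dotpC x (_ - _)) !dotpBl !dotpZl (dotpC y x).
  ring.
have [yy0|yy0] := eqVneq (dotp y y) 0.
  suff -> : dotp x y = 0 by rewrite expr0n/= mulr_ge0 ?dotp_ge0.
  apply: big1 => i _.
  have /eqP : y ord0 i * y ord0 i = 0.
    apply/eqP; rewrite eq_le -expr2 sqr_ge0 andbT -yy0 /dotp (bigD1 i)//= expr2.
    by rewrite lerDl sumr_ge0// => j _; rewrite -expr2 sqr_ge0.
  by rewrite mulf_eq0 orbb => /eqP ->; rewrite mulr0.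
have yp : 0 < dotp y y by rewrite lt_neqAle eq_sym yy0 dotp_ge0.
have := H (dotp x y) (dotp y y).
rewrite [X in 0 <= X](_ : _ = dotp y y * (dotp x x * dotp y y - dotp x y ^+ 2)); last by ring.
by rewrite pmulr_rge0// subr_ge0.
Qed.

Lemma enormD x y : enorm (x + y) <= enorm x + enorm y.
Proof.
rewrite -(ler_pXn2r (ltn0Sn 1)) ?nnegrE ?addr_ge0 ?enorm_ge0//.
rewrite sqrrD !sqr_enorm dotpDl !(dotpC _ (x + y)) !dotpDl (dotpC y x).
have := ler_norm (dotp x y); have := dotp_le x y; lra.
Qed.

Lemma enorm_triangle z x y : enorm (x - y) <= enorm (x - z) + enorm (z - y).
Proof. by rewrite (le_trans _ (enormD _ _))// addrA subrK. Qed.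

Lemma coord_le_enorm x i : `|x ord0 i| <= enorm x.
Proof.
rewrite -sqrtr_sqr ler_wsqrtr// /dotp (bigD1 i)//= -expr2 lerDl.
by apply: sumr_ge0 => j _; rewrite -expr2 sqr_ge0.
Qed.

Lemma coord_le_norm x i : `|x ord0 i| <= `|x|.
Proof.
by rewrite [leRHS]/Num.norm /= mx_normrE; apply/bigmax_geP; right => /=; exists (ord0, i).
Qed.

Lemma norm_le_coord x t : 0 <= t -> (forall i, `|x ord0 i| <= t) -> `|x| <= t.
Proof.
move=> t0 xt; rewrite [leLHS]/Num.norm /= mx_normrE; apply/bigmax_leP; split => //=.
by move=> [a i] _ /=; rewrite ord1.
Qed.

Lemma norm_lt_coord x t : 0 < t -> (forall i, `|x ord0 i| < t) -> `|x| < t.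
Proof.
move=> t0 xt; rewrite [ltLHS]/Num.norm /= mx_normrE; apply/bigmax_ltP; split => //=.
by move=> [a i] _ /=; rewrite ord1.
Qed.

Lemma norm_le_enorm x : `|x| <= enorm x.
Proof. by apply: norm_le_coord => [|i]; rewrite ?enorm_ge0// coord_le_enorm. Qed.

Lemma enorm_le_norm x : enorm x <= n%:R * `|x|.
Proof.
have [n0|n0] := eqVneq n 0%N; last first.
  rewrite -(ler_pXn2r (ltn0Sn 1)) ?nnegrE ?mulr_ge0 ?enorm_ge0 ?ler0n//.
  rewrite sqr_enorm; apply: (@le_trans _ _ (\sum_(i < n) `|x| ^+ 2)).
    apply: ler_sum => i _; rewrite -expr2 -real_normK ?num_real//.
    by rewrite ler_pXn2r ?nnegrE ?normr_ge0// coord_le_norm.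
  rewrite sumr_const card_ord exprMn -[leLHS]mulr_natl ler_wpM2r ?sqr_ge0//.
  by rewrite expr2 ler_peMl ?ler0n// ler1n lt0n.
rewrite /enorm /dotp big1 ?sqrtr0 ?mulr_ge0 ?ler0n// => -[i i0].
by exfalso; rewrite n0 in i0.
Qed.

Lemma enorm_eq0 x : (enorm x == 0) = (x == 0).
Proof.
apply/idP/eqP => [/eqP x0|->].
  by apply/eqP; rewrite -normr_le0 -x0 norm_le_enorm.
by rewrite -(scale0r 0) enormZ normr0 mul0r.
Qed.

Lemma enorm0 : enorm (0 : E) = 0.
Proof. by apply/eqP; rewrite enorm_eq0. Qed.

Lemma enorm_gt0 x y : x <> y -> 0 < enorm (x - y).
Proof.
by move=> /eqP xy; rewrite lt_neqAle eq_sym enorm_eq0 subr_eq0 xy enorm_ge0.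
Qed.

Lemma nbhs_enormP x (A : set E) :
  nbhs x A <-> exists2 e, 0 < e & forall y, enorm (x - y) < e -> A y.
Proof.
split=> [/nbhs_ballP[e e0 xA]|[e e0 xA]].
  exists e => // y xy; apply: xA; rewrite -ball_normE /ball_/=.
  exact: le_lt_trans (norm_le_enorm _) xy.
(* The euclidean norm is at most n times the sup norm; dividing by n + 1 keeps the radius positive
   also for n = 0. *)
apply/nbhs_ballP; exists (e / (n%:R + 1)) => /=.
  by rewrite divr_gt0// ltr_wpDl// ler0n.
move=> y; rewrite -ball_normE /ball_/= => xy; apply: xA.
apply: le_lt_trans (enorm_le_norm _) _.
have n1 : 0 < n%:R + 1 :> R by rewrite ltr_wpDl// ler0n.
move: xy; rewrite ltr_pdivlMr// => xy; apply: le_lt_trans xy.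
by rewrite mulrC ler_wpM2l// lerDl.
Qed.

Lemma open_enormP (A : set E) : open A ->
  forall x, A x -> exists2 e, 0 < e & forall y, enorm (x - y) < e -> A y.
Proof. by rewrite openE => oA x /oA /nbhs_enormP. Qed.

Lemma enorm_openP (A : set E) :
  (forall x, A x -> exists2 e, 0 < e & forall y, enorm (x - y) < e -> A y) ->
  open A.
Proof. by move=> H; rewrite openE => x /H Ax; apply/nbhs_enormP. Qed.

Lemma closure_enormP (A : set E) x :
  closure A x <-> forall e, 0 < e -> exists2 y, A y & enorm (x - y) < e.
Proof.
split=> [clA e e0|H B /nbhs_enormP[e e0 xB]].
  have [|y [Ay xy]] := clA [set y | enorm (x - y) < e]; last by exists y.
  by apply/nbhs_enormP; exists e.
by have [y Ay xy] := H _ e0; exists y; split => //; exact: xB.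
Qed.

Lemma open_ball x t : open [set y : E | enorm (x - y) < t].
Proof.
apply: enorm_openP => y /= xy; exists (t - enorm (x - y)); first by rewrite subr_gt0.
by move=> z yz; rewrite (le_lt_trans (enorm_triangle y x z))// -ltrBrDl.
Qed.

Lemma bounded_enorm (A : set E) : bounded_set A ->
  exists2 M, 0 < M & forall x, A x -> enorm x <= M.
Proof.
move=> /pinfty_ex_gt0[M M0 AM]; exists (n%:R * M + 1).
  by rewrite ltr_wpDl// mulr_ge0 ?ler0n// ltW.
move=> x Ax; rewrite (le_trans (enorm_le_norm _))//.
by rewrite -[leLHS]addr0 lerD// ler_wpM2l ?ler0n//; exact: AM.
Qed.

End euclidean_norm.

Section measurable_row_sets.
Context (R : realType) (n : nat).
Local Notation E := 'rV[R]_n.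
Local Notation leb := (lebesgue_row R n).

Lemma measurable_coord_box (A : 'I_n -> set R) :
  (forall i, measurable (A i : set (measurableTypeR R))) ->
  measurable [set x : E | forall i, A i (x ord0 i)].
Proof.
move=> mA; rewrite (_ : mkset _ = \bigcap_(i in [set: 'I_n])
    (@row_coord R n i @^-1` A i)); last first.
  by apply/seteqP; split => x /= H i; [move=> _|]; exact: H.
apply: fin_bigcap_measurable => // i _.
rewrite -[X in measurable X]setTI; exact: (@measurable_row_coord R n i measurableT).
Qed.

(** A countable base of the topology made of coordinate boxes: it connects open sets with a
    sigma-algebra that is generated by the coordinates. *)
Definition rational_box (p : 'rV[rat]_n * nat) : set E :=
  [set x | forall i, `](ratr (p.1 ord0 i) - p.2.+1%:R^-1),
                       (ratr (p.1 ord0 i) + p.2.+1%:R^-1)[%classic (x ord0 i)].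

Lemma open_measurable_row (U : set E) : open U -> measurable U.
Proof.
move=> oU.
pose F p := if `[< rational_box p `<=` U >] then rational_box p else set0.
rewrite (_ : U = \bigcup_p F p).
  apply: countable_bigcupT_measurable => // p; rewrite /F; case: ifP => // _.
  apply: (@measurable_coord_box (fun i => `](ratr (p.1 ord0 i) - p.2.+1%:R^-1),
                       (ratr (p.1 ord0 i) + p.2.+1%:R^-1)[%classic)) => i.
  exact: measurable_itv.
apply/seteqP; split => [x Ux|x [p _]]; last first.
  by rewrite /F; case: asboolP => // pU /pU.
have [e e0 xU] : exists2 e, 0 < e & forall y, `|x - y| < e -> U y.
  move: oU; rewrite openE => /(_ _ Ux)/nbhs_ballP[e e0 xU]; exists e => // y xy.
  by apply: xU; rewrite -ball_normE.
have [k ke] : exists k : nat, k.+1%:R^-1 < e / 2.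
  have e20 : 0 < (e / 2)^-1 by rewrite invr_gt0 divr_gt0.
  have ke := archi_boundP (ltW e20); exists (Num.bound (e / 2)^-1).
  rewrite -[ltRHS]invrK ltf_pV2 ?posrE//.
  by rewrite (lt_le_trans ke)// ler_nat.
have k0 : (0 : R) < k.+1%:R^-1 by rewrite invr_gt0.
have /choice[q qP] : forall i, exists q : rat, `|x ord0 i - ratr q| < k.+1%:R^-1.
  move=> i.
  have [|q] := @rat_in_itvoo R (x ord0 i - k.+1%:R^-1) (x ord0 i + k.+1%:R^-1).
    by rewrite ltrD2l gtrN.
  rewrite in_itv/= => /andP[q1 q2]; exists q.
  by rewrite distrC ltr_distl q1 q2.
exists (\row_i q i, k) => //; rewrite /F; case: asboolP => [_|].
  move=> i /=; rewrite mxE in_itv/=; by rewrite -ltr_distl.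
case => y; rewrite /rational_box/= => yp; apply: xU.
apply: norm_lt_coord => // i; rewrite !mxE.
have := yp i; have := qP i; rewrite mxE in_itv/=; move: (ratr (q i)) => r.
rewrite -ltr_distl => xr yr; rewrite (le_lt_trans (ler_distD r _ _))//.
by rewrite (distrC r) [ltRHS]splitr ltrD// (lt_trans _ ke).
Qed.

Lemma closed_measurable_row (U : set E) : closed U -> measurable U.
Proof.
by move=> cU; rewrite -(setCK U); apply: measurableC; apply: open_measurable_row; exact: closed_openC.
Qed.

Lemma measurable_ball_row (x : E) (t : R) :
  measurable [set y : E | enorm (x - y) < t].
Proof. exact: (open_measurable_row (@open_ball R n x t)). Qed.

Lemma measurable_enorm_diff :
  measurable_fun setT (fun z : E * E => enorm (z.1 - z.2)).
Proof.
rewrite (_ : (fun _ => _) = (fun z : E * E => dotp (z.1 - z.2) (z.1 - z.2) `^ 2^-1)).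
  apply: (@measurableT_comp _ _ _ _ _ _ (@powR R ^~ 2^-1)).
    exact: measurable_powR.
  apply: measurable_sum => i.
  have H : measurable_fun setT (fun z : E * E => (z.1 - z.2) ord0 i).
    under eq_fun do rewrite !mxE.
    apply: measurable_funB.
      by apply: measurableT_comp (@measurable_row_coord R n i) _.
    by apply: measurableT_comp (@measurable_row_coord R n i) _.
  exact: measurable_funM.
by apply/funext => z; rewrite powR12_sqrt// dotp_ge0.
Qed.

(** The ball lies in the cube of side 2t. Later only the exponent matters, hence the crude constant;
    n appears as a real exponent to fit [md_growth]. *)
Lemma lebesgue_row_ball (x : E) (t : R) : 0 < t ->
  (leb [set y : E | (enorm (x - y) < t)%R] <= (2 ^+ n * t `^ n%:R)%:E)%E.
Proof.
move=> t0.
pose A (i : 'I_n) := `](x ord0 i - t), (x ord0 i + t)[%classic.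
apply: (@le_trans _ _ (leb [set y | forall i, A i (y ord0 i)])).
  apply: le_measure; rewrite ?inE.
  - exact: measurable_ball_row.
  - by apply: (@measurable_coord_box A) => i; exact: measurable_itv.
  - move=> y /= xy i; rewrite /A/= in_itv/=.
    have := le_lt_trans (coord_le_enorm _ i) xy.
    by rewrite !mxE ltr_norml => /andP[? ?]; apply/andP; split; lra.
rewrite lebesgue_row_box; last by move=> i; exact: measurable_itv.
have H (i : 'I_n) : (lebesgue_measure (A i) = (2 * t)%:E)%E.
  rewrite lebesgue_measure_itv/= lte_fin ifT; last by lra.
  by rewrite -EFinD; congr EFin; ring.
under eq_bigr do rewrite H.
by rewrite prodEFin prodr_const card_ord exprMn powR_mulrn// ltW.
Qed.

Lemma lebesgue_row_bounded (A : set E) : measurable A -> bounded_set A ->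
  (leb A < +oo)%E.
Proof.
move=> mA /bounded_enorm[M M0 AM].
apply: le_lt_trans (ltry (2 ^+ n * (M + 1) `^ n%:R)).
apply: le_trans (_ : leb [set y : E | (enorm (0 - y) < M + 1)%R] <= _)%E; last first.
  by apply: lebesgue_row_ball; lra.
apply: le_measure; rewrite ?inE//.
  exact: measurable_ball_row.
by move=> y /AM /= yM; rewrite sub0r enormN; lra.
Qed.

Lemma lebesgue_row_set1 (x : E) : (0 < n)%N -> leb [set x] = 0%E.
Proof.
move=> n0.
rewrite (_ : [set x] = [set y : E | forall i, [set x ord0 i] (y ord0 i)]).
  rewrite (@lebesgue_row_box _ _ (fun i => [set x ord0 i]))//.
  rewrite (bigD1 (Ordinal n0))//= lebesgue_measure_set1 mul0e//.
apply/seteqP; split => [y /= ->//|y /= H]; apply/rowP => i.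
by rewrite H.
Qed.

Lemma measurable_set1_row (x : E) : measurable [set x].
Proof.
rewrite (_ : [set x] = [set y : E | forall i, [set x ord0 i] (y ord0 i)]).
  exact: (@measurable_coord_box (fun i => [set x ord0 i])).
by apply/seteqP; split => [y /= ->//|y /= H]; apply/rowP => i; rewrite H.
Qed.

Lemma measurable_lipschitz_row (f : E -> R) :
  (forall x y, `|f x - f y| <= enorm (x - y)) -> measurable_fun setT f.
Proof.
move=> fL; apply: (measurability (@RGenOpens.G R)); first exact: RGenOpens.measurableE.
move=> _ [_ [a [b ->] <-]]; rewrite setTI; apply: open_measurable_row.
apply: enorm_openP => x /=; rewrite in_itv/= => /andP[ax xb].
exists (Num.min (f x - a) (b - f x)); first by rewrite lt_min !subr_gt0 ax.
move=> y; rewrite lt_min => /andP[xy1 xy2]; rewrite in_itv/=.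
have := fL x y; rewrite ler_norml => /andP[? ?].
by apply/andP; split; lra.
Qed.

End measurable_row_sets.

Section distance.
Context (R : realType) (n : nat).
Local Notation E := 'rV[R]_n.
Implicit Types (A K U : set E) (x y z : E) (t : R).

Lemma dist_to_has_lbound A x : has_lbound [set enorm (x - y) | y in A].
Proof. by exists 0 => _ [y _ <-]; exact: enorm_ge0. Qed.

(** The infimum of the empty set is 0 by convention, so the empty set has distance 0, and not +oo,
    from every point. This is why it is treated apart below. *)
Lemma dist_to0 x : dist_to set0 x = 0.
Proof. by rewrite /dist_to image_set0 inf0. Qed.

Lemma dist_to_ge0 A x : 0 <= dist_to A x.
Proof.
have [->|/set0P[z Az]] := eqVneq A set0; first by rewrite dist_to0.
apply: lb_le_inf; first by exists (enorm (x - z)); exists z.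
by move=> _ [y _ <-]; exact: enorm_ge0.
Qed.

Lemma dist_to_le A x z : A z -> dist_to A x <= enorm (x - z).
Proof. by move=> Az; apply: ge_inf; [exact: dist_to_has_lbound|exists z]. Qed.

Lemma dist_to_lt A x t : A !=set0 -> dist_to A x < t ->
  exists2 z, A z & enorm (x - z) < t.
Proof.
move=> [z0 Az0] /inf_lt; case.
  by exists (enorm (x - z0)); exists z0.
by move=> _ [z Az <-] zt; exists z.
Qed.

Lemma dist_to_lip A x y : `|dist_to A x - dist_to A y| <= enorm (x - y).
Proof.
have [->|/set0P[z0 Az0]] := eqVneq A set0.
  by rewrite !dist_to0 subrr normr0 enorm_ge0.
have H a b : dist_to A a - enorm (a - b) <= dist_to A b.
  apply: lb_le_inf; first by exists (enorm (b - z0)); exists z0.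
  move=> _ [z Az <-]; rewrite lerBlDl; apply: le_trans (enorm_triangle b a z).
  exact: dist_to_le.
by rewrite ler_norml lerBlDr -[X in _ && X]lerBlDl; apply/andP; split;
  [have := H y x|have := H x y]; rewrite ?(enormB y); lra.
Qed.

Lemma lipschitz_continuous_row (f : E -> R) :
  (forall x y, `|f x - f y| <= enorm (x - y)) -> continuous f.
Proof.
move=> fL x A /nbhs_ballP[e e0 xA]; apply/nbhs_enormP; exists e => // y xy.
by apply: xA; exact: le_lt_trans xy.
Qed.

(** The image of K is compact, hence closed, and misses 0; so a whole interval around 0 misses it.
    In this form the empty K needs no special treatment. *)
Lemma compact_pos_min K (f : E -> R) : compact K ->
  (forall x y, `|f x - f y| <= enorm (x - y)) ->
  (forall x, K x -> 0 < f x) -> exists2 c, 0 < c & forall x, K x -> c <= f x.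
Proof.
move=> cK fL f0.
have : compact [set f x | x in K].
  apply: continuous_compact => //; apply: continuous_subspaceT.
  exact: lipschitz_continuous_row.
move=> /(compact_closed (@Rhausdorff R)) /closed_openC /=.
rewrite openE => /(_ 0) /= [|]; first by move=> [x /f0] /[swap] ->; rewrite ltxx.
move=> e /= e0 He; exists e => // x Kx; rewrite leNgt; apply/negP => fe.
by apply: (He (f x)); [rewrite /ball_/= sub0r normrN gtr0_norm// f0|exists x].
Qed.

Lemma compact_lebesgue_number K U : compact K -> open U -> K `<=` U ->
  exists2 e, 0 < e & forall x y, K x -> enorm (x - y) < e -> U y.
Proof.
move=> cK oU KU.
(* If U is the whole space, the distance to its complement is 0 by convention and a radius is given
   by hand. *)
have [U0|/set0P[z0 Uz0]] := eqVneq (~` U) set0.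
  by exists 1 => // x y _ _; rewrite -(setCK U) U0.
have [|e e0 He] := compact_pos_min cK (dist_to_lip (~` U)).
  move=> x /KU Ux; have [e e0 He] := open_enormP oU Ux.
  apply: lt_le_trans e0 _; apply: lb_le_inf.
    by exists (enorm (x - z0)); exists z0.
  by move=> _ [y Uy <-]; rewrite leNgt; apply/negP => /He.
exists e => // x y /He ex xy; apply: contrapT => Uy.
by have := dist_to_le x (Uy : (~` U) y); rewrite leNgt (lt_le_trans xy ex).
Qed.

Lemma compact_bounded_enorm K : compact K ->
  exists2 M, 0 < M & forall x, K x -> enorm x <= M.
Proof. by move=> /compact_bounded /bounded_enorm. Qed.

Lemma compact_measurable_row K : compact K -> measurable K.
Proof.
move=> cK; apply: closed_measurable_row; apply: compact_closed => //.
Qed.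

Lemma compact_thicken K U : compact K -> open U -> K `<=` U ->
  exists (K0 : set E) (e : R), [/\ 0 < e, compact K0, K0 `<=` U &
    forall x y, K x -> enorm (x - y) < e -> K0 y].
Proof.
move=> cK oU KU.
(* For empty K the function [dist_to K] is identically 0, and its sublevel set would be the whole
   space. *)
have [K0|/set0P[z0 Kz0]] := eqVneq K set0.
  by exists set0, 1; split => //; [exact: compact0 | rewrite K0].
have [e e0 He] := compact_lebesgue_number cK oU KU.
have [M M0 KM] := compact_bounded_enorm cK.
have e2 : 0 < e / 2 by rewrite divr_gt0.
exists [set y | dist_to K y <= e / 2], (e / 2).
have near y : dist_to K y <= e / 2 -> exists2 x, K x & enorm (y - x) < e.
  by move=> ye; apply: dist_to_lt; [exists z0|lra].
split => //.
- apply: bounded_closed_compact.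
    exists (M + e); split; first exact: num_real.
    move=> b Mb y /= /near[x Kx yx].
    rewrite (le_trans (norm_le_enorm _))//.
    rewrite -[y](subrK x) (le_trans (enormD _ _))//.
    have := KM _ Kx; lra.
  rewrite (_ : [set y | _] = dist_to K @^-1` [set r | r <= e / 2])//.
  apply: closed_comp; last exact: closed_le.
  by move=> y _; apply: lipschitz_continuous_row; exact: dist_to_lip.
- by move=> y /= /near[x Kx yx]; apply: (He x) => //; rewrite enormB.
- move=> x y Kx xy /=; apply: le_trans (dist_to_le _ Kx) _.
  by rewrite enormB ltW.
Qed.

End distance.

(** * Volume of the boundary strip *)

Section sections_measure.
Context (R : realType).

Lemma lebesgue_measure_diam (A : set (measurableTypeR R)) (eta : R) : measurable A -> 0 <= eta ->
  (forall a b, A a -> A b -> `|a - b| <= eta) ->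
  (lebesgue_measure A <= (2 * eta)%:E)%E.
Proof.
move=> mA eta0 Aeta.
have [->|/set0P[a Aa]] := eqVneq A set0.
  by rewrite measure0 lee_fin mulr_ge0.
apply: (@le_trans _ _ (lebesgue_measure `[a - eta, a + eta]%classic)).
  apply: le_measure; rewrite ?inE//;
  move=> b Ab /=; rewrite in_itv/=; have := Aeta _ _ Aa Ab.
  by rewrite ler_norml => /andP[? ?]; apply/andP; split; lra.
rewrite lebesgue_measure_itv/= lte_fin.
case: ifPn => _; last by rewrite lee_fin mulr_ge0.
by rewrite -EFinD lee_fin; lra.
Qed.

(** Cavalieri's principle with one thin direction i, by induction along the construction of the
    measure, which peels off the first coordinate. If i is another coordinate, the slices at fixed
    first coordinate satisfy the induction hypothesis; if i is the first one, Tonelli slices along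
    it and the thin lengths are integrated over the box of the remaining coordinates. *)
Lemma lebesgue_row_sections (n : nat) (S : set 'rV[R]_n) (i : 'I_n)
    (z : 'rV[R]_n) (l eta : R) : measurable S -> 0 <= l -> 0 <= eta ->
  (forall x, S x -> forall j, `|x ord0 j - z ord0 j| <= l) ->
  (forall x tau, S x -> S (x + tau *: delta_mx ord0 i) -> `|tau| <= eta) ->
  (lebesgue_row R n S <= (2 * eta * (2 * l) ^+ n.-1)%:E)%E.
Proof.
elim: n S i z => [S []//|n IH S i z mS l0 eta0 Sl Seta].
rewrite /= /cons_measure.
pose S' := @row_cons R n @^-1` S.
have mS' : measurable S'.
  by rewrite -[X in measurable X]setTI; exact: measurable_row_cons.
rewrite -/S'.
have [j ij|i0] := unliftP ord0 i.
- rewrite /product_measure1 /=.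
  have n0 : (0 < n)%N by case: n j {IH S i z mS Sl Seta S' mS' ij} => [[]|].
  pose I0 : set (measurableTypeR R) := `[z ord0 ord0 - l, z ord0 ord0 + l]%classic.
  pose c0 := 2 * eta * (2 * l) ^+ n.-1.
  apply: (@le_trans _ _ (\int[lebesgue_measure]_(x in I0) (c0%:E))%E).
    rewrite [leRHS]integral_mkcond; apply: le_integral_nonneg => // x _.
    rewrite patchE; case: ifPn => [_|/negP xz].
      apply: (IH _ j (\row_k z ord0 (lift ord0 k))) => //.
      - exact: measurable_xsection.
      - move=> v; rewrite /xsection/= inE => Sv k.
        have := Sl _ Sv (lift ord0 k); by rewrite !mxE liftK.
      - move=> v tau; rewrite /xsection/= !inE => Sv Sv'.
        apply: (Seta _ _ Sv); move: Sv'; rewrite /S'/=; congr (S _).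
        apply/rowP => k; rewrite !mxE ij eqxx/=.
        case: unliftP => [k' ->|->] /=.
          by rewrite !mxE (inj_eq lift_inj) eqxx.
        by rewrite mulr0 addr0.
    rewrite (_ : xsection S' x = set0) ?measure0//.
    rewrite -subset0 => v; rewrite /xsection/= inE => Sv.
    apply: xz; apply/mem_set; rewrite /I0/= in_itv/=.
    rewrite -ler_distl; by have := Sl _ Sv ord0; rewrite !mxE unlift_none.
  rewrite integral_cst; last exact: measurable_itv.
  rewrite /= /I0 lebesgue_measure_itv/= lte_fin.
  have K0 : 0 <= 2 * eta * (2 * l) ^+ n by rewrite !mulr_ge0 ?exprn_ge0 ?mulr_ge0.
  case: ifPn => _; last by rewrite mule0 lee_fin.
  rewrite -EFinD -EFinM lee_fin -[in leRHS](prednK n0) exprS.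
  by rewrite le_eqVlt; apply/orP; left; apply/eqP; rewrite /c0; ring.
- rewrite -(setIT S') -integral_indic// fubini_tonelli2//; last first.
    by apply/measurable_EFinP.
  rewrite /fubini_G.
  pose box := [set v : 'rV[R]_n | forall k,
    `[z ord0 (lift ord0 k) - l, z ord0 (lift ord0 k) + l]%classic (v ord0 k)].
  have mbox : measurable box.
    apply: (@measurable_coord_box R n (fun k => `[z ord0 (lift ord0 k) - l,
      z ord0 (lift ord0 k) + l]%classic)) => k; exact: measurable_itv.
  apply: (@le_trans _ _ (\int[lebesgue_row R n]_(v in box) (2 * eta)%:E)%E).
    rewrite [leRHS]integral_mkcond; apply: le_integral_nonneg.
      by move=> v _; apply: integral_ge0 => x _; rewrite lee_fin.
    move=> v _.
    rewrite (_ : (fun x => _) = (fun x => (\1_(ysection S' v) x)%:E)); last first.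
      apply/funext => x; rewrite !indicE; congr ((nat_of_bool _)%:R%:E).
      by rewrite mem_ysection.
    have mySv : measurable (ysection S' v) by exact: measurable_ysection.
    rewrite integral_indic// setIT patchE; case: ifPn => [_|/negP xz].
      apply: lebesgue_measure_diam => // a b.
      rewrite /ysection/= !inE => Sa Sb; rewrite distrC.
      apply: (Seta _ _ Sa); move: Sb; rewrite /S'/=; congr (S _).
      apply/rowP => k; rewrite !mxE i0 eqxx/=.
      case: unliftP => [k' ->|->] /=.
        by rewrite mulr0 addr0.
      by rewrite mulr1 addrC subrK.
    rewrite (_ : ysection S' v = set0) ?measure0//.
    rewrite -subset0 => x; rewrite /ysection/= inE => Sv.
    apply: xz; apply/mem_set => k /=; rewrite in_itv/=.
    rewrite -ler_distl; by have := Sl _ Sv (lift ord0 k); rewrite !mxE liftK.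
  rewrite integral_cst//.
  pose A0 (k : 'I_n) : set (measurableTypeR R) :=
    `[z ord0 (lift ord0 k) - l, z ord0 (lift ord0 k) + l]%classic.
  have boxE : lebesgue_row R n box = (\prod_(k < n) lebesgue_measure (A0 k))%E.
    by apply: (lebesgue_row_box (A := A0)) => k; exact: measurable_itv.
  apply: (@le_trans _ _ ((2 * eta)%:E * (\prod_(k < n) (2 * l)%:E))%E).
    apply: lee_wpmul2l; first by rewrite lee_fin mulr_ge0.
    apply: (@le_trans _ _ (\prod_(k < n) lebesgue_measure (A0 k))%E).
      by rewrite -boxE.
    rewrite (eq_bigr (fun=> (2 * l)%:E))// => k _.
    rewrite /A0 lebesgue_measure_itv/= lte_fin; case: ifPn => zl.
      by rewrite -EFinD; congr EFin; lra.
    by congr EFin; lra.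
  by rewrite prodEFin -EFinM prodr_const card_ord.
Qed.

End sections_measure.

Section charts.
Context (R : realType) (n : nat).
Local Notation E := 'rV[R]_n.
Implicit Types (x y z v w e p : E) (g : E -> R).

Lemma mean_value_row g p w : (forall x, differentiable g x) ->
  exists2 t : R, 0 <= t <= 1 & g (p + w) - g p = 'd g (p + t *: w) w.
Proof.
move=> dg.
pose h (t : R) := p + t *: w.
pose phi : R -> R := g \o h.
have dh t : is_diff t h (fun s => 0 + s *: w).
  rewrite /h; exact: is_diffD.
have dphi t : is_diff t phi ('d g (h t) \o (fun s => 0 + s *: w)).
  exact: is_diff_comp.
have dphi1 (t : R) : is_derive t (1 : R) phi ('d g (h t) w).
  apply: DeriveDef; first by apply: diff_derivable; exact: ex_diff.
  by rewrite deriveE; [rewrite diff_val /= scale1r add0r|exact: ex_diff].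
have cphi : {within `[0, 1], continuous phi}.
  apply: continuous_subspaceT => t.
  by apply: differentiable_continuous; exact: ex_diff.
have [c + Hc] := MVT_segment (ler01 : (0 : R) <= 1) (fun t _ => dphi1 t) cphi.
rewrite in_itv/= => c01; exists c => //; move: Hc.
by rewrite /phi /h /= scale1r scale0r addr0 subr0 mulr1.
Qed.

(** By the mean value theorem the increment is the derivative at a point of the segment from p to p
    + w, and this point stays within rho of z as a convex combination of the ends. Both ends move
    freely, as needed to compare two points of a boundary strip. *)
Lemma C11_strict_derivative g z (eps : R) : C11_function g -> 0 < eps ->
  exists2 rho, 0 < rho & forall p w, enorm (p - z) < rho ->
    enorm (p + w - z) < rho ->
    `|g (p + w) - g p - 'd g z w| <= eps * enorm w.
Proof.
move=> [dg [L HL]] eps0; pose L' := `|L| + 1.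
have L'0 : 0 < L' by rewrite ltr_wpDl.
exists (eps / L'); first by rewrite divr_gt0.
move=> p w pz pwz.
have [t /andP[t0 t1] ->] := mean_value_row p w dg.
apply: le_trans (HL _ _ _) _; apply: ler_wpM2r; first exact: enorm_ge0.
apply: (@le_trans _ _ (L' * enorm (p + t *: w - z))).
  apply: ler_wpM2r; first exact: enorm_ge0.
  by rewrite (le_trans (ler_norm _))// lerDl.
rewrite mulrC -ler_pdivlMr//; apply: ltW.
rewrite (_ : p + _ - _ = (1 - t) *: (p - z) + t *: (p + w - z)); last first.
  by apply/rowP => i; rewrite !mxE; ring.
apply: le_lt_trans (enormD _ _) _; rewrite !enormZ (ger0_norm t0) ger0_norm ?subr_ge0//.
move: pz pwz; set a := enorm _; set b := enorm _; set c := eps / L' => ac bc.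
by have [->|t0'] := eqVneq t 0; [lra|nra].
Qed.

Lemma enorm_delta (i : 'I_n) : enorm (delta_mx ord0 i : E) = 1.
Proof.
rewrite /enorm /dotp (bigD1 i)//= !mxE !eqxx mulr1 big1 ?addr0 ?sqrtr1// => j ji.
by rewrite !mxE eqxx /= (negbTE ji) mulr0.
Qed.

(** F(x) = x.e - g(Px) with P the projection along e, and A is its derivative at z. Since Pe = 0,
    A(e) = 1, so A cannot vanish on all coordinate vectors: some coordinate axis is transversal to
    the boundary near z, and it replaces the direction e of the chart. *)
Lemma boundary_chart (Om : set E) z : C11_open_set Om -> frontier Om z ->
  exists (F : E -> R) (A : {linear E -> R^o}) (i : 'I_n) (r : R),
  [/\ A (delta_mx ord0 i) != 0, 0 < r,
      forall x, enorm (x - z) < r -> (Om x <-> 0 < F x) &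
      forall eps, 0 < eps -> exists2 rho, 0 < rho &
        forall x v, enorm (x - z) < rho -> enorm (x + v - z) < rho ->
          `|F (x + v) - F x - A v| <= eps * enorm v].
Proof.
move=> [_ /(_ z) chart] /chart[r [e [g [r0 e1 Cg Hr]]]].
pose P x := x - dotp x e *: e.
have PD x y : P (x + y) = P x + P y.
  by rewrite /P dotpDl scalerDl opprD addrACA.
have PZ (t : R) x : P (t *: x) = t *: P x.
  by rewrite /P dotpZl scalerBr scalerA.
have PB x y : P (x - y) = P x - P y by rewrite PD -scaleN1r PZ scaleN1r.
have Ple x : enorm (P x) <= 2 * enorm x.
  rewrite /P (le_trans (enormD _ _))// enormN enormZ e1 mulr1.
  by have := dotp_le x e; rewrite e1 mulr1; lra.
pose A0 (v : E) : R^o := dotp v e - 'd g (P z) (P v).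
have A0lin : linear A0.
  move=> t x y; rewrite /A0 PD PZ dotpDl dotpZl linearP /=.
  by rewrite scalerBr /= /GRing.scale/=; ring.
pose Am := GRing.isLinear.Build _ _ _ _ A0 A0lin.
pose A : {linear E -> R^o} := HB.pack A0 Am.
have AE v : A v = dotp v e - 'd g (P z) (P v) by [].
have AZ (t : R) v : A (t *: v) = t * A v by exact: linearZ.
have [i Ai] : exists i, A (delta_mx ord0 i) != 0.
  apply: contrapT => /forallNP H.
  have : A e = 0.
    rewrite (row_sum_delta e) linear_sum big1// => i _.
    by rewrite AZ; have /negP/negPn/eqP -> := H i; rewrite mulr0.
  rewrite AE -sqr_enorm e1 expr1n /P -sqr_enorm e1 expr1n scale1r subrr linear0 subr0.
  by move/eqP; rewrite oner_eq0.
exists (fun x => dotp x e - g (P x)), A, i, r; split => //.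
  by move=> x xz; rewrite subr_gt0; exact: Hr.
move=> eps eps0.
(* P at most doubles lengths, which explains eps / 2 here and the radius rho / 2 below. *)
have [|rho rho0 Hrho] := C11_strict_derivative (P z) Cg (_ : 0 < eps / 2).
  by rewrite divr_gt0.
exists (rho / 2); first by rewrite divr_gt0.
move=> x v xz xvz; rewrite AE PD dotpDl.
rewrite [X in `|X|](_ : _ = - (g (P x + P v) - g (P x) - 'd g (P z) (P v))); last by ring.
rewrite normrN (le_trans (Hrho _ _ _ _))//.
- by rewrite -PB (le_lt_trans (Ple _))//; lra.
- by rewrite -PD -PB (le_lt_trans (Ple _))//; lra.
- have := Ple v; nra.
Qed.

End charts.

Section boundary_strip.
Context (R : realType) (n : nat) (Om : set 'rV[R]_n).
Hypotheses (n0 : (0 < n)%N) (bOm : bounded_set Om) (COm : C11_open_set Om).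
Local Notation E := 'rV[R]_n.
Local Notation leb := (lebesgue_row R n).
Local Notation d := (delta Om).

Let oOm : open Om. Proof. by case: COm. Qed.

Lemma frontier_notin y : frontier Om y -> ~ Om y.
Proof. by move=> [_ nI] Omy; apply: nI; have := oOm; rewrite openE; apply. Qed.

Lemma measurable_delta : measurable_fun setT d.
Proof. by apply: measurable_lipschitz_row => x y; exact: dist_to_lip. Qed.

Lemma measurable_strip (A : set E) (t : R) : measurable A ->
  measurable (A `&` [set x | d x < t]).
Proof.
move=> mA; apply: measurableI => //.
rewrite (_ : [set x | _] = setT `&` d @^-1` `]-oo, t[%classic).
  exact: measurable_delta.
by rewrite setTI; apply/seteqP; split=> x /=; rewrite in_itv.
Qed.

(* Near z the function F of the chart is Lipschitz and vanishes on the frontier,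
   so 0 < F <= C t where δ < t, while F is strictly monotone in the direction of
   the i-th axis: lines in that direction meet the strip in sets of diameter
   O(t). *)
Lemma boundary_strip_local z : frontier Om z ->
  exists (rho : R) (C : R), [/\ 0 < rho, 0 <= C & forall t, 0 < t ->
    (leb ((Om `&` [set x | (enorm (z - x) < rho)%R]) `&` [set x | (d x < t)%R])
       <= (C * t)%:E)%E].
Proof.
move=> fz.
have [F [A [i [r [Ai r0 Hr Hs]]]]] := boundary_chart COm fz.
pose c := `|A (delta_mx ord0 i)|.
have c0 : 0 < c by rewrite normr_gt0.
(* Half of the slope c along the i-th axis is given away as error; the other half remains. *)
have [|rho0 rho00 Hrho] := Hs (c / 2); first by rewrite divr_gt0.
pose rho := Num.min r rho0.
have rhop : 0 < rho by rewrite lt_min r0.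
have rhor x : enorm (x - z) < rho -> enorm (x - z) < r by rewrite lt_min => /andP[].
have rhor0 x : enorm (x - z) < rho -> enorm (x - z) < rho0 by rewrite lt_min => /andP[].
pose K := \sum_(j < n) `|A (delta_mx ord0 j)|.
have K0 : 0 <= K by apply: sumr_ge0.
have AK v : `|A v| <= K * enorm v.
  rewrite (row_sum_delta v) linear_sum (le_trans (ler_norm_sum _ _ _))//.
  rewrite /K mulr_suml; apply: ler_sum => j _.
  rewrite linearZ /= normrM mulrC ler_wpM2l// -row_sum_delta; exact: coord_le_enorm.
pose Lam := K + c / 2.
have Lam0 : 0 < Lam by rewrite ltr_wpDl// divr_gt0.
have FL x y : enorm (x - z) < rho -> enorm (y - z) < rho ->
    `|F x - F y| <= Lam * enorm (x - y).
  move=> xz yz; have := Hrho y (x - y) (rhor0 _ yz).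
  rewrite subrKC => /(_ (rhor0 _ xz)).
  have := AK (x - y); rewrite /Lam mulrDl.
  set a := F x - F y; set b := A _ => H1 H2.
  rewrite -[a](subrK b) (le_trans (ler_normD _ _))//; lra.
(* A frontier point is not in the open set Om, so F <= 0 there. If F were negative, the Lipschitz
   bound would keep it negative nearby, although points of Om, where F > 0, accumulate at y. *)
have F0 y : frontier Om y -> enorm (y - z) < rho -> F y = 0.
  move=> fy yz; have clOmy := fy.1; have nOmy := frontier_notin fy.
  have F1 : F y <= 0.
    by rewrite leNgt; apply/negP => /(Hr _ (rhor _ yz)); exact: nOmy.
  apply/eqP; rewrite eq_le F1/= leNgt; apply/negP => F2.
  pose eta := Num.min (rho - enorm (y - z)) (- F y / Lam).
  have eta0 : 0 < eta by rewrite lt_min subr_gt0 yz divr_gt0// oppr_gt0.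
  have /closure_enormP/(_ _ eta0)[x Omx yx] := clOmy.
  have xz : enorm (x - z) < rho.
    apply: le_lt_trans (enorm_triangle y x z) _.
    by move: yx; rewrite enormB lt_min => /andP[? ?]; lra.
  have Fx : 0 < F x by apply/(Hr _ (rhor _ xz)).
  have := FL _ _ xz yz; rewrite enormB => H.
  have : Lam * enorm (y - x) < - F y.
    by rewrite mulrC -ltr_pdivlMr//; move: yx; rewrite lt_min => /andP[].
  by have := ler_norm (F x - F y); lra.
have [M M0 OmM] := bounded_enorm bOm.
have mOm : measurable Om by exact: open_measurable_row.
have lOm : leb Om \is a fin_num by rewrite ge0_fin_numE//; exact: lebesgue_row_bounded.
pose m := fine (leb Om).
have m0 : 0 <= m by rewrite fine_ge0.
pose C1 := 2 * (4 * Lam / c) * (2 * rho) ^+ n.-1.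
have C10 : 0 <= C1 by rewrite /C1 !mulr_ge0 ?exprn_ge0 ?mulr_ge0 ?invr_ge0 ?ltW.
exists (rho / 2), (C1 + m / (rho / 2)); split.
- by rewrite divr_gt0.
- by rewrite addr_ge0// !divr_ge0// ltW.
(* For t >= rho / 2 the total volume m is already a multiple of t: this is the summand m / (rho / 2)
   of the constant. *)
move=> t t0; have [tr|tr] := leP (rho / 2) t.
  apply: (@le_trans _ _ (leb Om)).
    apply: le_measure; rewrite ?inE//; last by move=> x [[]].
    apply: measurable_strip; apply: measurableI => //.
    exact: measurable_ball_row.
  rewrite -(fineK lOm) lee_fin -/m mulrDl; apply: le_trans (_ : m / (rho / 2) * t <= _).
    by rewrite -mulrA ler_peMr// mulrC ler_pdivlMr ?mul1r// divr_gt0.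
  by rewrite lerDr mulr_ge0// ltW.
have rho2 : rho / 2 < rho by rewrite ltr_pdivrMr// ltr_pMr// ltr1n.
pose S := (Om `&` [set x | (enorm (z - x) < rho / 2)%R]) `&` [set x | (d x < t)%R].
have FS x : S x -> enorm (x - z) < rho / 2 /\ `|F x| <= Lam * t.
  move=> [[Omx /= xz] dx]; rewrite enormB in xz; split => //.
  have [|y fy xy] := dist_to_lt _ dx; first by exists z.
  have yz : enorm (y - z) < rho.
    by apply: le_lt_trans (enorm_triangle x y z) _; rewrite enormB; lra.
  have xz' := lt_trans xz rho2.
  have := FL _ _ xz' yz; rewrite (F0 _ fy yz) subr0 => /le_trans; apply.
  by rewrite ler_wpM2l ?(ltW Lam0)// ltW.
have mS : measurable S.
  apply: measurable_strip; apply: measurableI => //; exact: measurable_ball_row.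
apply: (@le_trans _ _ (2 * (4 * Lam / c * t) * (2 * rho) ^+ n.-1)%:E).
  apply: (@lebesgue_row_sections _ _ _ i z) => //.
  - exact: ltW.
  - by rewrite !mulr_ge0 ?invr_ge0 ?ltW.
  - move=> x /FS[xz _] j; have := coord_le_enorm (x - z) j; rewrite !mxE; lra.
  - move=> x tau /FS[xz Fx] /FS[xtz Fxt].
    have := Hrho x (tau *: delta_mx ord0 i); rewrite enormZ enorm_delta mulr1.
    move=> /(_ (rhor0 _ (lt_trans xz rho2)) (rhor0 _ (lt_trans xtz rho2))) H.
    (* Between two points of the strip F changes by at most 2 Lam t, and its increment is A(tau
       e_i), of size c |tau|, up to the error (c / 2) |tau|. Hence |tau| <= 4 Lam t / c. *)
    have : `|A (tau *: delta_mx ord0 i)| <= 2 * (Lam * t) + c / 2 * `|tau|.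
      move: H; set a := F (x + _) in Fxt *; set b := A _ => H.
      rewrite -[b](subrK (a - F x)) (le_trans (ler_normD _ _))//.
      have := ler_normB a (F x); rewrite distrC in H; lra.
    rewrite linearZ/= normrM -/c => H'.
    rewrite (_ : 4 * Lam / c * t = (4 * (Lam * t)) / c); last by ring.
    rewrite ler_pdivlMr//; lra.
rewrite lee_fin; apply: le_trans (_ : C1 * t <= _).
  by rewrite le_eqVlt; apply/orP; left; apply/eqP; rewrite /C1; ring.
by rewrite ler_wpM2r ?(ltW t0)// lerDl divr_ge0// ltW// divr_gt0.
Qed.

(** By compactness of the closure of Om. Frontier points are covered by [boundary_strip_local]; near
    a point z of Om the distance is at least δ(z)/2, so the strip is empty for small t and the total
    volume suffices for the others. The estimates are added over a finite subcover. *)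
Lemma boundary_strip : (forall x, Om x -> 0 < d x) ->
  exists2 C : R, 0 <= C & forall t, 0 < t ->
  (leb (Om `&` [set x | (d x < t)%R]) <= (C * t)%:E)%E.
Proof.
move=> d0; have mOm : measurable Om by exact: open_measurable_row.
have lOm : leb Om \is a fin_num by rewrite ge0_fin_numE//; exact: lebesgue_row_bounded.
pose m := fine (leb Om).
have m0 : 0 <= m by rewrite fine_ge0.
have loc z : exists UC : set E * R, closure Om z ->
    [/\ open UC.1, UC.1 z, 0 <= UC.2 & forall t, 0 < t ->
    (leb ((Om `&` UC.1) `&` [set x | (d x < t)%R]) <= (UC.2 * t)%:E)%E].
  have [clz|] := pselect (closure Om z); last by exists (set0, 0).
  have [fz|nfz] := pselect (frontier Om z).
    have [rho [C [rho0 C0 HC]]] := boundary_strip_local fz.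
    exists ([set x | enorm (z - x) < rho], C) => _; split => //=.
      exact: open_ball.
    by rewrite subrr enorm0.
  have Omz : Om z.
    by apply: contrapT => nz; apply: nfz; split => // /interior_subset.
  have dz := d0 _ Omz.
  exists ([set x | enorm (z - x) < d z / 2], m / (d z / 2)) => _; split => //=.
  - exact: open_ball.
  - by rewrite subrr enorm0 divr_gt0.
  - by rewrite !divr_ge0// ltW.
  move=> t t0; have [tz|tz] := leP (d z / 2) t.
    apply: (@le_trans _ _ (leb Om)).
      apply: le_measure; rewrite ?inE//; last by move=> x [[]].
      apply: measurable_strip; apply: measurableI => //.
      exact: measurable_ball_row.
    rewrite -(fineK lOm) lee_fin -/m -mulrA ler_peMr//.
    by rewrite mulrC ler_pdivlMr ?mul1r// divr_gt0.
  rewrite (_ : _ `&` _ = set0).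
    by rewrite measure0 lee_fin !mulr_ge0// ?invr_ge0 ltW// divr_gt0.
  rewrite -subset0 => x [[_ /= zx] dx].
  have := dist_to_lip (frontier Om) z x.
  by rewrite -/(delta Om z) -/(delta Om x) ler_norml => /andP[_]; lra.
have [UC HUC] := choice loc.
have mU z : closure Om z -> measurable (Om `&` (UC z).1).
  by move=> /HUC[oU _ _ _]; apply: measurableI => //; exact: open_measurable_row.
have cOm : compact (closure Om).
  apply: bounded_closed_compact; last exact: closed_closure.
  have [M M0 OmM] := bounded_enorm bOm.
  exists (M + 1); split; first exact: num_real.
  move=> b Mb x /closure_enormP/(_ _ ltr01)[y Omy xy].
  rewrite /= (le_trans (norm_le_enorm _))// -(subrK y x) (le_trans (enormD _ _))//.
  have := OmM _ Omy; lra.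
move: cOm; rewrite compact_cover => /(_ _ (closure Om) (fun z => (UC z).1)).
case=> [z /HUC[]//|z clz|D DOm Dcov].
  by exists z => //; have [] := HUC _ clz.
have fin (s : seq E) : (forall z, z \in s -> closure Om z) ->
    exists2 C : R, 0 <= C & measurable (Om `&` [set x | exists2 z, z \in s & (UC z).1 x]) /\
     forall t, 0 < t ->
    (leb ((Om `&` [set x | exists2 z, z \in s & (UC z).1 x]) `&` [set x | (d x < t)%R])
      <= (C * t)%:E)%E.
  elim: s => [|z s IH] sOm.
    exists 0 => //; rewrite (_ : Om `&` _ = set0); last first.
      by rewrite -subset0 => x [_ []].
    by split => // t t0; rewrite set0I measure0 mul0r.
  have [|C C0 [mC HC]] := IH; first by move=> y ys; apply: sOm; rewrite inE ys orbT.
  have clz : closure Om z by apply: sOm; rewrite mem_head.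
  have [oz _ Cz0 HCz] := HUC _ clz.
  have E1 : Om `&` [set x | exists2 z', z' \in z :: s & (UC z').1 x] =
      (Om `&` (UC z).1) `|` (Om `&` [set x | exists2 z, z \in s & (UC z).1 x]).
    apply/seteqP; split => x.
      move=> [Omx [y]]; rewrite inE => /predU1P[->|ys] Ux; first by left.
      by right; split => //; exists y.
    move=> [[Omx Ux]|[Omx [y ys Ux]]]; split => //.
      by exists z; rewrite ?mem_head.
    by exists y; rewrite ?inE ?ys ?orbT.
  exists (C + (UC z).2); first exact: addr_ge0.
  rewrite E1; split; first by apply: measurableU => //; exact: mU.
  move=> t t0; rewrite setIUl; apply: (le_trans (measureU2 _ _ _)).
  - by apply: measurable_strip; exact: mU.
  - exact: measurable_strip.
  - by rewrite addrC mulrDl EFinD leeD ?HC ?HCz.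
have [|C C0 [mC HC]] := fin (finmap.enum_fset D).
  by move=> z zD; apply: set_mem; exact: DOm.
exists C => // t t0; apply: le_trans (HC _ t0); apply: le_measure; rewrite ?inE.
- exact: measurable_strip.
- exact: measurable_strip.
- move=> x [Omx dx]; split => //; split => //.
  have [z zD Ux] := Dcov _ (subset_closure Omx).
  by exists z.
Qed.

End boundary_strip.

(** * Interpolating kernels *)

(** With m = max(a, b), the hypothesis gives 1 <= Q^t' c^(-t') m^t'. After multiplication by this
    factor, m^t' is absorbed by the power of the larger of a and b (by b^(-t) since t' <= t, by
    a^(-1) since t' <= 1), and the exponent -(1 + t - t') of the smaller one is left. *)
Lemma quasimetric_powers (R : realType) (a b c Q t t' : R) :
  0 < a -> 0 < b -> 0 < c -> 0 < Q -> 0 <= t' -> t' <= t -> t' <= 1 ->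
  c <= Q * Num.max a b ->
  a^-1 * b `^ (- t) <= Q `^ t' * c `^ (- t') *
    (a `^ (- (1 + (t - t'))) + b `^ (- (1 + (t - t')))).
Proof.
move=> a0 b0 c0 Q0 t'0 t't t'1 cQ; set m := Num.max a b in cQ *.
have m0 : 0 < m by rewrite lt_max a0.
have H : m `^ t' <= c `^ (- t') * m `^ t' * c `^ t'.
  by rewrite mulrAC -powRDp// addNr powRr0 mul1r.
have cm : 1 <= Q `^ t' * c `^ (- t') * m `^ t'.
  rewrite mulrAC -powRM ?(ltW Q0)// ?(ltW m0)// powRN ler_pdivlMr ?powR_gt0//.
  by rewrite mul1r powR_le// ltW.
have e0 : 0 <= t - t' by rewrite subr_ge0.
suff ab : a^-1 * b `^ (- t) <= m `^ t' *
    (a^-1 * b `^ (- t)) * (c `^ (- t') * Q `^ t') /\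
    m `^ t' * (a^-1 * b `^ (- t)) <= a `^ (- (1 + (t - t'))) + b `^ (- (1 + (t - t'))).
  have [h1 h2] := ab; apply: le_trans h1 _.
  by rewrite mulrC (mulrC (c `^ _)) ler_wpM2l// mulr_ge0// powR_ge0.
split.
  have p0 : 0 <= a^-1 * b `^ (- t) by rewrite mulr_ge0 ?powR_ge0// invr_ge0 ltW.
  rewrite (_ : m `^ t' * _ * _ = (a^-1 * b `^ (- t)) * (Q `^ t' * c `^ (- t') * m `^ t')); last by ring.
  by rewrite ler_peMr.
rewrite -powR_inv1 ?(ltW a0)//.
rewrite /m; have [ab|ba] := leP a b.
- apply: (@le_trans _ _ (a `^ (- (1 + (t - t'))))); last by rewrite lerDl powR_ge0.
  rewrite mulrCA -powRDp// opprD (@powRDp _ a)// ler_wpM2l ?powR_ge0//.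
  by rewrite (_ : t' + - t = - (t - t')) ?powRN_le//; ring.
- apply: (@le_trans _ _ (b `^ (- (1 + (t - t'))))); last by rewrite lerDr powR_ge0.
  rewrite mulrA -powRDp// (_ : - (1 + _) = - (1 - t') - t); last by ring.
  rewrite (@powRDp _ b)// ler_wpM2r ?powR_ge0//.
  rewrite (_ : t' - 1 = - (1 - t')); last by ring.
  by rewrite powRN_le ?subr_ge0// ltW.
Qed.

Section kernels.
Context (R : realType) (E : Type) (Om : set E) (d : E -> R) (dist : E -> E -> R).
Hypotheses (distC : forall x y, dist x y = dist y x)
  (distxx : forall x, dist x x = 0)
  (dist_gt0 : forall x y, x <> y -> 0 < dist x y)
  (dist_triangle : forall z x y, dist x y <= dist x z + dist z y)
  (d0 : forall x, Om x -> 0 < d x)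
  (dlip : forall x y, d x <= d y + dist x y).
Variables (N gamma : R).
Hypotheses (N0 : 0 < N) (g0 : 0 < gamma).

Lemma dist_ge0 x y : 0 <= dist x y.
Proof.
by have [->|/dist_gt0/ltW//] := pselect (x = y); rewrite distxx.
Qed.

Definition spread (x y : E) : R := dist x y + d x + d y.

Definition quasi (x y : E) : R := dist x y `^ N * spread x y `^ (2 * gamma).

(* [Phi 1] is comparable with the Green function and [Phi 0 x y] is
   [delta x ^ gamma * delta y ^ gamma]; the other values of [t] interpolate. *)
Definition Phi (t : R) (x y : E) : R :=
  d x `^ gamma * d y `^ gamma * quasi x y `^ (- t).

Lemma powR_le1 (a : R) : 0 <= a -> a <= 1 -> a `^ gamma <= 1.
Proof.
move=> a0 a1; apply: (@le_trans _ _ (1 `^ gamma)); last by rewrite powR1.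
by rewrite powR_le// ltW.
Qed.

Lemma powR_ge1 (a : R) : 1 <= a -> 1 <= a `^ gamma.
Proof.
move=> a1; apply: (@le_trans _ _ (1 `^ gamma)); first by rewrite powR1.
by rewrite powR_le// ltW.
Qed.

Lemma spread_gt0 x y : Om x -> Om y -> 0 < spread x y.
Proof. by move=> /d0 dx /d0 dy; rewrite /spread -addrA ltr_wpDl ?dist_ge0// addr_gt0. Qed.

Lemma quasi_gt0 x y : Om x -> Om y -> x <> y -> 0 < quasi x y.
Proof. by move=> Omx Omy xy; rewrite mulr_gt0 ?powR_gt0 ?dist_gt0 ?spread_gt0. Qed.

Lemma quasi_diag x : quasi x x = 0.
Proof. by rewrite /quasi distxx powR0 ?mul0r// gt_eqF. Qed.

Lemma Phi_ge0 t x y : 0 <= Phi t x y.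
Proof. by rewrite !mulr_ge0 ?powR_ge0. Qed.

(** A negative power of 0 is 0, so the kernel vanishes on the diagonal instead of being infinite
    there. Points are null sets, and the convention settles the cases x = z and z = y of the
    composition bound. *)
Lemma Phi_diag t x : 0 < t -> Phi t x x = 0.
Proof. by move=> t0; rewrite /Phi quasi_diag powR0 ?mulr0// oppr_eq0 gt_eqF. Qed.

Lemma spreadC x y : spread x y = spread y x.
Proof. by rewrite /spread distC addrAC. Qed.

Lemma quasiC x y : quasi x y = quasi y x.
Proof. by rewrite /quasi distC spreadC. Qed.

Lemma PhiC t x y : Phi t x y = Phi t y x.
Proof. by rewrite /Phi quasiC (mulrC (d x `^ _)). Qed.

(** If z is at least as close to y as to x, then |x-y| <= 2 |x-z|, and replacing δ(y) by δ(z) costs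
    at most another |x-z|, so the spread grows by at most a factor 3. The other case is symmetric.
    Hence the constant 2^N 3^(2γ). *)
Lemma quasi_triangle x y z : Om x -> Om y -> Om z ->
  quasi x y <= 2 `^ N * 3 `^ (2 * gamma) * Num.max (quasi x z) (quasi z y).
Proof.
have H x' y' z' : Om x' -> Om y' -> Om z' -> dist z' y' <= dist x' z' ->
    quasi x' y' <= 2 `^ N * 3 `^ (2 * gamma) * quasi x' z'.
  move=> Ox Oy Oz zy; rewrite /quasi.
  rewrite [leRHS](_ : _ = (2 * dist x' z') `^ N * (3 * spread x' z') `^ (2 * gamma)).
    have dx := d0 Ox; have dy := d0 Oy; have dz := d0 Oz.
    have tr := dist_triangle z' x' y'.
    have dl := dlip y' z'; rewrite distC in dl.
    apply: ler_pM; rewrite ?powR_ge0//; apply: powR_le.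
    - exact: ltW.
    - exact: dist_ge0.
    - lra.
    - by rewrite mulr_ge0// ltW.
    - by rewrite ltW// spread_gt0.
    - have := dist_ge0 x' z'; rewrite /spread; lra.
  by rewrite !powRM ?dist_ge0 ?(ltW (spread_gt0 _ _))//; ring.
move=> Ox Oy Oz; have [zy|xz] := leP (dist z y) (dist x z).
  apply: (le_trans (H _ _ _ Ox Oy Oz zy)); apply: ler_wpM2l.
    by rewrite mulr_ge0 ?powR_ge0.
  by rewrite le_max lexx.
rewrite quasiC (quasiC x) (quasiC z y).
apply: (le_trans (H _ _ z Oy Ox Oz _)); first by rewrite (distC z) (distC y) ltW.
apply: ler_wpM2l; first by rewrite mulr_ge0 ?powR_ge0.
by rewrite le_max lexx orbT.
Qed.

(** The first power of H pays for the weight, since δ(z) is at most the spread, and leaves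
    |x-z|^(-N); the surplus power eta is estimated by H >= |x-z|^(N + 2γ). *)
Lemma delta_quasi eta x z : 0 <= eta -> Om x -> Om z -> x <> z ->
  d z `^ (2 * gamma) * quasi x z `^ (- (1 + eta)) <=
  dist x z `^ (- (N + (N + 2 * gamma) * eta)).
Proof.
move=> eta0 Ox Oz xz.
have r0 := dist_gt0 xz; have s0 := spread_gt0 Ox Oz; have q0 := quasi_gt0 Ox Oz xz.
have dz := d0 Oz; have dx := d0 Ox.
rewrite opprD powRDp// [in leRHS]opprD powRDp// mulrA.
apply: ler_pM; rewrite ?mulr_ge0 ?powR_ge0//.
  rewrite powR_inv1 ?(ltW q0)// /quasi invfM -powRN mulrCA ler_piMr ?powR_ge0//.
  rewrite ler_pdivrMr ?powR_gt0// mul1r powR_le ?mulr_ge0 ?(ltW g0) ?(ltW dz)//.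
  by rewrite /spread lerDr addr_ge0 ?(ltW dx)// ltW.
rewrite -mulrN powRrM; apply: powRN_le => //; first by rewrite powR_gt0.
rewrite powRDp// /quasi ler_wpM2l ?powR_ge0// powR_le ?mulr_ge0 ?(ltW g0) ?(ltW r0)//.
by rewrite /spread -addrA lerDl addr_ge0 // ltW.
Qed.

(** [quasimetric_powers] with a = H(x,z), b = H(z,y) and c = H(x,y). The two factors δ(z)^γ, one
    from each kernel, form the weight that [delta_quasi] consumes. For t = t' = 1 this is the 3G
    inequality. *)
Lemma Phi_comp_pointwise t t' x y z : 0 < t -> 0 <= t' -> t' <= t -> t' <= 1 ->
  Om x -> Om y -> Om z -> x <> y ->
  Phi 1 x z * Phi t z y <= (2 `^ N * 3 `^ (2 * gamma)) `^ t' * Phi t' x y *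
    (dist x z `^ (- (N + (N + 2 * gamma) * (t - t'))) +
     dist z y `^ (- (N + (N + 2 * gamma) * (t - t')))).
Proof.
move=> t0 t'0 t't t'1 Ox Oy Oz xy.
have rhs0 : 0 <= (2 `^ N * 3 `^ (2 * gamma)) `^ t' * Phi t' x y *
    (dist x z `^ (- (N + (N + 2 * gamma) * (t - t'))) +
     dist z y `^ (- (N + (N + 2 * gamma) * (t - t')))).
  by rewrite !mulr_ge0 ?Phi_ge0 ?addr_ge0 ?powR_ge0.
have [xz|xz] := pselect (x = z); first by rewrite -xz in rhs0 *; rewrite Phi_diag// mul0r.
have [zy|zy] := pselect (z = y); first by rewrite -zy in rhs0 *; rewrite Phi_diag// mulr0.
set e := N + _ in rhs0 *; set Q := _ * 3 `^ _ in rhs0 *.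
have eta0 : 0 <= t - t' by rewrite subr_ge0.
have Q0 : 0 < Q by rewrite mulr_gt0 ?powR_gt0.
have := quasimetric_powers (quasi_gt0 Ox Oz xz) (quasi_gt0 Oz Oy zy)
  (quasi_gt0 Ox Oy xy) Q0 t'0 t't t'1 (quasi_triangle Ox Oy Oz).
move=> /(ler_wpM2l (powR_ge0 (d z) (2 * gamma))) /(ler_wpM2l (powR_ge0 (d x) gamma))
  /(ler_wpM2l (powR_ge0 (d y) gamma)) H.
have dz2 : d z `^ (2 * gamma) = d z `^ gamma * d z `^ gamma.
  by rewrite -powRDp ?d0//; congr powR; ring.
rewrite [leLHS](_ : _ = d y `^ gamma * (d x `^ gamma * (d z `^ (2 * gamma) *
  ((quasi x z)^-1 * quasi z y `^ (- t))))); last first.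
  by rewrite /Phi powR_inv1 ?(ltW (quasi_gt0 _ _ _))// dz2; ring.
apply: le_trans H _.
rewrite [leLHS](_ : _ = Q `^ t' * Phi t' x y *
  (d z `^ (2 * gamma) * quasi x z `^ (- (1 + (t - t'))) +
   d z `^ (2 * gamma) * quasi z y `^ (- (1 + (t - t'))))); last first.
  rewrite /Phi; move: (quasi x z `^ _) (quasi z y `^ _) (quasi x y `^ _) (Q `^ _)
    (d x `^ _) (d y `^ _) (d z `^ _) => *; ring.
rewrite ler_wpM2l ?mulr_ge0 ?Phi_ge0 ?powR_ge0// lerD//.
  exact: delta_quasi.
rewrite quasiC distC; apply: delta_quasi => //; exact/nesym.
Qed.

Lemma delta_le_spread x y : Om x -> Om y -> d x <= spread x y /\ d y <= spread x y.
Proof.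
move=> /d0 dx /d0 dy; have := dist_ge0 x y; rewrite /spread; split; lra.
Qed.

Lemma Phi1E x y : Om x -> Om y ->
  Phi 1 x y = dist x y `^ (- N) *
    ((d x / spread x y) `^ gamma * (d y / spread x y) `^ gamma).
Proof.
move=> Ox Oy; have s0 := spread_gt0 Ox Oy; have dx := d0 Ox; have dy := d0 Oy.
rewrite /Phi /quasi powR_inv1 ?mulr_ge0 ?powR_ge0// invfM -powRN.
rewrite !powRM ?invr_ge0 ?ltW// -(powR_inv1 (ltW s0)) -!powRrM mulN1r.
rewrite (_ : 2 * gamma = gamma + gamma) ?powRDp//; last by ring.
by rewrite invfM !powRN; ring.
Qed.

Lemma ratio_spread x y : Om x -> Om y ->
  0 <= (d x / spread x y) `^ gamma <= 1.
Proof.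
move=> Ox Oy; have s0 := spread_gt0 Ox Oy; rewrite powR_ge0/=; apply: powR_le1.
  by rewrite divr_ge0 ?ltW ?d0.
by rewrite ler_pdivrMr// mul1r; have [] := delta_le_spread Ox Oy.
Qed.

Lemma Phi1_le_riesz x y : Om x -> Om y -> Phi 1 x y <= dist x y `^ (- N).
Proof.
move=> Ox Oy; rewrite (Phi1E Ox Oy).
have := ratio_spread Ox Oy; have := ratio_spread Oy Ox; rewrite (spreadC y x).
move: (_ `^ gamma) (_ `^ gamma) (powR_ge0 (dist x y) (- N)) => a b r0.
by move=> /andP[? ?] /andP[? ?]; rewrite ler_piMr// mulr_ile1.
Qed.

(** What is discarded is the square of (δ(x)/spread)^γ <= 1. The boundary weight can thus be moved
    from x to y, at the price of the full Riesz kernel. *)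
Lemma Phi1_le_ratio x y : Om x -> Om y ->
  d x `^ gamma * Phi 1 x y <= d y `^ gamma * dist x y `^ (- N).
Proof.
move=> Ox Oy; rewrite (Phi1E Ox Oy).
have [] := delta_le_spread Ox Oy; have := spread_gt0 Ox Oy.
have := d0 Ox; have := d0 Oy; have := powR_ge0 (dist x y) (- N).
move: (dist _ _ `^ _) (d x) (d y) (spread x y) => r a b t r0 b0 a0 t0 at_ bt.
have a0' := ltW a0; have b0' := ltW b0; have t0' := ltW t0.
rewrite !powRM ?invr_ge0//.
have -> : a `^ gamma * (r * (a `^ gamma * t^-1 `^ gamma * (b `^ gamma * t^-1 `^ gamma)))
   = b `^ gamma * r * ((a `^ gamma * t^-1 `^ gamma) * (a `^ gamma * t^-1 `^ gamma)).
  by ring.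
have H : a `^ gamma * t^-1 `^ gamma <= 1.
  rewrite -powRM ?invr_ge0//; apply: powR_le1; first by rewrite divr_ge0.
  by rewrite ler_pdivrMr// mul1r.
by rewrite ler_piMr ?mulr_ge0 ?powR_ge0// mulr_ile1 ?mulr_ge0 ?powR_ge0.
Qed.

(** Either a <= 2r, and then r is comparable with t; or a > 2r, and then a, b and t are comparable,
    so both ratios are bounded below. The constant 20 leaves room in all cases. *)
Lemma model_powers (r a b t : R) : 0 < r -> 0 < a -> 0 < b ->
  a <= b + r -> b <= a + r -> t = r + a + b ->
  (a / t) `^ gamma * (b / t) `^ gamma <=
    Num.min (a `^ gamma * b `^ gamma / r `^ (2 * gamma)) 1 <=
  20 `^ gamma * 20 `^ gamma * ((a / t) `^ gamma * (b / t) `^ gamma).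
Proof.
move=> r0 a0 b0 ab ba tE; have t0 : 0 < t by lra.
have r0' := ltW r0; have a0' := ltW a0; have b0' := ltW b0; have t0' := ltW t0.
have E1 : a `^ gamma * b `^ gamma / r `^ (2 * gamma) =
    (a / r) `^ gamma * (b / r) `^ gamma.
  rewrite !powRM ?invr_ge0// -(powR_inv1 r0') -!powRrM mulN1r.
  rewrite (_ : 2 * gamma = gamma + gamma) ?powRDp//; last by ring.
  by rewrite invfM !powRN; ring.
have E2 : 20 `^ gamma * 20 `^ gamma * ((a / t) `^ gamma * (b / t) `^ gamma) =
    (20 * (a / t)) `^ gamma * (20 * (b / t)) `^ gamma.
  by rewrite !(@powRM _ 20) ?divr_ge0//; ring.
rewrite E1 E2 le_min ge_min -andbA; apply/and3P; split.
- apply: ler_pM; rewrite ?powR_ge0// powR_le ?(ltW g0) ?divr_ge0// ler_wpM2l//;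
    rewrite lef_pV2 ?posrE// tE; lra.
- by rewrite mulr_ile1 ?powR_ge0// powR_le1 ?divr_ge0// ler_pdivrMr// mul1r tE; lra.
have [dr|dr] := leP a (2 * r).
  apply/orP; left.
  have S5 : r^-1 <= 20 / t by rewrite ler_pdivlMr// mulrC ler_pdivrMr// tE; lra.
  by apply: ler_pM; rewrite ?powR_ge0// powR_le ?(ltW g0) ?divr_ge0//
    mulrCA ler_wpM2l.
apply/orP; right.
by rewrite -[leLHS]mulr1; apply: ler_pM => //; apply: powR_ge1;
  rewrite mulrA ler_pdivlMr// mul1r tE; lra.
Qed.

Lemma Phi1_le_model x y : Om x -> Om y -> x <> y ->
  let model := dist x y `^ (- N) *
    Num.min (d x `^ gamma * d y `^ gamma / dist x y `^ (2 * gamma)) 1 in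
  Phi 1 x y <= model <= 20 `^ gamma * 20 `^ gamma * Phi 1 x y.
Proof.
move=> Ox Oy xy /=.
have l1 := dlip x y; have l2 := dlip y x; rewrite (distC y) in l2.
have /andP[h1 h2] := model_powers (dist_gt0 xy) (d0 Ox) (d0 Oy) l1 l2 (erefl (spread x y)).
rewrite (Phi1E Ox Oy) [X in _ <= _ <= X]mulrCA.
apply/andP; split; exact: ler_wpM2l (powR_ge0 _ _) _ _ _.
Qed.

End kernels.

(** * Integral operators with non-negative kernels *)

Section kernel_operators.
Context disp (E : measurableType disp) (R : realType).
Variable mu : {sigma_finite_measure set E -> \bar R}.
Variable Om : set E.
Hypothesis mOm : measurable Om.
Implicit Types (k : E -> E -> R) (f g : E -> \bar R).
Local Open Scope ereal_scope.

Definition nonneg_measurable f :=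
  measurable_fun Om f /\ forall x, Om x -> 0 <= f x.

Definition measurable_kernel k :=
  measurable_fun setT (fun z : E * E => k z.1 z.2) /\
  forall x y, (0 <= k x y)%R.

(** Extended real values: composing kernels and exchanging integrals then requires no
    integrability. *)
Definition Kint k f (x : E) : \bar R := \int[mu]_(y in Om) ((k x y)%:E * f y).

Lemma measurable_fun_snd f : measurable_fun Om f ->
  measurable_fun (Om `*` Om) (fun z : E * E => f z.2).
Proof.
move=> mf; apply: (measurable_comp mOm _ mf); last first.
  by apply: measurable_funS measurable_snd.
by move=> _ [z [_ ?] <-].
Qed.

Lemma measurable_fun_fst f : measurable_fun Om f ->
  measurable_fun (Om `*` Om) (fun z : E * E => f z.1).
Proof.
move=> mf; apply: (measurable_comp mOm _ mf); last first.
  by apply: measurable_funS measurable_fst.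
by move=> _ [z [? _] <-].
Qed.

Lemma measurable_kernel_mul k f : measurable_kernel k -> nonneg_measurable f ->
  measurable_fun (Om `*` Om) (fun z : E * E => (k z.1 z.2)%:E * f z.2).
Proof.
move=> [mk _] [mf _]; apply: emeasurable_funM; last exact: measurable_fun_snd.
by apply/measurable_EFinP; apply: measurable_funS mk.
Qed.

Lemma Kint_nonneg k f : measurable_kernel k -> nonneg_measurable f ->
  nonneg_measurable (Kint k f).
Proof.
move=> hk hf; split.
  apply: (@measurable_integral_in _ _ _ _ _ mu Om Om (fun x y => (k x y)%:E * f y)) => //.
    by move=> x y Ox Oy; rewrite mule_ge0 ?lee_fin ?hk.2 ?hf.2.
  exact: measurable_kernel_mul.
by move=> x Ox; apply: integral_ge0 => y Oy; rewrite mule_ge0 ?lee_fin ?hk.2 ?hf.2.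
Qed.

Lemma measurable_kernel_slice k x : measurable_kernel k ->
  measurable_fun Om (k x).
Proof.
move=> [mk _]; apply: measurable_funTS.
exact: (measurableT_comp mk (pair1_measurable x)).
Qed.

Lemma measurable_kernel_slice' k y : measurable_kernel k ->
  measurable_fun Om (k ^~ y).
Proof.
move=> [mk _]; apply: measurable_funTS.
exact: (measurableT_comp mk (pair2_measurable y)).
Qed.

Lemma measurable_Kint_integrand k f x : measurable_kernel k ->
  measurable_fun Om f -> measurable_fun Om (fun y => (k x y)%:E * f y).
Proof.
move=> hk mf; apply: emeasurable_funM => //.
by apply/measurable_EFinP; exact: measurable_kernel_slice.
Qed.

Lemma Kint_le k f g x : measurable_kernel k ->
  nonneg_measurable f -> nonneg_measurable g ->
  {ae mu, forall y, Om y -> f y <= g y} -> Kint k f x <= Kint k g x.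
Proof.
move=> hk hf hg fg; apply: ae_le_integral_nonneg => //.
- by apply: measurable_Kint_integrand => //; exact: hg.1.
- by move=> y Oy; rewrite mule_ge0 ?lee_fin ?hk.2 ?hf.2.
- by move=> y Oy; rewrite mule_ge0 ?lee_fin ?hk.2 ?hg.2.
- apply: filterS fg => y fg Oy; apply: lee_wpmul2l; first by rewrite lee_fin hk.2.
  exact: fg.
Qed.

Lemma KintZ k f x (c : R) : measurable_kernel k -> nonneg_measurable f -> (0 <= c)%R ->
  Kint k (fun y => c%:E * f y) x = c%:E * Kint k f x.
Proof.
move=> hk hf c0; have mkf := measurable_Kint_integrand x hk hf.1.
rewrite -(ge0_integralZl mu mOm mkf) ?lee_fin//; last first.
  by move=> y Oy; rewrite mule_ge0 ?lee_fin ?hk.2 ?hf.2.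
by apply: eq_integral => y _; rewrite muleCA.
Qed.

Lemma KintD k f g x : measurable_kernel k ->
  nonneg_measurable f -> nonneg_measurable g ->
  Kint k (fun y => f y + g y) x = Kint k f x + Kint k g x.
Proof.
move=> hk hf hg; rewrite -ge0_integralD//.
- apply: eq_integral => y /set_mem Oy.
  by rewrite ge0_muleDr ?hf.2 ?hg.2.
- by move=> y Oy; rewrite mule_ge0 ?lee_fin ?hk.2 ?hf.2.
- by apply: measurable_Kint_integrand => //; exact: hf.1.
- by move=> y Oy; rewrite mule_ge0 ?lee_fin ?hk.2 ?hg.2.
- by apply: measurable_Kint_integrand => //; exact: hg.1.
Qed.

Lemma nonneg_measurableZ f (c : R) : (0 <= c)%R -> nonneg_measurable f ->
  nonneg_measurable (fun x => c%:E * f x).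
Proof.
move=> c0 [mf f0]; split; first exact: measurable_funeM.
by move=> x Ox; rewrite mule_ge0 ?f0.
Qed.

Lemma nonneg_measurableD f g : nonneg_measurable f -> nonneg_measurable g ->
  nonneg_measurable (fun x => f x + g x).
Proof.
move=> [mf f0] [mg g0']; split; first exact: emeasurable_funD.
by move=> x Ox; rewrite adde_ge0 ?f0 ?g0'.
Qed.

Lemma nonneg_measurableM f g : nonneg_measurable f -> nonneg_measurable g ->
  nonneg_measurable (fun x => f x * g x).
Proof.
move=> [mf f0] [mg g0']; split; first exact: emeasurable_funM.
by move=> x Ox; rewrite mule_ge0 ?f0 ?g0'.
Qed.

Lemma Kint_dual k f g : measurable_kernel k ->
  nonneg_measurable f -> nonneg_measurable g ->
  \int[mu]_(x in Om) (g x * Kint k f x) =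
  \int[mu]_(y in Om) (f y * Kint (fun y x => k x y) g y).
Proof.
move=> hk hf hg.
transitivity (\int[mu]_(x in Om) \int[mu]_(y in Om) (g x * ((k x y)%:E * f y))).
  apply: eq_integral => x /set_mem Ox; rewrite ge0_integralZl ?hg.2//.
    by apply: measurable_Kint_integrand => //; exact: hf.1.
  by move=> y Oy; rewrite mule_ge0 ?lee_fin ?hk.2 ?hf.2.
rewrite (@tonelli_in _ _ _ _ _ mu mu Om Om (fun x y => g x * ((k x y)%:E * f y)))//; last 2 first.
- by move=> x y Ox Oy; rewrite !mule_ge0 ?lee_fin ?hk.2 ?hf.2 ?hg.2.
- apply: emeasurable_funM; first by apply: measurable_fun_fst; exact: hg.1.
  exact: measurable_kernel_mul.
apply: eq_integral => y /set_mem Oy.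
rewrite -ge0_integralZl ?hf.2//; last 2 first.
- apply: emeasurable_funM; last exact: hg.1.
  by apply/measurable_EFinP; exact: measurable_kernel_slice'.
- by move=> x Ox; rewrite mule_ge0 ?lee_fin ?hk.2 ?hg.2.
by apply: eq_integral => x _; rewrite [RHS]muleC -muleA muleCA (muleC (g x)).
Qed.

Hypothesis mset1 : forall x : E, measurable [set x].
Hypothesis mu1 : forall x : E, mu [set x] = 0.

Lemma ae_neq x : {ae mu, forall y, y <> x}.
Proof.
exists [set x]; split => //.
by move=> y /= /contrapT.
Qed.

(** After Tonelli, the composed kernel at (x,y) is the integral over z of k1 k2 <= k3 w, and the
    weight w integrates to at most C. The point y = x may be left out because it is a null set. *)
Lemma Kint_comp_le k1 k2 k3 (w : E -> E -> E -> R) (C : R) f x : Om x ->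
  measurable_kernel k1 -> measurable_kernel k2 -> measurable_kernel k3 ->
  nonneg_measurable f -> (0 <= C)%R ->
  (forall y z, Om y -> Om z -> x <> y -> (k1 x z * k2 z y <= k3 x y * w x y z)%R) ->
  (forall y, measurable_fun Om (w x y)) -> (forall y z, (0 <= w x y z)%R) ->
  (forall y, Om y -> \int[mu]_(z in Om) (w x y z)%:E <= C%:E) ->
  Kint k1 (Kint k2 f) x <= C%:E * Kint k3 f x.
Proof.
move=> Ox h1 h2 h3 hf C0 Hk mw w0 wC.
have -> : Kint k1 (Kint k2 f) x = \int[mu]_(y in Om)
    (\int[mu]_(z in Om) ((k1 x z)%:E * ((k2 z y)%:E * f y))).
  transitivity (\int[mu]_(z in Om) \int[mu]_(y in Om) ((k1 x z)%:E * ((k2 z y)%:E * f y))).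
    apply: eq_integral => z /set_mem Oz; rewrite ge0_integralZl ?lee_fin ?h1.2//.
      by apply: measurable_Kint_integrand => //; exact: hf.1.
    by move=> y Oy; rewrite mule_ge0 ?lee_fin ?h2.2 ?hf.2.
  rewrite (@tonelli_in _ _ _ _ _ mu mu Om Om (fun z y => (k1 x z)%:E * ((k2 z y)%:E * f y)))//.
    by move=> z y Oz Oy; rewrite !mule_ge0 ?lee_fin ?h1.2 ?h2.2 ?hf.2.
  apply: emeasurable_funM; last exact: measurable_kernel_mul.
  apply: (measurable_fun_fst (f := EFin \o k1 x)).
  by apply/measurable_EFinP; exact: measurable_kernel_slice.
rewrite -ge0_integralZl//; last 2 first.
- by apply: measurable_Kint_integrand => //; exact: hf.1.
- by move=> y Oy; rewrite mule_ge0 ?lee_fin ?h3.2 ?hf.2.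
apply: ae_le_integral_nonneg => //.
- by apply: measurable_funeM; apply: measurable_Kint_integrand => //; exact: hf.1.
- move=> y Oy; apply: integral_ge0 => z Oz.
  by rewrite !mule_ge0 ?lee_fin ?h1.2 ?h2.2 ?hf.2.
- by move=> y Oy; rewrite !mule_ge0 ?lee_fin ?h3.2 ?hf.2.
apply: filterS (ae_neq x) => y yx Oy.
apply: (@le_trans _ _ (\int[mu]_(z in Om) (((k3 x y)%:E * f y) * (w x y z)%:E))).
  apply: le_integral_nonneg => z Oz.
    by rewrite !mule_ge0 ?lee_fin ?h1.2 ?h2.2 ?hf.2.
  rewrite muleA -EFinM muleAC -EFinM.
  apply: lee_wpmul2r; first exact: hf.2.
  by rewrite lee_fin; apply: Hk => //; exact/nesym.
rewrite ge0_integralZl//; last 3 first.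
- by apply/measurable_EFinP; exact: mw.
- by move=> z _; rewrite lee_fin.
- by rewrite mule_ge0 ?lee_fin ?h3.2 ?hf.2.
rewrite muleC; apply: lee_wpmul2r; last exact: wC.
by rewrite mule_ge0 ?lee_fin ?h3.2 ?hf.2.
Qed.

End kernel_operators.

Lemma measurable_fun_powR disp (E : measurableType disp) (R : realType)
    (A : set E) (f : E -> R) r :
  measurable_fun A f -> measurable_fun A (fun x => f x `^ r).
Proof.
move=> mf; apply: (@measurableT_comp _ _ _ _ _ _ (@powR R ^~ r)) => //.
Qed.

Lemma one_add_mule (R : realType) (s : R) (p : \bar R) : 0 <= s -> (0 <= p)%E ->
  ((1 + s)%:E * p = p + s%:E * p)%E.
Proof. by move=> s0 p0; rewrite EFinD ge0_muleDl ?lee_fin// mul1e. Qed.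

(** The potential theory is written against this list: balls of volume O(t^kappa) and a positive,
    bounded, 1-Lipschitz function d. In the application kappa is n and d is the distance to the
    boundary. *)
Record metric_domain disp (E : measurableType disp) (R : realType)
    (mu : {sigma_finite_measure set E -> \bar R}) (Om : set E) (d : E -> R)
    (dist : E -> E -> R) (kappa : R) : Prop := MetricDomain {
  md_kappa : 0 < kappa ;
  md_Om : measurable Om ;
  md_set1 : forall x : E, measurable [set x] ;
  md_mu1 : forall x : E, mu [set x] = 0%E ;
  md_fin : (mu Om < +oo)%E ;
  md_d : measurable_fun setT d ;
  md_dist : measurable_fun setT (fun z : E * E => dist z.1 z.2) ;
  md_distC : forall x y, dist x y = dist y x ;
  md_distxx : forall x, dist x x = 0 ;
  md_dist_gt0 : forall x y, x <> y -> 0 < dist x y ;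
  md_triangle : forall z x y, dist x y <= dist x z + dist z y ;
  md_d0 : forall x, Om x -> 0 < d x ;
  md_dlip : forall x y, d x <= d y + dist x y ;
  md_bounded : exists2 D : R, 0 < D & forall x y, Om x -> Om y ->
    dist x y <= D /\ d x <= D ;
  md_growth : exists2 A : R, 0 <= A & forall x t, 0 < t ->
    (mu (Om `&` [set y | (dist x y < t)%R]) <= (A * t `^ kappa)%:E)%E }.

(** * Composition and smoothing of the kernels Phi *)

Section potential.
Context disp (E : measurableType disp) (R : realType).
Variable mu : {sigma_finite_measure set E -> \bar R}.
Variables (Om : set E) (d : E -> R) (dist : E -> E -> R) (kappa : R).
Hypothesis HM : metric_domain mu Om d dist kappa.
Variables (N gamma : R).
Hypotheses (N0 : 0 < N) (Nk : N < kappa) (g0 : 0 < gamma).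
Local Notation Phi := (Phi d dist N gamma).
Local Notation Kint := (Kint mu Om).
Local Notation nonneg_measurable := (nonneg_measurable Om).

Let dist_ge0 x y : 0 <= dist x y.
Proof. exact: dist_ge0 (md_distxx HM) (md_dist_gt0 HM) x y. Qed.

Lemma measurable_dist x : measurable_fun Om (dist x).
Proof.
apply: measurable_funTS.
exact: (measurableT_comp (md_dist HM) (pair1_measurable x)).
Qed.

Lemma measurable_kernel_dist e : measurable_kernel (fun x y => dist x y `^ e).
Proof.
split; last by move=> x y; exact: powR_ge0.
exact: measurable_fun_powR (md_dist HM).
Qed.

Lemma measurable_kernel_Phi t : measurable_kernel (Phi t).
Proof.
split; last by move=> x y; exact: Phi_ge0.
have md1 : measurable_fun setT (fun z : E * E => d z.1).
  exact: (measurableT_comp (md_d HM)).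
have md2 : measurable_fun setT (fun z : E * E => d z.2).
  exact: (measurableT_comp (md_d HM)).
apply: measurable_funM.
  by apply: measurable_funM; exact: measurable_fun_powR.
apply: measurable_fun_powR; apply: measurable_funM; apply: measurable_fun_powR.
  exact: (md_dist HM).
apply: measurable_funD => //; apply: measurable_funD => //; exact: (md_dist HM).
Qed.

Lemma nonneg_measurable_dgamma r : nonneg_measurable (fun x => (d x `^ r)%:E).
Proof.
split; last by move=> x _; rewrite lee_fin powR_ge0.
apply/measurable_EFinP; apply: measurable_funTS.
exact: measurable_fun_powR (md_d HM).
Qed.

Let Dm := sval (cid2 (md_bounded HM)).
Let Dm0 : 0 < Dm. Proof. by rewrite /Dm; case: cid2. Qed.
Let dist_le x y : Om x -> Om y -> dist x y <= Dm.
Proof. by rewrite /Dm; case: cid2 => /= D _ H Ox Oy; have [] := H _ _ Ox Oy. Qed.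
Let d_le x : Om x -> d x <= Dm.
Proof. by rewrite /Dm; case: cid2 => /= D _ H Ox; have [] := H _ _ Ox Ox. Qed.

Lemma riesz_bound e : 0 < e < kappa -> exists2 C : R, 0 <= C &
  forall x, Om x -> (\int[mu]_(z in Om) (dist x z `^ (- e))%:E <= C%:E)%E.
Proof.
move=> ek; have mOm := md_Om HM; have [A A0 HA] := md_growth HM.
have [C C0 HC] := integral_powR_near mu A0 ek.
exists (C * (Dm + 1) `^ (kappa - e)); first by rewrite mulr_ge0// powR_ge0.
move=> x Ox; rewrite (_ : Om = Om `&` [set z | dist x z < Dm + 1]); last first.
  apply/seteqP; split => [z Oz|z []//]; split => //=.
  by have := dist_le Ox Oz; lra.
apply: HC => //; [exact: measurable_dist|exact: HA|].
by have := Dm0; lra.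
Qed.

Let quasi_le x y : Om x -> Om y ->
  quasi d dist N gamma x y <= Dm `^ N * (3 * Dm) `^ (2 * gamma).
Proof.
move=> Ox Oy; have d1 := md_d0 HM Ox; have d2 := md_d0 HM Oy.
have l1 := dist_le Ox Oy; have l2 := d_le Ox; have l3 := d_le Oy.
have l4 := dist_ge0 x y.
apply: ler_pM; rewrite ?powR_ge0//; apply: powR_le => //; rewrite ?(ltW N0)//.
- by rewrite mulr_ge0// ltW.
- by rewrite /spread; lra.
- by rewrite /spread; lra.
Qed.

Lemma Phi_comp t t' : 0 < t -> 0 <= t' -> t' <= t -> t' <= 1 ->
  N + (N + 2 * gamma) * (t - t') < kappa ->
  exists2 C : R, 0 <= C & forall f x, nonneg_measurable f -> Om x ->
    (Kint (Phi 1) (Kint (Phi t) f) x <= C%:E * Kint (Phi t') f x)%E.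
Proof.
move=> t0 t'0 t't t'1; set e := N + _ => ek.
have e0 : 0 < e < kappa.
  rewrite ek andbT /e ltr_wpDr// mulr_ge0 ?subr_ge0// addr_ge0 ?(ltW N0)//.
  by rewrite mulr_ge0// ltW.
have [C C0 HC] := riesz_bound e0.
pose Q := (2 `^ N * 3 `^ (2 * gamma)) `^ t'.
have Q0 : 0 <= Q by exact: powR_ge0.
exists (Q * (C + C)); first by rewrite mulr_ge0 ?addr_ge0.
move=> f x hf Ox; have mOm := md_Om HM.
have md1 := measurable_kernel_dist (- e).
pose w x y z := Q * (dist x z `^ (- e) + dist z y `^ (- e)).
have m1 y : measurable_fun Om (fun z => dist y z `^ (- e)).
  exact: (measurable_kernel_slice _ md1).
have m2 y : measurable_fun Om (fun z => dist z y `^ (- e)).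
  exact: (measurable_kernel_slice' _ md1).
apply: (@Kint_comp_le _ _ _ _ _ mOm (md_set1 HM) (md_mu1 HM) _ _ _ w) => //.
- exact: measurable_kernel_Phi.
- exact: measurable_kernel_Phi.
- exact: measurable_kernel_Phi.
- by rewrite mulr_ge0 ?addr_ge0.
- move=> y z Oy Oz xy; rewrite /w [X in _ <= X]mulrCA [X in _ <= X]mulrA.
  exact: (Phi_comp_pointwise (md_distC HM) (md_distxx HM) (md_dist_gt0 HM)
    (md_triangle HM) (md_d0 HM) (md_dlip HM)).
- by move=> y; apply: measurable_funM => //; exact: measurable_funD.
- by move=> y z; rewrite mulr_ge0// addr_ge0 ?powR_ge0.
move=> y Oy; rewrite /w; under eq_integral do rewrite EFinM EFinD.
rewrite ge0_integralZl//=; last 2 first.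
- by apply: emeasurable_funD; apply/measurable_EFinP.
- by move=> z _; rewrite adde_ge0 ?lee_fin ?powR_ge0.
rewrite ge0_integralD//=; last 4 first.
- by move=> z _; rewrite lee_fin powR_ge0.
- by apply/measurable_EFinP.
- by move=> z _; rewrite lee_fin powR_ge0.
- by apply/measurable_EFinP.
rewrite EFinM EFinD lee_wpmul2l// leeD ?HC//.
by under eq_integral do rewrite (md_distC HM); exact: HC.
Qed.

Lemma Phi1_integral : exists2 C : R, 0 <= C & forall y, Om y ->
  (\int[mu]_(x in Om) ((Phi 1 x y)%:E * (d x `^ gamma)%:E) <= (C * d y `^ gamma)%:E)%E.
Proof.
have [|C C0 HC] := @riesz_bound N; first by rewrite N0.
exists C => // y Oy; have mOm := md_Om HM.
apply: (@le_trans _ _ (\int[mu]_(x in Om)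
    ((d y `^ gamma)%:E * (dist y x `^ (- N))%:E))%E).
  apply: le_integral_nonneg => x Ox; first by rewrite mule_ge0 ?lee_fin ?Phi_ge0 ?powR_ge0.
  rewrite -!EFinM lee_fin mulrC (md_distC HM).
  exact: (Phi1_le_ratio (md_distxx HM) (md_dist_gt0 HM) (md_d0 HM) N g0 Ox Oy).
rewrite ge0_integralZl//=; last 3 first.
- by apply/measurable_EFinP; exact: measurable_kernel_slice (measurable_kernel_dist _).
- by move=> x _; rewrite lee_fin powR_ge0.
- by rewrite lee_fin powR_ge0.
by rewrite mulrC EFinM lee_wpmul2l ?lee_fin ?powR_ge0// HC.
Qed.

(** Tonelli lets the kernel act on the weight instead, and by [Phi1_integral] it sends δ^γ to at
    most C δ^γ. *)
Lemma Kint_Phi1_weighted : exists2 C : R, 0 <= C & forall f, nonneg_measurable f ->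
  (\int[mu]_(x in Om) ((d x `^ gamma)%:E * Kint (Phi 1) f x) <=
   C%:E * \int[mu]_(y in Om) ((d y `^ gamma)%:E * f y))%E.
Proof.
have [C C0 HC] := Phi1_integral; exists C => // f hf.
have mOm := md_Om HM.
rewrite (Kint_dual mu mOm)//; last 2 first.
- exact: measurable_kernel_Phi.
- exact: nonneg_measurable_dgamma.
rewrite -ge0_integralZl//; last 2 first.
- by have [] := nonneg_measurableM (nonneg_measurable_dgamma gamma) hf.
- by have [] := nonneg_measurableM (nonneg_measurable_dgamma gamma) hf.
apply: le_integral_nonneg => y Oy.
  rewrite mule_ge0 ?hf.2//; apply: integral_ge0 => x Ox.
  by rewrite mule_ge0 ?lee_fin ?Phi_ge0 ?powR_ge0.
rewrite muleA -EFinM muleC; apply: lee_wpmul2r; first exact: hf.2.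
exact: HC.
Qed.

(** [Phi 0] has rank one, on the diagonal too because 0 to the power 0 is 1. A bound by
    [Kint (Phi 0)] is therefore a uniform bound in terms of a weighted L^1 norm: the end of the
    smoothing. *)
Lemma Kint_Phi0E f x : nonneg_measurable f ->
  (Kint (Phi 0) f x = (d x `^ gamma)%:E * \int[mu]_(y in Om) ((d y `^ gamma)%:E * f y))%E.
Proof.
move=> hf; have mOm := md_Om HM; rewrite -ge0_integralZl//; last 3 first.
- by have [] := nonneg_measurableM (nonneg_measurable_dgamma gamma) hf.
- by have [] := nonneg_measurableM (nonneg_measurable_dgamma gamma) hf.
- by rewrite lee_fin powR_ge0.
by apply: eq_integral => y _; rewrite /= /Phi oppr0 powRr0 mulr1 EFinM muleA.
Qed.

Lemma Phi0_le_Phi1 : exists2 C : R, 0 < C & forall x y, Om x -> Om y -> x <> y ->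
  Phi 0 x y <= C * Phi 1 x y.
Proof.
exists (Dm `^ N * (3 * Dm) `^ (2 * gamma)).
  by rewrite mulr_gt0 ?powR_gt0// mulr_gt0.
move=> x y Ox Oy xy; rewrite /Phi oppr0 powRr0 mulr1 mulrCA ler_peMr//.
  by rewrite mulr_ge0 ?powR_ge0.
have q0 := quasi_gt0 (md_distxx HM) (md_dist_gt0 HM) (md_d0 HM) N gamma Ox Oy xy.
by rewrite powR_inv1 ?(ltW q0)// ler_pdivlMr// mul1r quasi_le.
Qed.

Lemma Kint_Phi0_le : exists2 C : R, 0 < C & forall f x, nonneg_measurable f -> Om x ->
  (Kint (Phi 0) f x <= C%:E * Kint (Phi 1) f x)%E.
Proof.
have [C C0 HC] := Phi0_le_Phi1; exists C => // f x hf Ox.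
have mOm := md_Om HM.
have hP := measurable_kernel_Phi 1.
rewrite -ge0_integralZl//; last 3 first.
- by apply: measurable_Kint_integrand => //; exact: hf.1.
- by move=> y Oy; rewrite mule_ge0 ?lee_fin ?Phi_ge0 ?hf.2.
- by rewrite lee_fin ltW.
apply: ae_le_integral_nonneg => //.
- by apply: measurable_funeM; apply: measurable_Kint_integrand => //; exact: hf.1.
- by move=> y Oy; rewrite mule_ge0 ?lee_fin ?Phi_ge0 ?hf.2.
- by move=> y Oy; rewrite !mule_ge0 ?lee_fin ?Phi_ge0 ?hf.2// ltW.
apply: filterS (ae_neq (md_set1 HM) (md_mu1 HM) x) => y yx Oy.
rewrite muleA -EFinM; apply: lee_wpmul2r; first exact: hf.2.
by rewrite lee_fin HC//; exact/nesym.
Qed.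

(** In [Phi_comp], lowering t by 1/M raises the Riesz exponent from N to N + (N + 2γ)/M, which must
    stay below kappa for the kernel to be integrable. *)
Lemma smoothing_steps : exists2 M : nat, (0 < M)%N & N + (N + 2 * gamma) * M%:R^-1 < kappa.
Proof.
have s0 : 0 < N + 2 * gamma by rewrite addr_gt0// mulr_gt0.
pose M := (Num.bound ((N + 2 * gamma) / (kappa - N))).+1.
exists M => //.
have M0 : 0 < M%:R :> R by rewrite ltr0n.
have k0 : 0 < kappa - N by rewrite subr_gt0.
rewrite -ltrBrDl ltr_pdivrMr// -ltr_pdivrMl// [ltLHS]mulrC.
have h : 0 <= (N + 2 * gamma) / (kappa - N) by rewrite divr_ge0// ltW.
by rewrite (lt_le_trans (archi_boundP h))// ler_nat.
Qed.

Lemma Phi_step (M k : nat) : (0 < M)%N -> N + (N + 2 * gamma) * M%:R^-1 < kappa ->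
  (k < M)%N -> exists2 C : R, 0 <= C & forall f x, nonneg_measurable f -> Om x ->
  (Kint (Phi 1) (Kint (Phi (k.+1%:R / M%:R)) f) x <= C%:E * Kint (Phi (k%:R / M%:R)) f x)%E.
Proof.
move=> M0 HMk kM; have M0' : 0 < M%:R :> R by rewrite ltr0n.
apply: Phi_comp.
- by rewrite divr_gt0.
- by rewrite divr_ge0// ltW.
- by rewrite ler_wpM2r ?invr_ge0 ?(ltW M0')// ler_nat.
- by rewrite ler_pdivrMr// mul1r ler_nat ltnW.
by rewrite -mulrBl -natrB// subSnn mul1r.
Qed.

Lemma Phi_idem : exists2 C : R, 0 <= C & forall f x, nonneg_measurable f -> Om x ->
  (Kint (Phi 1) (Kint (Phi 1) f) x <= C%:E * Kint (Phi 1) f x)%E.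
Proof. by apply: Phi_comp => //; rewrite subrr mulr0 addr0. Qed.

Let Kint_Phi_nn t f : nonneg_measurable f -> nonneg_measurable (Kint (Phi t) f).
Proof. move=> hf; apply: Kint_nonneg => //; first exact: (md_Om HM).
exact: measurable_kernel_Phi. Qed.

(** The current bound for u is substituted under Phi_1 in the inequality for u. The part Phi_1 Phi_1
    h falls back to Phi_1 h by [Phi_idem], and the part with u descends one level by [Phi_step].
    After M substitutions only the rank-one term is left. The constant precedes u and h, so it is
    uniform. *)
Lemma Phi_bootstrap (B L : R) : 0 <= B -> 0 <= L -> exists2 A : R, 0 <= A &
  forall u h, nonneg_measurable u -> nonneg_measurable h ->
  {ae mu, forall x, Om x ->
    (u x <= B%:E * (Kint (Phi 1) h x + L%:E * Kint (Phi 1) u x))%E} ->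
  {ae mu, forall x, Om x -> (u x <= A%:E * (Kint (Phi 1) h x + Kint (Phi 0) u x))%E}.
Proof.
move=> B0 L0; have [M M0 HMk] := smoothing_steps.
have [C1 C10 HC1] := Phi_idem.
have mOm := md_Om HM.
suff claim k : (k <= M)%N -> exists2 A : R, 0 <= A &
    forall u h, nonneg_measurable u -> nonneg_measurable h ->
    {ae mu, forall x, Om x ->
      (u x <= B%:E * (Kint (Phi 1) h x + L%:E * Kint (Phi 1) u x))%E} ->
    {ae mu, forall x, Om x -> (u x <= A%:E * (Kint (Phi 1) h x +
      Kint (Phi ((M - k)%:R / M%:R)) u x))%E}.
  by have := claim M (leqnn M); rewrite subnn mul0r.
elim: k => [_|k IH kM].
  exists (B * (1 + L)); first by rewrite mulr_ge0// addr_ge0.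
  move=> u h hu hh; apply: filterS => x + Ox; move=> /(_ Ox) /le_trans; apply.
  rewrite subn0 divff ?pnatr_eq0 -?lt0n// EFinM -muleA.
  have Kh := (Kint_Phi_nn 1 hh).2 _ Ox; have Ku := (Kint_Phi_nn 1 hu).2 _ Ox.
  apply: lee_wpmul2l; first by rewrite lee_fin.
  rewrite (ge0_muleDr _ Kh Ku) leeD//.
    by rewrite -[leLHS]mul1e; apply: lee_wpmul2r => //; rewrite lee_fin lerDl.
  by apply: lee_wpmul2r => //; rewrite lee_fin lerDr.
have [A A0 HA] := IH (ltnW kM).
have kM' : (M - k.+1 < M)%N by rewrite ltn_subrL.
have [C C0 HC] := Phi_step M0 HMk kM'.
rewrite subnSK// in HC.
exists (B * (1 + L * (A * (C1 + C)))).
  by rewrite mulr_ge0// addr_ge0// mulr_ge0// mulr_ge0// addr_ge0.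
move=> u h hu hh Hu; have := HA _ _ hu hh Hu.
pose t := (M - k)%:R / M%:R : R; rewrite -/t in HC *.
pose v x := (A%:E * (Kint (Phi 1) h x + Kint (Phi t) u x))%E => Huv.
have hv : nonneg_measurable v.
  apply: nonneg_measurableZ => //; apply: nonneg_measurableD; exact: Kint_Phi_nn.
have Kuv x := @Kint_le _ _ _ mu Om mOm _ _ _ x (measurable_kernel_Phi 1) hu hv Huv.
apply: filterS Hu => x + Ox; move=> /(_ Ox) /le_trans; apply.
have Kh := (Kint_Phi_nn 1 hh).2 _ Ox.
set t' := (_ / M%:R : R) in HC *.
have Ku := (Kint_Phi_nn t' hu).2 _ Ox.
rewrite EFinM -muleA; apply: lee_wpmul2l; first by rewrite lee_fin.
have Kv : (Kint (Phi 1) v x <= A%:E * (C1%:E * Kint (Phi 1) h x + C%:E * Kint (Phi t') u x))%E.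
  have hs := nonneg_measurableD (Kint_Phi_nn 1 hh) (Kint_Phi_nn t hu).
  rewrite /v (@KintZ _ _ _ mu Om mOm _ _ x _ (measurable_kernel_Phi 1) hs A0).
  apply: lee_wpmul2l; first by rewrite lee_fin.
  rewrite (@KintD _ _ _ mu Om mOm _ _ _ x (measurable_kernel_Phi 1)
    (Kint_Phi_nn 1 hh) (Kint_Phi_nn t hu)).
  by apply: leeD; [exact: HC1|exact: HC].
have p0 : (0 <= Kint (Phi 1) h x + Kint (Phi t') u x)%E by rewrite adde_ge0.
have c0 : (0 <= A * (C1 + C)) by rewrite mulr_ge0 ?addr_ge0.
rewrite one_add_mule ?mulr_ge0 ?addr_ge0//.
apply: leeD; first by rewrite leeDl.
rewrite EFinM -muleA; apply: lee_wpmul2l; first by rewrite lee_fin.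
apply: le_trans (Kuv x) _; apply: le_trans Kv _.
rewrite EFinM -muleA; apply: lee_wpmul2l; first by rewrite lee_fin.
rewrite (ge0_muleDr _ Kh Ku) leeD// lee_wpmul2r// lee_fin ?lerDl ?lerDr//.
Qed.

End potential.

(** * Spectral theory in L^2 *)

Section lebesgue_norms.
Context (R : realType) (n : nat).
Local Notation E := 'rV[R]_n.
Local Notation leb := (lebesgue_row R n).
Implicit Types (f g : E -> R) (p : R).

Lemma LpnormE (D : set E) p f : 0 < p ->
  Lpnorm D p%:E f = ((\int[leb]_(x in D) (`|f x| `^ p)%:E) `^ p^-1)%E.
Proof.
move=> p0; rewrite /Lpnorm unlock [in RHS]integral_mkcond.
set a := (\int[leb]_x _)%E; set b := (\int[leb]_x _)%E.
suff -> : a = b by []; apply: eq_integral => x _.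
rewrite /= !patchE; case: ifPn => // _.
by rewrite normr0 powR0// gt_eqF.
Qed.

Lemma Lpnorm_ge0 (D : set E) (p : \bar R) f : (0 <= Lpnorm D p f)%E.
Proof. exact: Lnorm_ge0. Qed.

Lemma Lpnorm1E (D : set E) f : Lpnorm D 1%E f = (\int[leb]_(x in D) (`|f x|)%:E)%E.
Proof.
rewrite (LpnormE _ _ (ltr01 : 0 < 1)) invr1 poweRe1.
  by apply: eq_integral => x _; rewrite powRr1.
by apply: integral_ge0 => x _; rewrite lee_fin powR_ge0.
Qed.

Lemma powR_int_ge0 (D : set E) p f : (0 <= \int[leb]_(x in D) (`|f x| `^ p)%:E)%E.
Proof. by apply: integral_ge0 => x _; rewrite lee_fin powR_ge0. Qed.

Lemma Lpnorm_lty (D : set E) p f : 0 < p ->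
  (Lpnorm D p%:E f < +oo)%E <-> (\int[leb]_(x in D) (`|f x| `^ p)%:E < +oo)%E.
Proof.
move=> p0; rewrite LpnormE//; split; last exact: poweR_lty.
by apply: lty_poweRy; rewrite invr_neq0// gt_eqF.
Qed.

Lemma Lpnorm_le_cst (D : set E) p f (C : R) : 0 < p -> 0 <= C ->
  (Lpnorm D p%:E f <= C%:E)%E <->
  (\int[leb]_(x in D) (`|f x| `^ p)%:E <= (C `^ p)%:E)%E.
Proof.
move=> p0 C0; rewrite LpnormE//; set I := (\int[_]_(_ in _) _)%E.
have I0 : (0 <= I)%E := powR_int_ge0 D p f.
have pV0 : 0 <= p^-1 by rewrite invr_ge0 ltW.
have CE : (C `^ p) `^ p^-1 = C by rewrite -powRrM divff ?powRr1// gt_eqF.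
split => [H|H].
- have -> : I = ((I `^ p^-1) `^ p)%E by rewrite -poweRrM mulVf ?gt_eqF// poweRe1.
  rewrite -poweR_EFin; apply: gt0_ler_poweR; rewrite ?in_itv/= ?poweR_ge0 ?leey ?lee_fin ?C0//.
  exact: ltW.
- have -> : C%:E = ((C `^ p)%:E `^ p^-1)%E by rewrite poweR_EFin CE.
  by apply: gt0_ler_poweR => //;
    rewrite in_itv/= ?I0 ?leey ?lee_fin ?powR_ge0.
Qed.

End lebesgue_norms.

Section L2_inner.
Context (R : realType) (n : nat) (Om : set 'rV[R]_n).
Hypothesis mOm : measurable Om.
Local Notation E := 'rV[R]_n.
Local Notation leb := (lebesgue_row R n).
Local Notation L2 := (fmem (Lp Om 2%:E)).
Local Notation inner := (inner Om).
Implicit Types (f g h : E -> R).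

Lemma L2P f : L2 f <-> measurable_fun Om f /\ leb.-integrable Om (fun x => (f x ^+ 2)%:E).
Proof.
have E1 : (\int[leb]_(x in Om) (`|f x| `^ 2)%:E = \int[leb]_(x in Om) `|(f x ^+ 2)%:E|)%E.
  apply: eq_integral => x _.
  by rewrite powR_mulrn// real_normK ?num_real// abse_EFin ger0_norm ?sqr_ge0.
split=> -[mf].
  move=> /(Lpnorm_lty _ _ (ltr0Sn R 1)); rewrite E1 => fi; split => //.
  apply/integrableP; split => //; apply/measurable_EFinP.
  exact: measurable_funX.
by move=> /integrableP[_ fi]; split => //=; apply/(Lpnorm_lty _ _ (ltr0Sn R 1)); rewrite E1.
Qed.

Lemma L2_integrable f g : L2 f -> L2 g ->
  leb.-integrable Om (fun x => (f x * g x)%:E).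
Proof.
move=> /L2P[mf fi] /L2P[mg gi].
apply: le_integrable (integrableD mOm fi gi) => //.
  by apply/measurable_EFinP; exact: measurable_funM.
move=> x _; rewrite /= lee_fin normrM [leRHS]ger0_norm ?addr_ge0 ?sqr_ge0//.
rewrite -(real_normK (num_real (f x))) -(real_normK (num_real (g x))).
have := sqr_ge0 (`|f x| - `|g x|); have := sqr_ge0 (`|f x| + `|g x|).
have : 0 <= `|f x| * `|g x| by exact: mulr_ge0.
move: `|f x| `|g x| => a b ab0 h1 h2; nra.
Qed.

Lemma L2_lin (a b : R) f g : L2 f -> L2 g -> L2 (fun x => a * f x + b * g x).
Proof.
move=> hf hg; have mf := hf.1; have mg := hg.1.
apply/L2P; split.
  by apply: measurable_funD; apply: measurable_funM => //; exact: measurable_cst.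
have -> : (fun x => ((a * f x + b * g x) ^+ 2)%:E) =
    (fun x => ((a ^+ 2)%:E * (f x * f x)%:E + ((2 * a * b)%:E * (f x * g x)%:E
       + (b ^+ 2)%:E * (g x * g x)%:E))%E).
  by apply/funext => x; rewrite -!EFinM -!EFinD; congr EFin; ring.
apply: integrableD => //; first by apply: integrableZl => //; exact: L2_integrable.
by apply: integrableD => //; apply: integrableZl => //; exact: L2_integrable.
Qed.

Lemma L2_linr (a : R) f g : L2 f -> L2 g -> L2 (fun x => a * f x + g x).
Proof.
move=> hf hg; have := L2_lin a 1 hf hg; congr (L2 _).
by apply/funext => x; rewrite mul1r.
Qed.

Lemma L2B f g : L2 f -> L2 g -> L2 (fun x => f x - g x).
Proof.
move=> hf hg; have := L2_lin 1 (-1) hf hg; congr (L2 _).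
by apply/funext => x; rewrite mul1r mulN1r.
Qed.

Lemma L2_0 : L2 (fun=> 0).
Proof.
apply/L2P; split; first exact: measurable_cst.
under eq_fun do rewrite expr0n/=; exact: integrable0.
Qed.

Lemma L2_sum N (c : nat -> R) (f : nat -> E -> R) : (forall j, L2 (f j)) ->
  L2 (fun x => \sum_(j < N) c j * f j x).
Proof.
move=> hf; elim: N => [|N IH].
  by under eq_fun do rewrite big_ord0; exact: L2_0.
under eq_fun do rewrite big_ord_recr /= addrC.
exact: L2_linr.
Qed.

Lemma innerC f g : inner f g = inner g f.
Proof. by apply: eq_Rintegral => x _; rewrite mulrC. Qed.

Lemma inner_linl (a b : R) f g h : L2 f -> L2 g -> L2 h ->
  inner (fun x => a * f x + b * g x) h = a * inner f h + b * inner g h.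
Proof.
move=> hf hg hh; rewrite /inner /Defs.inner.
under eq_Rintegral do rewrite mulrDl -!mulrA.
have i1 := L2_integrable hf hh; have i2 := L2_integrable hg hh.
rewrite RintegralD//=; last 2 first.
- exact: (integrableZl mOm _ i1).
- exact: (integrableZl mOm _ i2).
by rewrite !RintegralZl.
Qed.

Lemma innerDl (a : R) f g h : L2 f -> L2 g -> L2 h ->
  inner (fun x => a * f x + g x) h = a * inner f h + inner g h.
Proof.
move=> hf hg hh; rewrite -(mul1r (inner g h)) -inner_linl//.
by congr (inner _ h); apply/funext => x; rewrite mul1r.
Qed.

Lemma innerBl f g h : L2 f -> L2 g -> L2 h ->
  inner (fun x => f x - g x) h = inner f h - inner g h.
Proof.
move=> hf hg hh; rewrite -(mul1r (inner f h)) -mulN1r -inner_linl//.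
by congr (inner _ h); apply/funext => x; rewrite mul1r mulN1r.
Qed.

Lemma inner0l h : inner (fun=> 0) h = 0.
Proof.
rewrite /inner /Defs.inner; under eq_Rintegral do rewrite mul0r.
by rewrite /Rintegral integral0.
Qed.

Lemma inner_suml N (c : nat -> R) (f : nat -> E -> R) h : (forall j, L2 (f j)) -> L2 h ->
  inner (fun x => \sum_(j < N) c j * f j x) h = \sum_(j < N) c j * inner (f j) h.
Proof.
move=> hf hh; elim: N => [|N IH].
  rewrite [RHS]big_ord0 -[RHS](inner0l h); congr (inner _ h).
  by apply/funext => x; rewrite big_ord0.
rewrite big_ord_recr/= -IH addrC -innerDl//; last exact: L2_sum.
by congr (inner _ h); apply/funext => x; rewrite big_ord_recr/= addrC.
Qed.

Lemma inner_ge0 f : 0 <= inner f f.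
Proof. by apply: Rintegral_ge0 => x _; rewrite -expr2 sqr_ge0. Qed.

Lemma cauchy_schwarz f g : L2 f -> L2 g -> inner f g ^+ 2 <= inner f f * inner g g.
Proof.
move=> hf hg.
have H (a b : R) : 0 <= a * a * inner f f + 2 * (a * b * inner f g) + b * b * inner g g.
  have := inner_ge0 (fun x => a * f x + b * g x).
  have hl := L2_lin a b hf hg.
  rewrite inner_linl// (innerC f) (innerC g) !inner_linl// (innerC g f).
  by congr (0 <= _); ring.
have [gg0|gg0] := eqVneq (inner g g) 0.
  rewrite gg0 mulr0; have := H (- inner f g) ((inner f f + 1) * 1).
  have := H 1 (- (inner f f + 1) / 2 * inner f g); rewrite gg0.
  set u := inner f g; set v := inner f f => h1 _.
  have v0 : 0 <= v := inner_ge0 f.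
  have : (v + 1) * u ^+ 2 <= v by move: h1; nra.
  move=> h2.
  have [->|u0] := eqVneq u 0; first by rewrite expr0n.
  (* When g has norm 0 the quadratic form is affine in b, and a non-zero slope makes it negative for
     this b. *)
  have := H 1 (- (v + 1) / u); rewrite gg0 -/u -/v.
  rewrite (_ : 1 * (- (v + 1) / u) * u = - (v + 1)); last by field.
  lra.
have gp : 0 < inner g g by rewrite lt_neqAle eq_sym gg0 inner_ge0.
have := H (inner g g) (- inner f g).
rewrite [X in 0 <= X](_ : _ = inner g g * (inner f f * inner g g - inner f g ^+ 2)); last by ring.
by rewrite pmulr_rge0// subr_ge0.
Qed.

Lemma inner_ae f g h : L2 f -> L2 g -> L2 h ->
  f = g %[ae leb in Om] -> inner f h = inner g h.
Proof.
move=> hf hg hh fg; rewrite /inner /Defs.inner /Rintegral; congr fine.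
apply: ae_eq_integral => //.
- by apply/measurable_EFinP; apply: measurable_funM; [exact: hf.1|exact: hh.1].
- by apply/measurable_EFinP; apply: measurable_funM; [exact: hg.1|exact: hh.1].
by apply: filterS fg => x fg Ox; rewrite fg.
Qed.

Lemma inner_eq0 f : L2 f -> inner f f = 0 -> f = (fun=> 0) %[ae leb in Om].
Proof.
move=> hf f0.
have i1 := L2_integrable hf hf.
have : (\int[leb]_(x in Om) `|(f x * f x)%:E| = 0)%E.
  rewrite (eq_integral (fun x => (f x * f x)%:E)); last first.
    by move=> x _; rewrite abse_EFin ger0_norm// -expr2 sqr_ge0.
  by rewrite -(fineK (integrable_fin_num mOm i1)) -/(Rintegral _ _ _) -[X in X%:E]/(inner f f) f0.
have mff : measurable_fun Om (fun x => (f x * f x)%:E) by have /integrableP[] := i1.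
move=> /(ae_eq_integral_abs leb mOm mff); apply: filterS => x /= H Ox.
have := H Ox; move=> [] /eqP; rewrite mulf_eq0 orbb => /eqP -> //.
Qed.

Lemma Lpnorm2E f : L2 f -> Lpnorm Om 2%:E f = (Num.sqrt (inner f f))%:E.
Proof.
move=> hf; rewrite LpnormE// -powR12_sqrt ?inner_ge0// -poweR_EFin; congr (_ `^ _)%E.
rewrite /inner /Defs.inner /Rintegral fineK; last exact/integrable_fin_num/L2_integrable.
apply: eq_integral => x _.
by rewrite powR_mulrn// real_normK ?num_real// expr2.
Qed.

Lemma Lpnorm2_cvg0 (f : nat -> E -> R) : (forall N, L2 (f N)) ->
  Lpnorm Om 2%:E (f N) @[N --> \oo] --> 0%E <-> inner (f N) (f N) @[N --> \oo] --> 0.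
Proof.
move=> hf; under eq_fun do rewrite (Lpnorm2E (hf _)); split => [/fine_cvgP[_ H]|H].
- have : (fun N => Num.sqrt (inner (f N) (f N)) ^+ 2) @ \oo --> (0 : R) ^+ 2.
    by rewrite expr2; under eq_fun do rewrite expr2; exact: cvgM.
  by rewrite expr0n/=; under eq_fun do rewrite sqr_sqrtr ?inner_ge0//.
- apply/fine_cvgP; split; first exact: nearW.
  have : (fun N => Num.sqrt (inner (f N) (f N))) @ \oo --> Num.sqrt 0.
    by apply: continuous_cvg => //; exact: sqrt_continuous.
  by rewrite sqrtr0.
Qed.

End L2_inner.

Section spectral_gap.
Context (R : realType) (lam : nat -> R).
Hypothesis lamy : lam @ \oo --> +oo.

Lemma near_lam_ge (A : R) : exists N, forall j, (N <= j)%N -> A <= lam j.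
Proof.
have /cvgryPge/(_ A)[N _ H] := lamy.
by exists N => j Nj; apply: H.
Qed.

Lemma dist_Sigma_lbound l : lbound (range (fun j => `|lam j - l|)) 0.
Proof. by move=> _ [j _ <-]. Qed.

Lemma dist_Sigma_le l j : dist_Sigma lam l <= `|lam j - l|.
Proof.
by apply: ge_inf; [exists 0; exact: dist_Sigma_lbound|exists j].
Qed.

(** Only finitely many eigenvalues are within distance 1 of l, and none of them equals l; so the
    infimum is bounded below by a minimum over finitely many positive numbers. *)
Lemma dist_Sigma_gt0 l : ~ Sigma lam l -> 0 < dist_Sigma lam l.
Proof.
move=> Sl; have [N HN] := near_lam_ge (l + 1).
have pos j : 0 < `|lam j - l|.
  by rewrite normr_gt0 subr_eq0; apply/eqP => e; apply: Sl; exists j.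
have [e e0 He] : exists2 e : R, 0 < e & forall j, (j < N)%N -> e <= `|lam j - l|.
  elim: N {HN} => [|N [e e0 He]]; first by exists 1.
  exists (Num.min e `|lam N - l|); first by rewrite lt_min e0 pos.
  move=> j; rewrite ltnS leq_eqVlt => /orP[/eqP->|jN].
    by rewrite ge_min lexx orbT.
  by rewrite ge_min He.
apply: (@lt_le_trans _ _ (Num.min e 1)); first by rewrite lt_min e0 ltr01.
apply: lb_le_inf; first by exists `|lam 0%N - l|, 0%N.
move=> _ [j _ <-]; have [jN|Nj] := ltnP j N; first by rewrite ge_min He.
rewrite ge_min; apply/orP; right; have := HN _ Nj => H.
by apply: le_trans (ler_norm _); lra.
Qed.

(** A jump index exists: otherwise the non-decreasing sequence would be constant from some index on,
    against its divergence. Hence the choice in [first_jump] returns a genuine jump and not its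
    default 0. *)
Lemma le_lambda_bar l : (forall j, lam j <= lam j.+1) -> l <= lambda_bar lam l.
Proof.
move=> mlam; have [N HN] := near_lam_ge l.
have [j Jj] : exists j, jump_index lam l j.
  apply: contrapT => noj.
  have H k : lam (N + k)%N <= lam N.
    elim: k => [|k IH]; first by rewrite addn0.
    apply: le_trans IH; rewrite addnS leNgt; apply/negP => lt.
    by apply: noj; exists (N + k)%N; split => //; apply: HN; rewrite leq_addr.
  have [M HM] := near_lam_ge (lam N + 1).
  by have := HM (N + M)%N (leq_addl _ _); have := H M; lra.
have [I [JI _]] : exists I, [set I | jump_index lam l I /\
                    forall j, jump_index lam l j -> (I <= j)%N] I.
  have ex : exists j, `[< jump_index lam l j >] by exists j; exact/asboolP.
  exists (ex_minn ex); case: ex_minnP => m /asboolP Jm Hm; split => // k Jk.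
  exact/Hm/asboolP.
have : jump_index lam l (first_jump lam l).
  rewrite /first_jump; case: xgetP => [k -> []//|H].
  exfalso; apply: (H (ex_minn (P := fun j => `[< jump_index lam l j >])
    (ex_intro _ j (asboolT Jj)))).
  case: ex_minnP => m /asboolP Jm Hm; split => // k Jk; exact/Hm/asboolP.
by move=> [h1 /ltW h2]; exact: le_trans h1 h2.
Qed.

(** For l >= 0 this is l <= λ-bar. For l < 0 all eigenvalues are positive, hence at distance at
    least |l| from l. It extracts a bound on |l| from the two parameters that the constants may
    depend on. *)
Lemma normr_le_lambda_bar l : 0 < lam 0%N -> (forall j, lam j <= lam j.+1) ->
  `|l| <= `|lambda_bar lam l| + dist_Sigma lam l.
Proof.
move=> l0 mlam; have d0 : 0 <= dist_Sigma lam l.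
  by apply: lb_le_inf; [exists `|lam 0%N - l|, 0%N|exact: dist_Sigma_lbound].
have [lge0|llt0] := leP 0 l.
  rewrite ger0_norm//; have := le_lambda_bar l mlam.
  by have := ler_norm (lambda_bar lam l); lra.
have lampos j : 0 < lam j by elim: j => // j; have := mlam j; lra.
suff : `|l| <= dist_Sigma lam l by have := normr_ge0 (lambda_bar lam l); lra.
apply: lb_le_inf; first by exists `|lam 0%N - l|, 0%N.
move=> _ [j _ <-]; have := lampos j => ?.
by rewrite ltr0_norm// gtr0_norm; lra.
Qed.

End spectral_gap.

(** * Eigenfunction expansions and the L^2 resolvent *)

Section eigenbasis.
Context (R : realType) (n : nat) (Om : set 'rV[R]_n).
Hypothesis oOm : open Om.
Local Notation E := 'rV[R]_n.
Local Notation leb := (lebesgue_row R n).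
Local Notation L2 := (fmem (Lp Om 2%:E)).
Local Notation inner := (inner Om).
Implicit Types (f g h u v : E -> R).

Let mOm : measurable Om. Proof. exact: open_measurable_row. Qed.

Lemma measurable_continuous_open f : {within closure Om, continuous f} -> measurable_fun Om f.
Proof.
move=> cf; have {}cf : {within Om, continuous f}.
  by apply: continuous_subspaceW cf; exact: subset_closure.
apply: (measurability (@RGenOpens.G R)); first exact: RGenOpens.measurableE.
move=> _ [_ [a [b ->] <-]]; apply: open_measurable_row.
rewrite continuous_open_subspace// in cf.
exact: ((continuous_inP f oOm).1 cf _ (interval_open _ _)).
Qed.

Lemma Lpnorm_distC f g : Lpnorm Om 2%:E (fun x => f x - g x) = Lpnorm Om 2%:E (fun x => g x - f x).
Proof.
rewrite (LpnormE Om (fun x => f x - g x) (ltr0Sn R 1)) (LpnormE Om (fun x => g x - f x) (ltr0Sn R 1)).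
by under eq_integral do rewrite distrC.
Qed.

Lemma L2_cvg_inner (v : nat -> E -> R) u f : (forall k, L2 (v k)) -> L2 u -> L2 f ->
  Lpnorm Om 2%:E (fun x => v k x - u x) @[k --> \oo] --> 0%E ->
  (fun k => inner (v k) f) @ \oo --> inner u f.
Proof.
move=> hv hu hf /(Lpnorm2_cvg0 mOm (fun k => L2B mOm (hv k) hu)) cv.
have c1 : (fun k => inner (fun x => v k x - u x) (fun x => v k x - u x) * inner f f) @ \oo
    --> (0 : R).
  by rewrite -(mul0r (inner f f)); apply: cvgM => //; exact: cvg_cst.
have c2 : (fun k => (inner (v k) f - inner u f) ^+ 2) @ \oo --> (0 : R).
  apply: squeeze_cvgr (cvg_cst 0) c1; apply: nearW => k; rewrite sqr_ge0/=.
  by rewrite -innerBl//; apply: cauchy_schwarz => //; exact: L2B.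
have c3 : (fun k => Num.sqrt ((inner (v k) f - inner u f) ^+ 2)) @ \oo --> Num.sqrt (0 : R).
  by apply: continuous_cvg => //; exact: sqrt_continuous.
have c4 : (fun k => `|inner (v k) f - inner u f|) @ \oo --> (0 : R).
  by rewrite -sqrtr0; under eq_fun do rewrite -sqrtr_sqr.
apply/subr_cvg0; apply: (@norm_cvg0 R) => //.
Qed.

Lemma L2_limit_inner (v : nat -> E -> R) u f (a : R) : (forall k, L2 (v k)) -> L2 u -> L2 f ->
  Lpnorm Om 2%:E (fun x => v k x - u x) @[k --> \oo] --> 0%E ->
  (\forall k \near \oo, inner (v k) f = a) -> inner u f = a.
Proof.
move=> hv hu hf cv ev; apply: (cvg_unique (@Rhausdorff R) (L2_cvg_inner hv hu hf cv)).
exact: cvg_near_cst.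
Qed.

Variables (G : E -> E -> R) (lam : nat -> R) (phi : nat -> E -> R).
Hypothesis EB : green_eigenbasis Om G lam phi.
Local Notation c f j := (inner f (phi j)).

Lemma eigen_L2 j : L2 (phi j).
Proof.
have mp := measurable_continuous_open (@eigen_cont _ _ _ _ _ _ EB j).
apply/L2P => //; split => //; apply/integrableP; split.
  by apply/measurable_EFinP; exact: measurable_funX.
under eq_integral do rewrite abse_EFin ger0_norm ?sqr_ge0// expr2.
(* An infinite integral would be read as 0 by [fine], against the normalisation to 1. So square
   integrability is contained in orthonormality. *)
rewrite ltey; apply/eqP => H; have := eigen_orthonormal EB j j.
rewrite /Defs.inner /Rintegral H eqxx /= => /esym/eqP.
by rewrite oner_eq0.
Qed.

#[local] Hint Resolve eigen_L2 : core.

Lemma eigen_gt0 j : 0 < lam j.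
Proof. by elim: j => [|j]; [exact: eigen_pos EB|have := eigen_le EB j; lra]. Qed.

Lemma inner_eigen_sum (a : nat -> R) N k : (k < N)%N ->
  c (fun x => \sum_(j < N) a j * phi j x) k = a k.
Proof.
move=> kN; rewrite inner_suml// (bigD1 (Ordinal kN))//= (eigen_orthonormal EB) eqxx mulr1.
rewrite big1 ?addr0// => i ik; rewrite (eigen_orthonormal EB).
by rewrite (_ : (nat_of_ord i == k) = false) ?mulr0//; exact: negbTE ik.
Qed.

Lemma inner_eigen_sums (a : nat -> R) N :
  inner (fun x => \sum_(j < N) a j * phi j x) (fun x => \sum_(j < N) a j * phi j x) =
  \sum_(j < N) a j ^+ 2.
Proof.
rewrite inner_suml//; last exact: (L2_sum mOm N _ eigen_L2).
apply: eq_bigr => j _; rewrite innerC inner_eigen_sum//.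
Qed.

Lemma inner_residual f N : L2 f ->
  inner (fun x => f x - \sum_(j < N) c f j * phi j x)
        (fun x => f x - \sum_(j < N) c f j * phi j x) =
  inner f f - \sum_(j < N) c f j ^+ 2.
Proof.
move=> hf; have hS := L2_sum mOm N (fun j => c f j) eigen_L2.
have hB := L2B mOm hf hS.
have fS : inner f (fun x => \sum_(j < N) c f j * phi j x) = \sum_(j < N) c f j ^+ 2.
  rewrite innerC (inner_suml mOm N (fun j => c f j) eigen_L2 hf).
    by apply: eq_bigr => j _; rewrite (innerC _ _ f) expr2.
rewrite innerBl// (innerC _ f) (innerC _ (fun x => \sum_(j < N) _)) !innerBl//.
rewrite (inner_eigen_sums (fun j => c f j)) fS (innerC _ _ f) fS; ring.
Qed.

Lemma bessel f N : L2 f -> \sum_(j < N) c f j ^+ 2 <= inner f f.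
Proof. by move=> hf; rewrite -subr_ge0 -inner_residual// inner_ge0. Qed.

Lemma parseval f : L2 f -> (fun N => \sum_(j < N) c f j ^+ 2) @ \oo --> inner f f.
Proof.
move=> hf; have := eigen_total EB hf.
move/(Lpnorm2_cvg0 mOm (fun N => L2B mOm hf (L2_sum mOm N (fun j => c f j) eigen_L2))) => H.
have : (fun N => inner f f - (inner f f - \sum_(j < N) c f j ^+ 2)) @ \oo --> inner f f - 0.
  by apply: cvgB; [exact: cvg_cst|under eq_fun do rewrite -inner_residual//].
by rewrite subr0; under eq_fun do rewrite opprB addrC subrK.
Qed.

Lemma inner_le_coef f u (A : R) : 0 <= A -> L2 f -> L2 u ->
  (forall j, `|c u j| <= A * `|c f j|) -> inner u u <= A ^+ 2 * inner f f.
Proof.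
move=> A0 hf hu H; apply: (cvgr_to_le (parseval hu)).
apply: nearW => N; apply: (@le_trans _ _ (A ^+ 2 * \sum_(j < N) c f j ^+ 2)).
  rewrite mulr_sumr; apply: ler_sum => j _.
  rewrite -(real_normK (num_real (c u j))) -(real_normK (num_real (c f j))) -exprMn.
  by rewrite ler_pXn2r ?nnegrE ?mulr_ge0.
by rewrite ler_wpM2l ?sqr_ge0// bessel.
Qed.

Lemma eq_coef u v : L2 u -> L2 v -> (forall j, c u j = c v j) -> u = v %[ae leb in Om].
Proof.
move=> hu hv H; have hB := L2B mOm hu hv.
have B0 : inner (fun x => u x - v x) (fun x => u x - v x) = 0.
  apply/eqP; rewrite eq_le inner_ge0 andbT.
  have := @inner_le_coef (fun=> 0) _ 0 (lexx 0) (L2_0 Om) hB.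
  rewrite expr0n mul0r; apply => j.
  by rewrite innerBl// H subrr normr0 mul0r.
apply: filterS (inner_eq0 mOm hB B0) => x /= H' Ox.
by apply/eqP; rewrite -subr_eq0; apply/eqP; exact: H'.
Qed.

Lemma spectral_sum_coef l f u : is_spectral_sum Om lam phi l f u ->
  forall j, c u j = c f j / (lam j - l).
Proof.
move=> [hu cv] j.
pose S N := fun x => \sum_(j < N) c f j / (lam j - l) * phi j x.
have hS N : L2 (S N) by exact: (L2_sum mOm N (fun j => c f j / (lam j - l)) eigen_L2).
apply: (L2_limit_inner hS hu (eigen_L2 j)).
  by under eq_fun do rewrite (Lpnorm_distC _ u).
by exists j.+1 => // N /= jN; exact: (inner_eigen_sum (fun j => c f j / (lam j - l)) jN).
Qed.

Lemma coef_spectral_sum l f u : L2 u ->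
  (forall j, c u j = c f j / (lam j - l)) -> is_spectral_sum Om lam phi l f u.
Proof.
move=> hu H; split => //; have := eigen_total EB hu.
by under eq_fun do under eq_fun do under eq_bigr do rewrite H.
Qed.

Hypothesis SA : L2_self_adjoint Om (green_op Om G).
Hypothesis CO : L2_compact Om (green_op Om G).
Local Notation G0 := (green_op Om G).

Lemma green_L2 h : L2 h -> L2 (G0 h).
Proof. exact: CO.1. Qed.

(** Self-adjointness moves the Green operator to the eigenfunction, where it is division by the
    eigenvalue. *)
Lemma green_coef h j : L2 h -> c (G0 h) j = c h j / lam j.
Proof.
move=> hh; rewrite SA//; have lj := eigen_gt0 j.
have -> : c h j = lam j * inner h (G0 (phi j)).
  have Lg := green_L2 (eigen_L2 j); have L0 := L2_0 Om.
  have e := innerDl mOm (lam j) Lg L0 hh; rewrite inner0l addr0 in e.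
  rewrite innerC [in RHS]innerC -e; apply: inner_ae => //; first exact: L2_linr.
  by apply: filterS (eigen_eq EB j) => x H Ox; rewrite addr0; exact: H.
by rewrite mulrC mulKf// gt_eqF.
Qed.

(** Compactness of the Green operator takes the place of completeness of L^2. The series with
    coefficients multiplied by λ_j has bounded partial sums, since |λ_j/(λ_j - l)| <= 1 + |l|/d; the
    Green operator maps them to the partial sums of the wanted series. A subsequence converges, and
    its limit has the right coefficients. *)
Lemma spectral_sum_exists l f (d : R) : 0 < d -> (forall j, d <= `|lam j - l|) -> L2 f ->
  exists u, is_spectral_sum Om lam phi l f u.
Proof.
move=> d0 dl hf.
have ln0 j : lam j - l != 0 by rewrite -normr_gt0 (lt_le_trans d0).
pose b j := lam j * (c f j / (lam j - l)).
pose F N := fun x => \sum_(j < N) b j * phi j x.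
have hF N : L2 (F N) by exact: (L2_sum mOm N _ eigen_L2).
pose A := 1 + `|l| / d.
have A0 : 0 <= A by rewrite addr_ge0// divr_ge0// ltW.
have bA j : `|b j| <= A * `|c f j|.
  rewrite /b mulrCA normrM mulrC ler_wpM2r//.
  rewrite (_ : lam j / (lam j - l) = 1 + l / (lam j - l)); last by field.
  apply: le_trans (ler_normD _ _) _; rewrite normr1 lerD2l normrM normfV.
  by rewrite ler_wpM2l// lef_pV2// posrE (lt_le_trans d0).
have FA N : inner (F N) (F N) <= A ^+ 2 * inner f f.
  rewrite inner_eigen_sums; apply: le_trans (_ : A ^+ 2 * \sum_(j < N) c f j ^+ 2 <= _).
    rewrite mulr_sumr; apply: ler_sum => j _.
    rewrite -(real_normK (num_real (b j))) -(real_normK (num_real (c f j))) -exprMn.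
    by rewrite ler_pXn2r ?nnegrE ?mulr_ge0.
  by rewrite ler_wpM2l ?sqr_ge0// bessel.
have [|h [u [hh hu cv]]] := CO.2 F (Num.sqrt (A ^+ 2 * inner f f)).
  move=> k; split => //; rewrite Lpnorm2E// lee_fin ler_sqrt// mulr_ge0 ?sqr_ge0//.
  exact: inner_ge0.
exists u; apply: coef_spectral_sum => // j.
apply: (L2_limit_inner (fun k => green_L2 (hF (h k))) hu (eigen_L2 j) cv).
have hk k : (k <= h k)%N by elim: k => // k IH; exact: leq_ltn_trans IH (hh k).
exists j.+1 => // k /= jk; rewrite green_coef// inner_eigen_sum; last exact: leq_trans (hk k).
by rewrite /b mulrAC mulfV ?mul1r// gt_eqF// eigen_gt0.
Qed.

Lemma spectral_sum_bound l f u (d : R) : 0 < d -> (forall j, d <= `|lam j - l|) -> L2 f ->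
  is_spectral_sum Om lam phi l f u -> inner u u <= d^-1 ^+ 2 * inner f f.
Proof.
move=> d0 dl hf hu; have L2u := hu.1.
apply: inner_le_coef => //; first by rewrite invr_ge0 ltW.
move=> j; rewrite (spectral_sum_coef hu) normrM mulrC ler_wpM2r// normfV.
by rewrite lef_pV2// posrE (lt_le_trans d0).
Qed.

Lemma spectral_sum_unique l f u v : is_spectral_sum Om lam phi l f u ->
  is_spectral_sum Om lam phi l f v -> u = v %[ae leb in Om].
Proof.
move=> hu hv; have [L2u _] := hu; have [L2v _] := hv.
by apply: eq_coef => // j; rewrite (spectral_sum_coef hu) (spectral_sum_coef hv).
Qed.

(** On coefficients, with m = λ_j: 1/(m - l) = l/(m (m - l)) + 1/m. Here the solution itself stands
    under the Green operator, which is the form that can be bootstrapped. *)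
Lemma resolvent_right l h u : (forall j, lam j - l != 0) -> L2 h ->
  is_spectral_sum Om lam phi l h u ->
  u = (fun x => l * G0 u x + G0 h x) %[ae leb in Om].
Proof.
move=> ln0 hh hu; have [L2u _] := hu.
apply: eq_coef => //; first by apply: L2_linr => //; exact: green_L2.
move=> j; rewrite (innerDl mOm _ (green_L2 L2u) (green_L2 hh) (eigen_L2 j)) !green_coef// (spectral_sum_coef hu).
have := ln0 j; have := eigen_gt0 j => /lt0r_neq0; move: (c h j) (lam j) => a m h1 h2.
by field; rewrite h1 h2.
Qed.

(** The same identity on coefficients, now with the resolvent applied to the smoother datum G h;
    this is the form that allows the resolvent to be defined on rougher data. *)
Lemma resolvent_left l h u : (forall j, lam j - l != 0) -> L2 h ->
  is_spectral_sum Om lam phi l (G0 h) u ->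
  is_spectral_sum Om lam phi l h (fun x => l * u x + G0 h x).
Proof.
move=> ln0 hh hu; have [L2u _] := hu.
apply: coef_spectral_sum; first by apply: L2_linr => //; exact: green_L2.
move=> j; rewrite (innerDl mOm _ L2u (green_L2 hh) (eigen_L2 j)) (spectral_sum_coef hu) !green_coef//.
have := ln0 j; have := eigen_gt0 j => /lt0r_neq0; move: (c h j) (lam j) => a m h1 h2.
by field; rewrite h1 h2.
Qed.

Lemma spectral_sum_lin l (a : R) f g u v : L2 f -> L2 g ->
  is_spectral_sum Om lam phi l f u -> is_spectral_sum Om lam phi l g v ->
  is_spectral_sum Om lam phi l (fun x => a * f x + g x) (fun x => a * u x + v x).
Proof.
move=> hf hg hu hv; have [L2u _] := hu; have [L2v _] := hv.
apply: coef_spectral_sum; first exact: L2_linr.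
by move=> j; rewrite !innerDl// (spectral_sum_coef hu) (spectral_sum_coef hv) mulrDl mulrA.
Qed.

(** On eigenfunction expansions the form is the sum of the c_j^2/λ_j. Its positivity is what
    excludes n < 2s. *)
Lemma green_inner_ge0 f : L2 f -> 0 <= inner (G0 f) f.
Proof.
move=> hf; pose S N := fun x => \sum_(j < N) c f j * phi j x.
have hS N : L2 (S N) by exact: (L2_sum mOm N (fun j => c f j) eigen_L2).
have cS : Lpnorm Om 2%:E (fun x => S N x - f x) @[N --> \oo] --> 0%E.
  by under eq_fun do rewrite (Lpnorm_distC _ f); exact: (eigen_total EB hf).
rewrite innerC; apply: (cvgr_to_ge (L2_cvg_inner hS hf (green_L2 hf) cS)).
apply: nearW => N; rewrite (inner_suml mOm N (fun j => c f j) eigen_L2 (green_L2 hf)); apply: sumr_ge0 => j _.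
by rewrite (innerC _ (phi j)) green_coef// mulrA -expr2 divr_ge0 ?sqr_ge0// ltW// eigen_gt0.
Qed.

End eigenbasis.

(** * The resolvent and its pointwise bound *)

Section green_operator.
Context disp (E : measurableType disp) (R : realType).
Variable mu : {sigma_finite_measure set E -> \bar R}.
Variables (Om : set E) (d : E -> R) (dist : E -> E -> R) (kappa : R).
Hypothesis HM : metric_domain mu Om d dist kappa.
Variables (N gamma : R).
Hypotheses (N0 : 0 < N) (Nk : N < kappa) (g0 : 0 < gamma).
Variables (G : E -> E -> R) (CG : R).
Let offdiag := [set z : E * E | [/\ Om z.1, Om z.2 & z.1 <> z.2]].
Hypotheses (mG : measurable_fun offdiag (fun z => G z.1 z.2)) (CG0 : 0 < CG)
  (G0 : forall x y, offdiag (x, y) -> 0 <= G x y)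
  (GC : forall x y, offdiag (x, y) -> G x y <= CG * Phi d dist N gamma 1 x y).
Local Notation Phi := (Phi d dist N gamma).
Local Notation Kint := (Kint mu Om).
Local Notation nonneg_measurable := (nonneg_measurable Om).
Implicit Types (f h : E -> R).

Let mOm : measurable Om := md_Om HM.

Definition Gop f (x : E) : R := \int[mu]_(y in Om) (G x y * f y).

(** The Green function is known to be measurable and non-negative only off the diagonal of Om x Om;
    extended by 0 it becomes a kernel on the whole space. Integrals over y do not change, because
    {x} is a null set. *)
Definition offG (x y : E) : R := if pselect (offdiag (x, y)) then G x y else 0.

Lemma measurable_offdiag : measurable offdiag.
Proof.
rewrite (_ : offdiag = (Om `*` Om) `&` ((fun z : E * E => dist z.1 z.2) @^-1` `]0, +oo[)).
  apply: measurableI; first exact: measurableX.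
  by rewrite -[X in measurable X]setTI; exact: (md_dist HM).
apply/seteqP; split=> [[x y] /= [Ox Oy xy]|[x y] /= [[Ox Oy]]].
  by split => //; rewrite in_itv/= andbT; exact: (md_dist_gt0 HM).
rewrite in_itv/= andbT => H; split => //= xy.
by rewrite xy (md_distxx HM) ltxx in H.
Qed.

Lemma measurable_kernel_offG : measurable_kernel offG.
Proof.
split; last by move=> x y; rewrite /offG; case: pselect => // xy; exact: G0.
rewrite (_ : (fun _ => _) = (fun z => G z.1 z.2) \_ offdiag).
  by apply/(measurable_restrictT _ measurable_offdiag).
apply/funext => -[x y]; rewrite /offG /patch/=.
by case: pselect => [H|H]; [rewrite mem_set|rewrite memNset].
Qed.

Lemma offG_le x y : offG x y <= CG * Phi 1 x y.
Proof.
rewrite /offG; case: pselect => [H|H]; first exact: GC.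
by rewrite mulr_ge0 ?Phi_ge0// ltW.
Qed.

Lemma offG_neq x y : Om x -> Om y -> y <> x -> offG x y = G x y.
Proof. by move=> Ox Oy xy; rewrite /offG; case: pselect => // -[]; split => //; exact/nesym. Qed.

Lemma measurable_Gop_integrand f x : Om x -> measurable_fun Om f ->
  measurable_fun Om (fun y => (G x y * f y)%:E).
Proof.
move=> Ox mf; apply/measurable_EFinP; apply: measurable_funM => //.
rewrite (_ : Om = (Om `\` [set x]) `|` (Om `&` [set x])); last first.
  by rewrite setUC setUIDK.
apply/measurable_funU; [exact: measurableD (md_set1 HM x)|exact: measurableI (md_set1 HM x)|split].
  apply: (eq_measurable_fun (offG x)).
    by move=> y /set_mem[Oy yx]; rewrite offG_neq.
  apply: (measurable_funS mOm _ (measurable_kernel_slice x measurable_kernel_offG)).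
  exact: subDsetl.
apply: (eq_measurable_fun (cst (G x x))); last exact: measurable_cst.
by move=> y /set_mem[Oy ->].
Qed.

Lemma Gop_integrand_ae f x : Om x ->
  {ae mu, forall y, Om y -> (G x y * f y)%:E = (offG x y * f y)%:E}.
Proof.
move=> Ox; apply: filterS (ae_neq (md_set1 HM) (md_mu1 HM) x) => y yx Oy.
by rewrite offG_neq.
Qed.

Lemma measurable_offG_integrand f x : measurable_fun Om f ->
  measurable_fun Om (fun y => (offG x y * f y)%:E).
Proof.
move=> mf; apply/measurable_EFinP; apply: measurable_funM => //.
exact: (measurable_kernel_slice x measurable_kernel_offG).
Qed.

Lemma GopE f x : Om x -> measurable_fun Om f -> Gop f x = \int[mu]_(y in Om) (offG x y * f y).
Proof.
move=> Ox mf; rewrite /Gop /Rintegral; congr fine; apply: ae_eq_integral => //.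
- exact: measurable_Gop_integrand.
- exact: measurable_offG_integrand.
- exact: Gop_integrand_ae.
Qed.

Lemma nonneg_measurable_norm f : measurable_fun Om f -> nonneg_measurable (fun x => `|f x|%:E).
Proof.
move=> mf; split; first by apply/measurable_EFinP; exact: measurableT_comp.
by move=> x _; rewrite lee_fin.
Qed.

Lemma Gop_integrand_le f x : Om x -> measurable_fun Om f ->
  (\int[mu]_(y in Om) `|(offG x y * f y)%:E| <= CG%:E * Kint (Phi 1) (fun y => `|f y|%:E) x)%E.
Proof.
move=> Ox mf; have hf := nonneg_measurable_norm mf.
have hP := measurable_kernel_Phi HM N gamma 1.
rewrite -ge0_integralZl//; last 3 first.
- exact: measurable_Kint_integrand hP hf.1.
- by move=> y Oy; rewrite mule_ge0 ?lee_fin ?Phi_ge0.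
- by rewrite lee_fin ltW.
apply: le_integral_nonneg => y Oy; first by rewrite abse_ge0.
rewrite abse_EFin normrM ger0_norm ?(measurable_kernel_offG.2)// -!EFinM lee_fin mulrA.
by rewrite ler_wpM2r// offG_le.
Qed.

Lemma Gop_integrable f x : Om x -> measurable_fun Om f ->
  (Kint (Phi 1) (fun y => `|f y|%:E) x < +oo)%E ->
  mu.-integrable Om (fun y => (offG x y * f y)%:E).
Proof.
move=> Ox mf Kf; apply/integrableP; split; first exact: measurable_offG_integrand.
apply: le_lt_trans (Gop_integrand_le Ox mf) _.
by rewrite lte_mul_pinfty// lee_fin ltW.
Qed.

(** Holds at every point: where the integral is infinite its real value is 0 by [fine]. *)
Lemma Gop_le f x : Om x -> measurable_fun Om f ->
  (`|Gop f x|%:E <= CG%:E * Kint (Phi 1) (fun y => `|f y|%:E) x)%E.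
Proof.
move=> Ox mf; apply: le_trans (Gop_integrand_le Ox mf); rewrite GopE//.
have := le_abse_integral mu mOm (measurable_offG_integrand x mf).
rewrite /Rintegral; case: (integral _ _ _) => [r|_|_] //=.
  by rewrite normr0; exact: integral_ge0.
by rewrite normr0; exact: integral_ge0.
Qed.

Lemma measurable_Gop f : measurable_fun Om f -> measurable_fun Om (Gop f).
Proof.
(* Tonelli gives measurability for non-negative integrands, so positive and negative parts are
   integrated separately. *)
move=> mf; apply: (eq_measurable_fun (fun x => fine
    (\int[mu]_(y in Om) (fun y => (offG x y * f y)%:E)^\+ y -
     \int[mu]_(y in Om) (fun y => (offG x y * f y)%:E)^\- y)%E)).
  by move=> x /set_mem Ox; rewrite GopE// /Rintegral integralE.
have mF : measurable_fun (Om `*` Om) (fun z : E * E => (offG z.1 z.2 * f z.2)%:E).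
  apply/measurable_EFinP; apply: measurable_funM; first exact: measurable_funS (measurable_kernel_offG.1).
  by move/measurable_EFinP: mf => /(measurable_fun_snd mOm)/measurable_EFinP.
apply: (measurableT_comp (fine_measurable measurableT)); apply: emeasurable_funB.
- have := @measurable_integral_in _ _ _ _ _ mu Om Om (fun x y => ((fun y => (offG x y * f y)%:E)^\+ y)%E) mOm mOm.
  apply; first by move=> x y _ _; exact: funepos_ge0.
  have -> : (fun z : E * E => ((fun y => (offG z.1 y * f y)%:E)^\+ z.2)%E) =
      ((fun z : E * E => (offG z.1 z.2 * f z.2)%:E)^\+)%E.
    by apply/funext => z; rewrite !funeposE.
  exact: measurable_funepos.
- have := @measurable_integral_in _ _ _ _ _ mu Om Om (fun x y => ((fun y => (offG x y * f y)%:E)^\- y)%E) mOm mOm.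
  apply; first by move=> x y _ _; exact: funeneg_ge0.
  have -> : (fun z : E * E => ((fun y => (offG z.1 y * f y)%:E)^\- z.2)%E) =
      ((fun z : E * E => (offG z.1 z.2 * f z.2)%:E)^\-)%E.
    by apply/funext => z; rewrite !funenegE.
  exact: measurable_funeneg.
Qed.

Lemma Gop_ae f h x : Om x -> measurable_fun Om f -> measurable_fun Om h ->
  {ae mu, forall y, Om y -> f y = h y} -> Gop f x = Gop h x.
Proof.
move=> Ox mf mh fh; rewrite !GopE// /Rintegral; congr fine; apply: ae_eq_integral => //.
- exact: measurable_offG_integrand.
- exact: measurable_offG_integrand.
- by apply: filterS fh => y fh Oy; rewrite fh.
Qed.

Lemma Gop_lin (a : R) f h x : Om x -> measurable_fun Om f -> measurable_fun Om h ->
  (Kint (Phi 1) (fun y => `|f y|%:E) x < +oo)%E ->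
  (Kint (Phi 1) (fun y => `|h y|%:E) x < +oo)%E ->
  Gop (fun y => a * f y + h y) x = a * Gop f x + Gop h x.
Proof.
move=> Ox mf mh Kf Kh; have i1 := Gop_integrable Ox mf Kf; have i2 := Gop_integrable Ox mh Kh.
rewrite !GopE//; last first.
  by apply: measurable_funD => //; apply: measurable_funM => //; exact: measurable_cst.
transitivity (\int[mu]_(y in Om) (a * (offG x y * f y) + offG x y * h y)).
  by apply: eq_Rintegral => y _; ring.
rewrite RintegralD//=; last exact: (integrableZl mOm _ i1).
by rewrite RintegralZl.
Qed.

(** The integral of Phi_1 w against the positive weight δ^γ is finite. Off a null set the Green
    integral of such data therefore converges, and the Green operator is linear there. *)
Lemma Kint_Phi1_ae_fin w : nonneg_measurable w ->
  (\int[mu]_(y in Om) ((d y `^ gamma)%:E * w y) < +oo)%E ->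
  {ae mu, forall x, Om x -> (Kint (Phi 1) w x < +oo)%E}.
Proof.
move=> hw fw; have hP := measurable_kernel_Phi HM N gamma 1.
have [C C0 HC] := Kint_Phi1_weighted HM N0 Nk g0.
have hK := Kint_nonneg mu mOm hP hw.
have hd := nonneg_measurable_dgamma HM gamma.
have [mdK dK0] := nonneg_measurableM hd hK.
have : mu.-integrable Om (fun x => (d x `^ gamma)%:E * Kint (Phi 1) w x)%E.
  apply/integrableP; split => //.
  rewrite (eq_integral (fun x => (d x `^ gamma)%:E * Kint (Phi 1) w x)%E); last first.
    by move=> x /set_mem Ox; rewrite gee0_abs// dK0.
  by apply: le_lt_trans (HC _ hw) _; rewrite lte_mul_pinfty.
move=> /(integrable_ae mOm); apply: filterS => x + Ox; move=> /(_ Ox).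
have := hK.2 _ Ox; case: (Kint (Phi 1) w x) => [r| |] // _; first by rewrite ltry.
by rewrite mulry gtr0_sg ?mul1e// powR_gt0// (md_d0 HM).
Qed.

End green_operator.

Section resolvent.
Context (R : realType) (n : nat) (Om : set 'rV[R]_n).
Local Notation E := 'rV[R]_n.
Local Notation leb := (lebesgue_row R n).
Local Notation L2 := (fmem (Lp Om 2%:E)).
Local Notation inner := (inner Om).
Variables (d : E -> R) (dist : E -> E -> R) (kappa : R).
Hypothesis HM : metric_domain leb Om d dist kappa.
Variables (N gamma : R).
Hypotheses (N0 : 0 < N) (Nk : N < kappa) (g0 : 0 < gamma).
Variables (G : E -> E -> R) (CG : R).
Hypotheses
  (mG : measurable_fun (off_diag Om) (fun z => G z.1 z.2))
  (CG0 : 0 < CG)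
  (G_ge0 : forall x y, off_diag Om (x, y) -> 0 <= G x y)
  (GC : forall x y, off_diag Om (x, y) ->
     G x y <= CG * Phi d dist N gamma 1 x y).
Hypothesis oOm : open Om.
Variables (lam : nat -> R) (phi : nat -> E -> R).
Hypothesis EB : green_eigenbasis Om G lam phi.
Hypothesis SA : L2_self_adjoint Om (green_op Om G).
Hypothesis CO : L2_compact Om (green_op Om G).
Local Notation G0 := (green_op Om G).
Local Notation Phi := (Phi d dist N gamma).
Local Notation Kint := (Kint leb Om).
Local Notation nonneg_measurable := (nonneg_measurable Om).
Local Notation spectral_sum := (is_spectral_sum Om lam phi).
Local Notation "'abs f" := (fun x => `|f x|%:E) (at level 9).
Local Notation wint w := (\int[leb]_(y in Om) ((d y `^ gamma)%:E * w y))%E.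
Implicit Types (f h u v : E -> R) (w : E -> \bar R).

Let mOm : measurable Om := md_Om HM.

Let hP t : measurable_kernel (Phi t) := measurable_kernel_Phi HM N gamma t.

Let hd := nonneg_measurable_dgamma HM gamma.

Let Kn t w : nonneg_measurable w -> nonneg_measurable (Kint (Phi t) w).
Proof. exact: (Kint_nonneg leb mOm (hP t)). Qed.

Let Kle t w w' x : nonneg_measurable w -> nonneg_measurable w' ->
  {ae leb, forall y, Om y -> (w y <= w' y)%E} -> (Kint (Phi t) w x <= Kint (Phi t) w' x)%E.
Proof. exact: (@Kint_le _ _ _ leb Om mOm _ _ _ x (hP t)). Qed.

Let KZ t w x (c : R) : nonneg_measurable w -> 0 <= c ->
  Kint (Phi t) (fun y => c%:E * w y)%E x = (c%:E * Kint (Phi t) w x)%E.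
Proof. exact: (@KintZ _ _ _ leb Om mOm _ _ x _ (hP t)). Qed.

Let KD t w w' x : nonneg_measurable w -> nonneg_measurable w' ->
  Kint (Phi t) (fun y => w y + w' y)%E x = (Kint (Phi t) w x + Kint (Phi t) w' x)%E.
Proof. exact: (@KintD _ _ _ leb Om mOm _ _ _ x (hP t)). Qed.

Let nabs f : measurable_fun Om f -> nonneg_measurable 'abs f.
Proof. exact: nonneg_measurable_norm. Qed.

Let Gle f x : Om x -> measurable_fun Om f -> (`|G0 f x|%:E <= CG%:E * Kint (Phi 1) 'abs f x)%E.
Proof. exact: (Gop_le HM mG CG0 G_ge0 GC). Qed.

Let mGop f : measurable_fun Om f -> measurable_fun Om (G0 f).
Proof. exact: (measurable_Gop HM mG G_ge0). Qed.

Let Gae f h x : Om x -> measurable_fun Om f -> measurable_fun Om h ->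
  {ae leb, forall y, Om y -> f y = h y} -> G0 f x = G0 h x.
Proof. exact: (Gop_ae HM mG G_ge0). Qed.

Lemma wintE f : Lpnorm Om 1%E (fun x => f x * d x `^ gamma) = wint 'abs f.
Proof.
rewrite Lpnorm1E; apply: eq_integral => x _.
by rewrite normrM (ger0_norm (powR_ge0 _ _)) mulrC EFinM.
Qed.

Let Dg := (sval (cid2 (md_bounded HM))) `^ gamma.

Let Dg0 : 0 <= Dg. Proof. exact: powR_ge0. Qed.

Let dg_le x : Om x -> d x `^ gamma <= Dg.
Proof.
rewrite /Dg; case: cid2 => /= D D0 H Ox; apply: powR_le; rewrite ?(ltW g0)//.
  by rewrite ltW// (md_d0 HM).
by have [] := H _ _ Ox Ox.
Qed.

Lemma bounded_L2 f (c : R) : 0 <= c -> measurable_fun Om f ->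
  {ae leb, forall x, Om x -> `|f x| <= c} -> L2 f /\ inner f f <= c ^+ 2 * fine (leb Om).
Proof.
move=> c0 mf fc; have muf : leb Om = (fine (leb Om))%:E.
  by rewrite fineK// ge0_fin_numE ?(md_fin HM).
have H : (\int[leb]_(x in Om) (f x ^+ 2)%:E <= (c ^+ 2 * fine (leb Om))%:E)%E.
  rewrite EFinM -muf -integral_cst//; apply: ae_le_integral_nonneg => //.
  - by move=> x _; rewrite lee_fin sqr_ge0.
  - by move=> x _; rewrite lee_fin sqr_ge0.
  apply: filterS fc => x fc Ox; rewrite lee_fin -(real_normK (num_real (f x))).
  by rewrite ler_pXn2r ?nnegrE// fc.
have hf : L2 f.
  apply/L2P => //; split => //; apply/integrableP; split.
    by apply/measurable_EFinP; exact: measurable_funX.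
  under eq_integral do rewrite abse_EFin ger0_norm ?sqr_ge0//.
  by apply: le_lt_trans H _; rewrite ltry.
split => //; rewrite -lee_fin; apply: le_trans H.
rewrite /inner /Rintegral fineK; last exact/integrable_fin_num/L2_integrable.
by apply: le_integral_nonneg => // x _; rewrite -expr2 // lee_fin sqr_ge0.
Qed.

Lemma L2_wint : exists2 C : R, 0 <= C & forall f, L2 f ->
  (wint 'abs f <= (C * Num.sqrt (inner f f))%:E)%E.
Proof.
have md : measurable_fun Om (fun x => d x `^ gamma) by apply/measurable_EFinP; exact: hd.1.
have [|hdg _] := @bounded_L2 (fun x => d x `^ gamma) Dg Dg0 md.
  by apply: nearW => x Ox; rewrite ger0_norm ?powR_ge0// dg_le.
exists (Num.sqrt (inner (fun x => d x `^ gamma) (fun x => d x `^ gamma))).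
  exact: sqrtr_ge0.
move=> f hf; pose af : E -> R := fun x => `|f x|.
have haf : L2 af.
  have [mf /integrableP[_ fi]] := (L2P Om f).1 hf.
  apply/L2P => //; split; first exact: measurableT_comp.
  by under eq_fun do rewrite real_normK ?num_real//; exact: ((L2P Om f).1 hf).2.
have e : inner af af = inner f f.
  by apply: eq_Rintegral => x _; rewrite -!expr2 real_normK ?num_real.
have ii := L2_integrable mOm hdg haf.
have -> : (wint 'abs f = (inner (fun x => d x `^ gamma) af)%:E)%E.
  by rewrite /Defs.inner /Rintegral fineK; last exact/integrable_fin_num.
rewrite lee_fin -sqrtrM ?inner_ge0// -e.
apply: le_trans (ler_norm _) _; rewrite -sqrtr_sqr ler_sqrt ?mulr_ge0 ?inner_ge0//.
exact: cauchy_schwarz.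
Qed.

Definition resolvent_L2 (l : R) f : E -> R :=
  if pselect (exists u, spectral_sum l f u) is left P then sval (cid P) else fun=> 0.

(** The identity T f = λ T(G f) + G f unfolded m times, ending with the L^2 resolvent of the m-th
    iterate of G. With m = M + 1 it makes sense for every f in L^1(Ω;δ^γ). *)
Fixpoint resolvent_iter (l : R) (m : nat) f : E -> R :=
  if m is m'.+1 then fun x => l * resolvent_iter l m' (G0 f) x + G0 f x
  else resolvent_L2 l f.

Variables (d0 : R).
Hypothesis d00 : 0 < d0.

(** The number d0 is fixed before l, so that the constants below are common to all l with this
    gap. *)
Let gap l := forall j, d0 <= `|lam j - l|.

Let gap_neq0 l j : gap l -> lam j - l != 0.
Proof. by move=> gl; rewrite -normr_gt0 (lt_le_trans d00). Qed.

Lemma resolvent_L2P l f : gap l -> L2 f -> spectral_sum l f (resolvent_L2 l f).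
Proof.
move=> gl hf; rewrite /resolvent_L2; case: pselect => [P|P]; first by case: cid.
by exfalso; apply: P; exact: (spectral_sum_exists oOm EB SA CO d00 gl hf).
Qed.

Lemma resolvent_iter_L2 l m f : gap l -> L2 f -> spectral_sum l f (resolvent_iter l m f).
Proof.
move=> gl; elim: m f => [|m IH] f hf; first exact: resolvent_L2P.
apply: (resolvent_left oOm EB SA CO) => //; first by move=> j; exact: gap_neq0.
exact/IH/CO.1.
Qed.

Let M := sval (cid2 (smoothing_steps N0 Nk g0)).

Let M0 : (0 < M)%N. Proof. by rewrite /M; case: cid2. Qed.

Let HMk : N + (N + 2 * gamma) * M%:R^-1 < kappa. Proof. by rewrite /M; case: cid2. Qed.
Local Notation Psi k := (Phi (k%:R / M%:R)).

Let Psi_step k : (k < M)%N -> exists2 C : R, 0 <= C & forall w x, nonneg_measurable w -> Om x ->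
  (Kint (Phi 1) (Kint (Psi k.+1) w) x <= C%:E * Kint (Psi k) w x)%E.
Proof. exact: (Phi_step HM N0 g0 M0 HMk). Qed.

Let wint_fin w : nonneg_measurable w -> (wint w < +oo)%E -> exists2 r : R, 0 <= r & wint w = r%:E.
Proof.
move=> hw wf; exists (fine (wint w)).
  by apply: fine_ge0; apply: integral_ge0 => y Oy; rewrite mule_ge0 ?hw.2// lee_fin powR_ge0.
rewrite fineK// ge0_fin_numE//.
by apply: integral_ge0 => y Oy; rewrite mule_ge0 ?hw.2// lee_fin powR_ge0.
Qed.

Lemma smooth_L2 v w (c : R) : measurable_fun Om v -> nonneg_measurable w -> wint w = c%:E -> 0 <= c ->
  {ae leb, forall x, Om x -> (`|v x|%:E <= Kint (Psi 0) w x)%E} ->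
  L2 v /\ inner v v <= (Dg * c) ^+ 2 * fine (leb Om).
Proof.
move=> mv hw wc c0 vw; apply: bounded_L2 => //; first exact: mulr_ge0.
apply: filterS vw => x vw Ox; rewrite -lee_fin; apply: le_trans (vw Ox) _.
rewrite mul0r (Kint_Phi0E HM N gamma x hw) wc -EFinM lee_fin.
by rewrite ler_wpM2r// dg_le.
Qed.

(* k counts the applications of G that separate v from the original datum: if
   |v| <= Phi_(k/M) w, then k further smoothing steps give |G^k v| <= C Phi_0 w. *)
Lemma resolvent_iter_bound (Lam : R) k : 0 <= Lam -> (k <= M)%N -> exists2 K : R, 0 <= K &
  forall l v w, `|l| <= Lam -> gap l -> measurable_fun Om v -> nonneg_measurable w ->
  (wint w < +oo)%E ->
  {ae leb, forall x, Om x -> (`|v x|%:E <= Kint (Psi k) w x)%E} ->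
  measurable_fun Om (resolvent_iter l k v) /\
  {ae leb, forall x, Om x -> (`|resolvent_iter l k v x|%:E <=
     K%:E * (Kint (Phi 1) 'abs v x + Kint (Phi 1) w x))%E}.
Proof.
move=> Lam0; elim: k => [_|k IH kM].
  have [A A0 HA] := Phi_bootstrap HM N0 Nk g0 (ltW CG0) Lam0.
  have [C C0 HC] := L2_wint.
  have [C2 C20 HC2] := Kint_Phi0_le HM N0 g0.
  (* Let c be the weighted integral of w. Then |v| <= Dg c, so the L^2 norm of v is at most Dg c
     times the root of the volume; the gap gives the factor 1/d0 for the L^2 norm of u, and C passes
     from L^2 to the weighted L^1 norm. *)
  pose q := C * (d0^-1 * (Dg * Num.sqrt (fine (leb Om)))).
  have q0 : 0 <= q.
    by rewrite mulr_ge0// mulr_ge0 ?invr_ge0 ?(ltW d00)// mulr_ge0// sqrtr_ge0.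
  exists (A * (1 + q * C2)); first by rewrite mulr_ge0// addr_ge0// mulr_ge0// ltW.
  move=> l v w lL gl mv hw wf vw; have [c c0 wc] := wint_fin hw wf.
  have [hv vv] := smooth_L2 mv hw wc c0 vw.
  have us := resolvent_L2P gl hv; have [hu _] := us.
  split; first exact: hu.1.
  rewrite /=; set u := resolvent_L2 l v in us hu *.
  have nu := nabs hu.1; have nv := nabs mv.
  have uu := spectral_sum_bound oOm EB d00 gl hv us.
  (* The identity u = l G u + G v, combined with G <= CG Phi_1, is the hypothesis of
     [Phi_bootstrap]. *)
  have Hu : {ae leb, forall x, Om x ->
     ('abs u x <= CG%:E * (Kint (Phi 1) 'abs v x + Lam%:E * Kint (Phi 1) 'abs u x))%E}.
    apply: filterS (resolvent_right oOm EB SA CO (fun j => gap_neq0 j gl) hv us) => x ux Ox.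
    rewrite (ux Ox); apply: le_trans (_ : (`|l|%:E * `|G0 u x|%:E + `|G0 v x|%:E <= _)%E).
      by rewrite -EFinM -EFinD lee_fin -normrM ler_normD.
    have Kv0 := (Kn 1 nv).2 _ Ox; have Ku0 := (Kn 1 nu).2 _ Ox.
    rewrite ge0_muleDr//; last by rewrite mule_ge0 ?lee_fin.
    rewrite addeC; apply: leeD; first exact: Gle.
    rewrite [leRHS]muleCA; apply: lee_pmul => //; rewrite ?lee_fin//.
    exact: Gle hu.1.
  apply: filterS (HA _ _ nu nv Hu) => x ux Ox; apply: le_trans (ux Ox) _.
  have Kv0 := (Kn 1 nv).2 _ Ox; have Kw0 := (Kn 1 hw).2 _ Ox.
  rewrite EFinM -muleA; apply: lee_wpmul2l; first by rewrite lee_fin.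
  have s0 : (0 <= Kint (Phi 1) 'abs v x + Kint (Phi 1) w x)%E by rewrite adde_ge0.
  have qC : 0 <= q * C2 by rewrite mulr_ge0// ltW.
  rewrite (one_add_mule qC s0); apply: leeD; first by rewrite leeDl.
  rewrite (Kint_Phi0E HM N gamma x nu).
  have wu : (wint 'abs u <= q%:E * wint w)%E.
    apply: le_trans (HC _ hu) _; rewrite wc -EFinM lee_fin /q -!mulrA ler_wpM2l//.
    rewrite -(ler_pXn2r (ltn0Sn 1)) ?nnegrE ?sqrtr_ge0//; last first.
      by rewrite !mulr_ge0 ?invr_ge0 ?(ltW d00) ?sqrtr_ge0.
    rewrite sqr_sqrtr ?inner_ge0//; apply: le_trans uu _.
    rewrite !exprMn sqr_sqrtr; last exact: fine_ge0.
    rewrite ler_wpM2l ?sqr_ge0//; apply: le_trans vv _.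
    by rewrite exprMn -mulrA (mulrC (c ^+ 2)).
  apply: le_trans (_ : (q%:E * Kint (Phi 0) w x <= _)%E).
    rewrite (Kint_Phi0E HM N gamma x hw) [leRHS]muleCA.
    by apply: lee_wpmul2l => //; rewrite lee_fin powR_ge0.
  rewrite (EFinM q C2) -[leRHS]muleA; apply: lee_wpmul2l; first by rewrite lee_fin.
  apply: le_trans (HC2 _ _ hw Ox) _; apply: lee_wpmul2l; first by rewrite lee_fin ltW.
  by rewrite leeDr.
have [K K0 HK] := IH (ltnW kM).
have [C C0 HC] := Psi_step kM; have [C1 C10 HC1] := Phi_idem HM N0 Nk g0.
pose B := Lam * K * (CG * C1 + CG * C) + CG.
have c1 : 0 <= CG * C1 by rewrite mulr_ge0 ?(ltW CG0).
have c2 : 0 <= CG * C by rewrite mulr_ge0 ?(ltW CG0).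
exists B; first by rewrite addr_ge0 ?(ltW CG0)// !mulr_ge0// addr_ge0.
move=> l v w lL gl mv hw wf vw; have nv := nabs mv; have mGv := mGop mv; have nGv := nabs mGv.
(* One application of G lowers the level of the majorant from k + 1 to k at the cost of the factor
   CG C. *)
pose w' x := ((CG * C)%:E * w x)%E.
have hw' : nonneg_measurable w' by exact: nonneg_measurableZ.
have wf' : (wint w' < +oo)%E.
  have -> : wint w' = ((CG * C)%:E * wint w)%E.
    have [mdw dw0] := nonneg_measurableM hd hw.
    rewrite -(ge0_integralZl leb mOm mdw dw0) ?lee_fin//.
    by apply: eq_integral => y _; rewrite /w' muleCA.
  by rewrite lte_mul_pinfty.
have Gvw : {ae leb, forall x, Om x -> (`|G0 v x|%:E <= Kint (Psi k) w' x)%E}.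
  apply: nearW => x Ox; apply: le_trans (Gle Ox mv) _.
  rewrite KZ// EFinM -muleA; apply: lee_wpmul2l; first by rewrite lee_fin ltW.
  apply: le_trans (HC _ _ hw Ox); exact: (Kle 1 x nv (Kn _ hw) vw).
have [mT HT] := HK l _ _ lL gl mGv hw' wf' Gvw.
split.
  by apply: measurable_funD => //; apply: measurable_funM => //; exact: measurable_cst.
apply: filterS HT => x HT Ox; have {}HT := HT Ox.
have Kv0 := (Kn 1 nv).2 _ Ox; have Kw0 := (Kn 1 hw).2 _ Ox.
have s0 : (0 <= Kint (Phi 1) 'abs v x + Kint (Phi 1) w x)%E by rewrite adde_ge0.
apply: le_trans (_ : (`|l|%:E * `|resolvent_iter l k (G0 v) x|%:E + `|G0 v x|%:E <= _)%E).
  by rewrite -EFinM -EFinD lee_fin -normrM ler_normD.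
rewrite /B EFinD ge0_muleDl//; last 2 first.
- by rewrite lee_fin !mulr_ge0// addr_ge0.
- by rewrite lee_fin ltW.
apply: leeD; last first.
  apply: le_trans (Gle Ox mv) _; apply: lee_wpmul2l; first by rewrite lee_fin ltW.
  by rewrite leeDl.
rewrite -mulrA EFinM -muleA; apply: lee_pmul => //.
apply: le_trans HT _; rewrite EFinM -muleA; apply: lee_wpmul2l; first by rewrite lee_fin.
rewrite EFinD ge0_muleDl ?lee_fin//; apply: leeD.
  have cK : nonneg_measurable (fun y => CG%:E * Kint (Phi 1) 'abs v y)%E.
    by apply: nonneg_measurableZ; [exact: ltW|exact: Kn].
  apply: le_trans (Kle 1 x nGv cK _) _; first by apply: nearW => y Oy; exact: Gle.
  rewrite (KZ 1 x (Kn 1 nv) (ltW CG0)).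
  rewrite EFinM -muleA; apply: lee_wpmul2l; first by rewrite lee_fin ltW.
  apply: le_trans (HC1 _ _ nv Ox) _; apply: lee_wpmul2l; first by rewrite lee_fin.
  by rewrite leeDl.
rewrite KZ//; apply: lee_wpmul2l; first by rewrite lee_fin.
by rewrite leeDr.
Qed.

(** One application of G more than in [resolvent_iter_bound]: the bound |G f| <= CG Phi_1 |f|
    provides the starting level k = M for every f in L^1(Ω;δ^γ). *)
Lemma resolvent_iter_key (Lam : R) : 0 <= Lam -> exists2 K : R, 0 <= K &
  forall l f, `|l| <= Lam -> gap l -> measurable_fun Om f -> (wint 'abs f < +oo)%E ->
  measurable_fun Om (resolvent_iter l M.+1 f) /\
  {ae leb, forall x, Om x ->
     (`|resolvent_iter l M.+1 f x|%:E <= K%:E * Kint (Phi 1) 'abs f x)%E}.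
Proof.
move=> Lam0; have [K K0 HK] := resolvent_iter_bound Lam0 (leqnn M).
have [C1 C10 HC1] := Phi_idem HM N0 Nk g0.
exists (Lam * (K * (CG * C1 + CG)) + CG).
  by rewrite addr_ge0 ?(ltW CG0)// !mulr_ge0// addr_ge0 ?(ltW CG0)// mulr_ge0// ltW.
move=> l f lL gl mf ff; have nf := nabs mf; have mGf := mGop mf; have nGf := nabs mGf.
pose w x := (CG%:E * `|f x|%:E)%E.
have hw : nonneg_measurable w by apply: nonneg_measurableZ => //; exact: ltW.
have wf : (wint w < +oo)%E.
  have -> : wint w = (CG%:E * wint 'abs f)%E.
    have [mdw dw0] := nonneg_measurableM hd nf.
    rewrite -ge0_integralZl ?lee_fin ?(ltW CG0)//.
    by apply: eq_integral => y _; rewrite /w muleCA.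
  by rewrite lte_mul_pinfty// lee_fin ltW.
have M1 : M%:R / M%:R = 1 :> R by rewrite divff// pnatr_eq0 -lt0n M0.
have [|mT HT] := HK l _ _ lL gl mGf hw wf.
  by apply: nearW => x Ox; rewrite M1 KZ ?(ltW CG0)//; exact: Gle.
split.
  by apply: measurable_funD => //; apply: measurable_funM => //; exact: measurable_cst.
apply: filterS HT => x HT Ox; have {}HT := HT Ox.
have Kf0 := (Kn 1 nf).2 _ Ox.
apply: le_trans (_ : (`|l|%:E * `|resolvent_iter l M (G0 f) x|%:E + `|G0 f x|%:E <= _)%E).
  by rewrite -EFinM -EFinD lee_fin -normrM ler_normD.
rewrite EFinD ge0_muleDl//; last 2 first.
- by rewrite lee_fin !mulr_ge0// addr_ge0 ?(ltW CG0)// mulr_ge0// ltW.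
- by rewrite lee_fin ltW.
apply: leeD; last exact: Gle.
rewrite EFinM -muleA; apply: lee_pmul => //.
apply: le_trans HT _; rewrite EFinM -muleA; apply: lee_wpmul2l; first by rewrite lee_fin.
rewrite KZ ?(ltW CG0)// EFinD ge0_muleDl; last 2 first.
- by rewrite lee_fin mulr_ge0// ltW.
- by rewrite lee_fin ltW.
apply: leeD => //.
have cK : nonneg_measurable (fun y => CG%:E * Kint (Phi 1) 'abs f y)%E.
  by apply: nonneg_measurableZ; [exact: ltW|exact: Kn].
apply: le_trans (Kle 1 x nGf cK _) _; first by apply: nearW => y Oy; exact: Gle.
rewrite (KZ 1 x (Kn 1 nf) (ltW CG0)).
rewrite EFinM -muleA; apply: lee_wpmul2l; first by rewrite lee_fin ltW.
exact: HC1.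
Qed.

Let L1d f := measurable_fun Om f /\ (wint 'abs f < +oo)%E.

(** The data on which [resolvent_iter l k] is meaningful: G maps level k + 1 to level k, level 0 is
    contained in L^2, and G f has level M for every f in L^1(Ω;δ^γ). *)
Let smooth k v := L1d v /\ exists w, [/\ nonneg_measurable w, (wint w < +oo)%E &
  {ae leb, forall x, Om x -> (`|v x|%:E <= Kint (Psi k) w x)%E}].

Let nn_wint w : nonneg_measurable w -> (0 <= wint w)%E.
Proof. by move=> hw; apply: integral_ge0 => y Oy; rewrite mule_ge0 ?hw.2// lee_fin powR_ge0. Qed.

Let wintZ w (c : R) : 0 <= c -> nonneg_measurable w -> wint (fun x => c%:E * w x)%E = (c%:E * wint w)%E.
Proof.
move=> c0 hw; have [mdw dw0] := nonneg_measurableM hd hw.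
by rewrite -(ge0_integralZl leb mOm mdw dw0) ?lee_fin//; apply: eq_integral => y _; rewrite muleCA.
Qed.

Let wintD w w' : nonneg_measurable w -> nonneg_measurable w' ->
  wint (fun x => w x + w' x)%E = (wint w + wint w')%E.
Proof.
move=> hw hw'; have [mdw dw0] := nonneg_measurableM hd hw.
have [mdw' dw0'] := nonneg_measurableM hd hw'.
rewrite -ge0_integralD//; apply: eq_integral => y /set_mem Oy.
by rewrite ge0_muleDr ?hw.2 ?hw'.2.
Qed.

Let wint_le w w' : nonneg_measurable w -> nonneg_measurable w' ->
  {ae leb, forall x, Om x -> (w x <= w' x)%E} -> (wint w <= wint w')%E.
Proof.
move=> hw hw' ww'; have [mdw dw0] := nonneg_measurableM hd hw.
have [mdw' dw0'] := nonneg_measurableM hd hw'.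
apply: ae_le_integral_nonneg => //; apply: filterS ww' => x ww' Ox.
by apply: lee_wpmul2l; [rewrite lee_fin powR_ge0|exact: ww'].
Qed.

Let nlin (a : R) f h : measurable_fun Om f -> measurable_fun Om h ->
  nonneg_measurable (fun x => `|a|%:E * `|f x|%:E + `|h x|%:E)%E.
Proof.
by move=> mf mh; apply: nonneg_measurableD (nabs mh); exact: nonneg_measurableZ (nabs mf).
Qed.

Let mlin (a : R) f h : measurable_fun Om f -> measurable_fun Om h ->
  measurable_fun Om (fun x => a * f x + h x).
Proof.
by move=> mf mh; apply: measurable_funD => //; apply: measurable_funM => //; exact: measurable_cst.
Qed.

Lemma L1d_lin (a : R) f h : L1d f -> L1d h -> L1d (fun x => a * f x + h x).
Proof.
move=> [mf ff] [mh fh]; split; first exact: mlin.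
apply: (@le_lt_trans _ _ (`|a|%:E * wint 'abs f + wint 'abs h)%E).
  rewrite -wintZ//; last exact: nabs.
  rewrite -wintD; [|exact: nonneg_measurableZ (nabs mf)|exact: nabs].
  apply: wint_le; [by apply: nabs; exact: mlin|exact: nlin|].
  by apply: nearW => x Ox; rewrite -EFinM -EFinD lee_fin -normrM ler_normD.
by rewrite lte_add_pinfty// lte_mul_pinfty.
Qed.

Lemma green_L1d f : L1d f -> L1d (G0 f).
Proof.
move=> [mf ff]; have nf := nabs mf; split; first exact: mGop.
have [C C0 HC] := Kint_Phi1_weighted HM N0 Nk g0.
have cK : nonneg_measurable (fun y => CG%:E * Kint (Phi 1) 'abs f y)%E.
  by apply: nonneg_measurableZ; [exact: ltW|exact: Kn].
apply: (@le_lt_trans _ _ (CG%:E * (C%:E * wint 'abs f))%E).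
  apply: le_trans (wint_le (nabs (mGop mf)) cK _) _.
    by apply: nearW => x Ox; exact: Gle.
  rewrite wintZ ?(ltW CG0)//; last exact: Kn.
  by apply: lee_wpmul2l; [rewrite lee_fin ltW|exact: HC].
rewrite lte_mul_pinfty ?lee_fin ?(ltW CG0)//.
by rewrite lte_mul_pinfty.
Qed.

Let smooth_lin k (a : R) u v : smooth k u -> smooth k v -> smooth k (fun x => a * u x + v x).
Proof.
move=> [Lu [w [hw wf uw]]] [Lv [w' [hw' wf' vw']]]; split; first exact: L1d_lin.
have aw : nonneg_measurable (fun x => `|a|%:E * w x)%E by exact: nonneg_measurableZ.
exists (fun x => `|a|%:E * w x + w' x)%E; split.
- exact: nonneg_measurableD.
- by rewrite wintD// wintZ// lte_add_pinfty// lte_mul_pinfty.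
apply: filterS2 uw vw' => x uw vw' Ox; rewrite KD// KZ//.
apply: (@le_trans _ _ (`|a|%:E * `|u x|%:E + `|v x|%:E)%E).
  by rewrite -EFinM -EFinD lee_fin -normrM ler_normD.
by apply: leeD; [apply: lee_wpmul2l => //; exact: uw|exact: vw'].
Qed.

Let smooth_green k v : (k < M)%N -> smooth k.+1 v -> smooth k (G0 v).
Proof.
move=> kM [[mv fv] [w [hw wf vw]]]; split; first exact: green_L1d.
have [C C0 HC] := Psi_step kM.
have c0 : 0 <= CG * C by rewrite mulr_ge0// ltW.
exists (fun x => (CG * C)%:E * w x)%E; split; first exact: nonneg_measurableZ.
  by rewrite wintZ// lte_mul_pinfty.
apply: nearW => x Ox; apply: le_trans (Gle Ox mv) _.
rewrite KZ// EFinM -muleA; apply: lee_wpmul2l; first by rewrite lee_fin ltW.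
apply: le_trans (HC _ _ hw Ox); exact: (Kle 1 x (nabs mv) (Kn _ hw) vw).
Qed.

Let smooth0_L2 v : smooth 0 v -> L2 v.
Proof.
move=> [[mv _] [w [hw wf vw]]]; have [c c0 wc] := wint_fin hw wf.
by have [] := smooth_L2 mv hw wc c0 vw.
Qed.

Let L1d_smooth f : L1d f -> smooth M (G0 f).
Proof.
move=> Lf; have [mf ff] := Lf; split; first exact: green_L1d.
exists (fun x => CG%:E * `|f x|%:E)%E; split.
- by apply: nonneg_measurableZ; [exact: ltW|exact: nabs].
- by rewrite wintZ ?(ltW CG0)//; [rewrite lte_mul_pinfty// lee_fin ltW|exact: nabs].
have M1 : M%:R / M%:R = 1 :> R by rewrite divff// pnatr_eq0 -lt0n M0.
by apply: nearW => x Ox; rewrite M1 KZ ?(ltW CG0)//; [exact: Gle|exact: nabs].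
Qed.

(** [resolvent_L2] chooses a function for each representative, not for each class, while G is linear
    only a.e.; so a.e. equality has to be carried through the iteration. *)
Let resolvent_iter_ae l k u v : gap l -> (k <= M)%N -> smooth k u -> smooth k v ->
  u = v %[ae leb in Om] -> resolvent_iter l k u = resolvent_iter l k v %[ae leb in Om].
Proof.
move=> gl; elim: k u v => [|k IH] u v kM su sv uv.
  have hu := smooth0_L2 su; have hv := smooth0_L2 sv.
  have [L2u _] := resolvent_L2P gl hu; have [L2v _] := resolvent_L2P gl hv.
  apply: (eq_coef oOm EB L2u L2v) => j.
  have -> := spectral_sum_coef oOm EB (resolvent_L2P gl hu) j.
  have -> := spectral_sum_coef oOm EB (resolvent_L2P gl hv) j.
  by rewrite (inner_ae mOm hu hv (eigen_L2 oOm EB j) uv).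
have Guv x : Om x -> G0 u x = G0 v x by move=> Ox; exact: (Gae Ox su.1.1 sv.1.1 uv).
have ih := IH _ _ (ltnW kM) (smooth_green kM su) (smooth_green kM sv).
apply: filterS (ih _); last by apply: nearW => x Ox; exact: Guv.
by move=> x H Ox /=; rewrite Guv// H.
Qed.

Let green_lin (a : R) f h : L1d f -> L1d h ->
  G0 (fun x => a * f x + h x) = (fun x => a * G0 f x + G0 h x) %[ae leb in Om].
Proof.
move=> [mf ff] [mh fh].
have F1 := Kint_Phi1_ae_fin HM N0 Nk g0 (nabs mf) ff.
have F2 := Kint_Phi1_ae_fin HM N0 Nk g0 (nabs mh) fh.
apply: filterS2 F1 F2 => x F1 F2 Ox.
exact: (Gop_lin HM mG CG0 G_ge0 GC a Ox mf mh (F1 Ox) (F2 Ox)).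
Qed.

Let resolvent_iter_lin l k (a : R) u v : gap l -> (k <= M)%N -> smooth k u -> smooth k v ->
  resolvent_iter l k (fun x => a * u x + v x) =
  (fun x => a * resolvent_iter l k u x + resolvent_iter l k v x) %[ae leb in Om].
Proof.
move=> gl; elim: k u v => [|k IH] u v kM su sv.
  have hu := smooth0_L2 su; have hv := smooth0_L2 sv.
  apply: (spectral_sum_unique oOm EB (resolvent_L2P gl (L2_linr mOm a hu hv))).
  exact: (spectral_sum_lin oOm EB a hu hv (resolvent_L2P gl hu) (resolvent_L2P gl hv)).
have Gl := green_lin a su.1 sv.1.
have su' := smooth_green kM su; have sv' := smooth_green kM sv.
have suv := smooth_green kM (smooth_lin a su sv).
have R1 := resolvent_iter_ae gl (ltnW kM) suv (smooth_lin a su' sv') Gl.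
have R2 := IH _ _ (ltnW kM) su' sv'.
apply: filterS3 Gl R1 R2 => x Gl R1 R2 Ox /=.
by rewrite R1// R2// Gl//; ring.
Qed.

Lemma resolvent_iter_linear l (a : R) f h : gap l -> L1d f -> L1d h ->
  resolvent_iter l M.+1 (fun x => a * f x + h x) =
  (fun x => a * resolvent_iter l M.+1 f x + resolvent_iter l M.+1 h x) %[ae leb in Om].
Proof.
move=> gl Lf Lh; have Gl := green_lin a Lf Lh.
have su := L1d_smooth Lf; have sv := L1d_smooth Lh; have suv := L1d_smooth (L1d_lin a Lf Lh).
have R1 := resolvent_iter_ae gl (leqnn M) suv (smooth_lin a su sv) Gl.
have R2 := resolvent_iter_lin a gl (leqnn M) su sv.
apply: filterS3 Gl R1 R2 => x Gl R1 R2 Ox /=.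
by rewrite R1// R2// Gl//; ring.
Qed.

Local Notation L1dw := (L1w Om (fun x => d x `^ gamma)).

Let L1dwP f : fmem L1dw f <-> L1d f.
Proof. by rewrite /= wintE. Qed.

Let resolvent_for l (T : (E -> R) -> E -> R) := [/\ linear_on Om L1dw T,
      exists C : R, bounded_by C L1dw L1dw T &
      forall f, L2 f -> spectral_sum l f (T f)].

Lemma resolvent_iterP l : gap l -> resolvent_for l (resolvent_iter l M.+1).
Proof.
move=> gl; split.
- by move=> a f h /L1dwP Lf /L1dwP Lh; exact: resolvent_iter_linear.
- have [K K0 HK] := resolvent_iter_key (normr_ge0 l).
  have [C C0 HC] := Kint_Phi1_weighted HM N0 Nk g0.
  exists (K * C) => f /L1dwP[mf ff]; have [mT HT] := HK l f (lexx _) gl mf ff.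
  have cK : nonneg_measurable (fun y => K%:E * Kint (Phi 1) 'abs f y)%E.
    by apply: nonneg_measurableZ => //; exact/Kn/nabs.
  have H : (wint 'abs (resolvent_iter l M.+1 f) <= (K * C)%:E * wint 'abs f)%E.
    apply: le_trans (wint_le (nabs mT) cK HT) _.
    rewrite wintZ//; last exact/Kn/nabs.
    by rewrite EFinM -muleA; apply: lee_wpmul2l => //; exact/HC/nabs.
  split; last by rewrite /= !wintE.
  apply/L1dwP; split => //; apply: le_lt_trans H _.
  by rewrite lte_mul_pinfty// lee_fin mulr_ge0.
- by move=> f hf; exact: resolvent_iter_L2.
Qed.

(** Replacing f by 0 where |f| > k gives bounded functions on a set of finite measure; convergence
    is dominated by δ^γ |f|. *)
Lemma truncation_cvg f : L1d f -> exists t : nat -> E -> R,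
  (forall k, L2 (t k)) /\ wint 'abs (fun x => f x - t k x) @[k --> \oo] --> 0%E.
Proof.
move=> [mf ff]; pose t (k : nat) x := if `|f x| <= k%:R then f x else 0.
have mt k : measurable_fun Om (t k).
  apply: measurable_fun_if => //.
    by apply: measurable_fun_ler => //; exact: measurableT_comp.
  by apply: measurable_funS mf => //; exact: subIsetl.
exists t; split.
  move=> k; have [|] := @bounded_L2 (t k) k%:R (ler0n _ _) (mt k); last by [].
  by apply: nearW => x _; rewrite /t; case: ifPn => // _; rewrite normr0.
have nf := nabs mf; have [mdf df0] := nonneg_measurableM hd nf.
have := @dominated_cvg _ _ _ leb Om mOm (fun k x => (d x `^ gamma)%:E * `|f x - t k x|%:E)%E
  (cst 0%E) (fun x => (d x `^ gamma)%:E * `|f x|%:E)%E.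
rewrite integral0; apply.
- move=> k; have [] := nonneg_measurableM hd (nabs (measurable_funB mf (mt k))) => //.
- move=> x Ox; apply: cvg_near_cst; exists (Num.bound `|f x|) => // k /= xk.
  rewrite /t (_ : `|f x| <= k%:R); first by rewrite subrr normr0 mule0.
  by rewrite ltW// (lt_le_trans (archi_boundP (normr_ge0 _)))// ler_nat.
- by move=> x Ox.
- apply/integrableP; split => //.
  rewrite (eq_integral (fun x => (d x `^ gamma)%:E * `|f x|%:E)%E)//.
  by move=> x /set_mem Ox; rewrite gee0_abs// df0.
- move=> k x Ox; rewrite -EFinM abse_EFin ger0_norm ?mulr_ge0 ?powR_ge0// -EFinM lee_fin.
  rewrite ler_wpM2l ?powR_ge0// /t; case: ifPn => _; last by rewrite subr0.
  by rewrite subrr normr0.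
Qed.

(** The two operators agree a.e. on the truncations t k, which lie in L^2. By linearity T f - T' f =
    (T - T')(f - t k) a.e. for every k, and boundedness makes its weighted norm tend to 0. *)
Lemma resolvent_unique l T T' f : resolvent_for l T -> resolvent_for l T' -> L1d f ->
  T f = T' f %[ae leb in Om].
Proof.
move=> [linT [C bT] sT] [linT' [C' bT'] sT'] Lf.
have [t [tL2 tcvg]] := truncation_cvg Lf.
have L2L1 u : L2 u -> L1d u.
  move=> hu; split; first exact: hu.1.
  by have [D D0 HD] := L2_wint; apply: le_lt_trans (HD _ hu) _; rewrite ltry.
have tL1 k := L2L1 _ (tL2 k).
pose r k x := f x - t k x.
have rL1 k : L1d (r k).
  have := L1d_lin (-1) (tL1 k) Lf; congr (L1d _); apply/funext => x.
  by rewrite mulN1r addrC.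
pose g x := T f x - T' f x.
have mTf : measurable_fun Om (T f) by have [[]] := bT f ((L1dwP f).2 Lf).
have mTf' : measurable_fun Om (T' f) by have [[]] := bT' f ((L1dwP f).2 Lf).
have mg : measurable_fun Om g by exact: measurable_funB.
have gr k : g = (fun x => T (r k) x - T' (r k) x) %[ae leb in Om].
  have e : (fun x => 1 * r k x + t k x) = f by apply/funext => x; rewrite /r mul1r subrK.
  have := linT 1 _ _ ((L1dwP _).2 (rL1 k)) ((L1dwP _).2 (tL1 k)).
  have := linT' 1 _ _ ((L1dwP _).2 (rL1 k)) ((L1dwP _).2 (tL1 k)).
  rewrite e; apply: filterS3 (spectral_sum_unique oOm EB (sT _ (tL2 k)) (sT' _ (tL2 k))).
  by move=> x H H2 H1 Ox; rewrite /g H1// H2// H// !mul1r; ring.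
have gk k : (wint 'abs g <= (`|C| + `|C'|)%:E * wint 'abs (r k))%E.
  have [[mT fT] bTr] := bT _ ((L1dwP _).2 (rL1 k)).
  have [[mT' fT'] bTr'] := bT' _ ((L1dwP _).2 (rL1 k)).
  rewrite /= !wintE in bTr bTr'.
  have W0 := nn_wint (nabs (rL1 k).1).
  apply: (@le_trans _ _ (wint 'abs (T (r k)) + wint 'abs (T' (r k)))%E).
    rewrite -wintD; [|exact: nabs|exact: nabs].
    apply: wint_le; [exact: nabs|exact: nonneg_measurableD (nabs mT) (nabs mT')|].
    apply: filterS (gr k) => x gx Ox; rewrite gx// -EFinD lee_fin.
    exact: ler_normB.
  rewrite EFinD ge0_muleDl ?lee_fin//; apply: leeD.
    by apply: le_trans bTr _; apply: lee_wpmul2r => //; rewrite lee_fin ler_norm.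
  by apply: le_trans bTr' _; apply: lee_wpmul2r => //; rewrite lee_fin ler_norm.
have g0' : (wint 'abs g = 0)%E.
  apply/eqP; rewrite eq_le nn_wint ?andbT; last exact: nabs.
  have c : (fun k => (`|C| + `|C'|)%:E * wint 'abs (r k))%E @ \oo --> ((`|C| + `|C'|)%:E * 0)%E.
    by apply: cvgeZl.
  rewrite mule0 in c.
  by apply: (cvge_to_ge c); apply: nearW.
have [mdg dg0] := nonneg_measurableM hd (nabs mg).
have : (\int[leb]_(x in Om) `|(d x `^ gamma)%:E * `|g x|%:E| = 0)%E.
  by rewrite -g0'; apply: eq_integral => x /set_mem Ox; rewrite gee0_abs// dg0.
move=> /(ae_eq_integral_abs leb mOm mdg); apply: filterS => x /= H Ox.
have := H Ox; move=> [] /eqP; rewrite mulf_eq0 normr_eq0 gt_eqF/=; last first.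
  by rewrite powR_gt0// (md_d0 HM).
by rewrite subr_eq0 => /eqP.
Qed.

Lemma resolvent_key (Lam : R) : 0 <= Lam -> exists2 K : R, 0 <= K &
  forall l T f, `|l| <= Lam -> gap l -> resolvent_for l T -> L1d f ->
  measurable_fun Om (T f) /\
  {ae leb, forall x, Om x -> (`|T f x|%:E <= K%:E * Kint (Phi 1) 'abs f x)%E}.
Proof.
move=> Lam0; have [K K0 HK] := resolvent_iter_key Lam0; exists K => //.
move=> l T f lL gl hT Lf; have [mf ff] := Lf; have [mT HT] := HK l f lL gl mf ff.
split; first by have [_ [C bT] _] := hT; have [[]] := bT f ((L1dwP f).2 Lf).
apply: filterS2 HT (resolvent_unique hT (resolvent_iterP gl) Lf) => x HT e Ox.
by rewrite e// HT.
Qed.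

End resolvent.

(** * Riesz potentials *)

Section riesz_potential.
Context disp (E : measurableType disp) (R : realType).
Variable mu : {sigma_finite_measure set E -> \bar R}.
Variables (Om : set E) (d : E -> R) (dist : E -> E -> R) (kappa : R).
Hypothesis HM : metric_domain mu Om d dist kappa.
Local Notation Kint := (Kint mu Om).
Local Notation nonneg_measurable := (nonneg_measurable Om).
Local Notation pint p w := (\int[mu]_(x in Om) (w x `^ p)%:E)%E.
Implicit Types (w v h : E -> R).

Let mOm : measurable Om := md_Om HM.

Let dist_ge0 x y : 0 <= dist x y.
Proof. exact: dist_ge0 (md_distxx HM) (md_dist_gt0 HM) x y. Qed.

Let hK e : measurable_kernel (fun x y => dist x y `^ e) := measurable_kernel_dist HM e.

Definition nnfun w := measurable_fun Om w /\ forall x, Om x -> 0 <= w x.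

Lemma nnfunE w : nnfun w -> nonneg_measurable (fun x => (w x)%:E).
Proof.
by move=> [mw w0]; split; [exact/measurable_EFinP|move=> x Ox; rewrite lee_fin w0].
Qed.

Lemma nnfunZ (c : R) w : 0 <= c -> nnfun w -> nnfun (fun x => w x * c).
Proof.
move=> c0 [mw w0]; split; first by apply: measurable_funM => //; exact: measurable_cst.
by move=> x Ox; rewrite mulr_ge0// w0.
Qed.

Lemma nonneg_measurable_powR p w : measurable_fun Om w -> nonneg_measurable (fun x => (w x `^ p)%:E).
Proof.
move=> mw; split; last by move=> x _; rewrite lee_fin powR_ge0.
by apply/measurable_EFinP; exact: measurable_fun_powR.
Qed.

Definition riesz (e : R) w (x : E) : \bar R :=
  Kint (fun x y => dist x y `^ (- e)) (fun y => (w y)%:E) x.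

Lemma riesz_nonneg e w : nnfun w -> nonneg_measurable (riesz e w).
Proof. by move=> hw; apply: Kint_nonneg => //; exact: nnfunE. Qed.

Lemma rieszZ e (c : R) w x : 0 <= c -> nnfun w ->
  riesz e (fun y => w y * c) x = (c%:E * riesz e w x)%E.
Proof.
move=> c0 hw; rewrite /riesz -(KintZ mu mOm x (hK (- e)) (nnfunE hw) c0).
by apply: eq_integral => y _; rewrite EFinM (muleC (w y)%:E).
Qed.

Lemma pintZ p (c : R) w : 0 <= c -> nnfun w -> pint p (fun x => w x * c) = ((c `^ p)%:E * pint p w)%E.
Proof.
move=> c0 [mw w0]; have [m0 p0] := nonneg_measurable_powR p mw.
rewrite -ge0_integralZl ?lee_fin ?powR_ge0//; apply: eq_integral => x /set_mem Ox.
by rewrite powRM ?w0// mulrC EFinM.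
Qed.

(** Young's inequality and the splittings below are not homogeneous, so the estimates are proved for
    data of norm at most 1; division by t reduces the general case to this one. *)
Lemma riesz_homogeneous e p q (C : R) : 0 <= C ->
  (forall w v, nnfun w -> measurable_fun Om v -> (pint p w <= 1)%E ->
     {ae mu, forall x, Om x -> (`|v x|%:E <= riesz e w x)%E} ->
     (pint q (fun x => `|v x|) <= (C `^ q)%:E)%E) ->
  forall t w v, 0 < t -> nnfun w -> measurable_fun Om v -> (pint p w <= (t `^ p)%:E)%E ->
     {ae mu, forall x, Om x -> (`|v x|%:E <= riesz e w x)%E} ->
     (pint q (fun x => `|v x|) <= ((C * t) `^ q)%:E)%E.
Proof.
move=> C0 H t w v t0 hw mv wt vw.
have ti0 : 0 <= t^-1 by rewrite invr_ge0 ltW.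
have tK : t^-1 * t = 1 by rewrite mulVf// gt_eqF.
have mv' : measurable_fun Om (fun x => v x * t^-1).
  by apply: measurable_funM => //; exact: measurable_cst.
have w1 : (pint p (fun x => (w x * t^-1)%R) <= 1)%E.
  have tp : 1%:E = ((t^-1 `^ p)%:E * (t `^ p)%:E)%E.
    by rewrite -EFinM -powRM ?(ltW t0)// tK powR1.
  by rewrite pintZ// tp; apply: lee_wpmul2l; rewrite ?lee_fin ?powR_ge0.
have vw' : {ae mu, forall x, Om x -> (`|(v x * t^-1)%R|%:E <= riesz e (fun x => (w x * t^-1)%R) x)%E}.
  apply: filterS vw => x vw Ox; rewrite rieszZ// normrM (ger0_norm ti0) mulrC EFinM.
  by apply: lee_wpmul2l; rewrite ?lee_fin// vw.
have := H _ _ (nnfunZ ti0 hw) mv' w1 vw'.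
have nv : nnfun (fun x => `|v x|) by split => //; exact: measurableT_comp.
under eq_integral do rewrite normrM (ger0_norm ti0).
rewrite pintZ// => H'; rewrite powRM ?(ltW t0)// mulrC EFinM.
have tq : 1%:E = ((t `^ q)%:E * (t^-1 `^ q)%:E)%E.
  by rewrite -EFinM -powRM ?(ltW t0)// mulrC tK powR1.
rewrite -[leLHS]mul1e tq -muleA; apply: lee_wpmul2l => //.
by rewrite lee_fin powR_ge0.
Qed.

Lemma riesz_dual e w h : nnfun w -> nnfun h ->
  (\int[mu]_(x in Om) ((h x)%:E * riesz e w x) =
   \int[mu]_(y in Om) ((w y)%:E * riesz e h y))%E.
Proof.
move=> hw hh; apply: (etrans (@Kint_dual _ _ _ mu Om mOm _ _ _ (hK (- e)) (nnfunE hw) (nnfunE hh))).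
have -> : (fun y x => dist x y `^ (- e)) = (fun x y => dist x y `^ (- e)).
  by apply/funext => y; apply/funext => x; rewrite (md_distC HM).
by [].
Qed.

Lemma riesz_integral e w (C : R) : nnfun w ->
  (forall x, Om x -> (\int[mu]_(z in Om) (dist x z `^ (- e))%:E <= C%:E)%E) ->
  (\int[mu]_(x in Om) riesz e w x <= C%:E * \int[mu]_(y in Om) (w y)%:E)%E.
Proof.
move=> hw HC.
have h1 : nnfun (fun=> 1) by split => // x _; exact: ler01.
have := riesz_dual e hw h1; under eq_integral do rewrite mul1e; move=> ->.
have [mw w0] := nnfunE hw.
have [Om0|/set0P[x0 Ox0]] := eqVneq Om set0.
  by rewrite Om0 !integral_set0 mule0.
have C0 : 0 <= C.
  by rewrite -lee_fin (le_trans _ (HC _ Ox0))//; apply: integral_ge0 => z _; rewrite lee_fin powR_ge0.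
rewrite -ge0_integralZl//; apply: le_integral_nonneg => y Oy.
  by rewrite mule_ge0 ?w0//; exact: (riesz_nonneg e h1).2.
rewrite muleC; apply: lee_wpmul2r; first exact: w0.
by apply: le_trans (HC _ Oy); rewrite /riesz /Kint; under eq_integral do rewrite mule1.
Qed.

(** Jensen's inequality for the density w of mass at most 1, up to the factor 2^p. With t = c / 2
    every k >= 0 satisfies k <= t^(1-p) k^p + t; integration against w gives c <= t^(1-p) B + t,
    where B is the potential of exponent N p, and so t^p <= B. The number c stands in for the
    potential of exponent N, which may be infinite. *)
Lemma riesz_pointwise_convex N p w x (c : R) : 1 <= p -> nnfun w ->
  (\int[mu]_(y in Om) (w y)%:E <= 1)%E -> 0 <= c -> (c%:E <= riesz N w x)%E ->
  (((c / 2) `^ p)%:E <= riesz (N * p) w x)%E.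
Proof.
move=> p1 hw w1 c0 cw; have [mw w0] := nnfunE hw.
have p0 : p != 0 by rewrite gt_eqF// (lt_le_trans ltr01).
have R0 : (0 <= riesz (N * p) w x)%E.
  apply: integral_ge0 => y Oy; apply: mule_ge0; last exact: w0.
  by rewrite lee_fin powR_ge0.
move: c0; rewrite le_eqVlt => /orP[/eqP<-|c0].
  by rewrite mul0r (powR0 p0); exact: R0.
pose t := c / 2; have t0 : 0 < t by rewrite divr_gt0.
have pointwise (k : R) : 0 <= k -> k <= t `^ (1 - p) * k `^ p + t.
  move=> k0; have [kt|tk] := leP k t; first by rewrite ler_wpDl// mulr_ge0 ?powR_ge0.
  have k0' : 0 < k := lt_trans t0 tk.
  rewrite -[leLHS]addr0 lerD ?(ltW t0)//.
  rewrite -{1}(powRr1 (ltW k0')) -{1}(subrK p 1) powRDp// ler_wpM2r ?powR_ge0//.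
  by rewrite -(opprB p) powRN_le ?subr_ge0// ltW.
have H : (riesz N w x <= (t `^ (1 - p))%:E * riesz (N * p) w x + t%:E)%E.
  apply: (@le_trans _ _ (\int[mu]_(y in Om) ((t `^ (1 - p))%:E * ((dist x y `^ (- (N * p)))%:E * (w y)%:E)
     + t%:E * (w y)%:E))%E).
    apply: le_integral_nonneg => y Oy; first by rewrite mule_ge0 ?w0// lee_fin powR_ge0.
    rewrite -!EFinM -EFinD lee_fin mulrA -mulrDl ler_wpM2r ?hw.2//.
    apply: le_trans (pointwise _ (powR_ge0 _ _)) _.
    by rewrite -powRrM mulNr.
  have mk := measurable_Kint_integrand x (hK (- (N * p))) mw.
  rewrite ge0_integralD//; last 4 first.
  - by move=> y Oy; rewrite !mule_ge0 ?w0// lee_fin powR_ge0.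
  - exact: measurable_funeM.
  - by move=> y Oy; rewrite mule_ge0 ?w0// lee_fin ltW.
  - exact: measurable_funeM.
  apply: leeD.
    rewrite ge0_integralZl ?lee_fin ?powR_ge0// => y Oy.
    by rewrite mule_ge0 ?w0// lee_fin powR_ge0.
  rewrite ge0_integralZl ?lee_fin ?(ltW t0)//.
  by rewrite -[leRHS]mule1; apply: lee_wpmul2l => //; rewrite lee_fin ltW.
have := le_trans cw H; move: R0.
case: (riesz (N * p) w x) => [B| |] //; last by move=> _ _; rewrite leey.
move=> _; rewrite -EFinM -EFinD !lee_fin => cB.
have {cB} : t <= t `^ (1 - p) * B by move: cB; rewrite /t; lra.
rewrite -/t; clear H; clearbody t.
move=> /(ler_wpM2l (powR_ge0 t (p - 1))); rewrite mulrA -powRDp//.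
rewrite (_ : p - 1 + (1 - p) = 0); last by ring.
rewrite powRr0 mul1r -{2}(powRr1 (ltW t0)) -powRDp// subrK; exact.
Qed.

(** By [riesz_pointwise_convex] the p-th power of the potential is dominated by a potential of
    exponent N p < kappa, whose integral over x is at most a multiple of the mass of w. *)
Lemma riesz_L1_Lp N p : 0 < N -> 1 <= p -> N * p < kappa -> exists2 C : R, 0 <= C &
  forall t w v, 0 < t -> nnfun w -> measurable_fun Om v ->
  (\int[mu]_(x in Om) (w x)%:E <= t%:E)%E ->
  {ae mu, forall x, Om x -> (`|v x|%:E <= riesz N w x)%E} ->
  (pint p (fun x => `|v x|) <= ((C * t) `^ p)%:E)%E.
Proof.
move=> N0 p1 Npk; have p0 : 0 < p := lt_le_trans ltr01 p1.
have [|C C0 HC] := riesz_bound HM (e := N * p); first by rewrite mulr_gt0.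
exists (2 * C `^ p^-1); first by rewrite mulr_ge0// powR_ge0.
move=> t w v t0 hw mv wt vw.
apply: (@riesz_homogeneous N 1 p _ _ _ t w v) => //; first by rewrite mulr_ge0// powR_ge0.
- clear t w v t0 hw mv wt vw; move=> w v hw mv w1 vw.
  have {}w1 : (\int[mu]_(y in Om) (w y)%:E <= 1)%E.
    apply: le_trans w1; apply: le_integral_nonneg => y Oy; first exact: (nnfunE hw).2.
    by rewrite powRr1 ?hw.2.
  rewrite powRM// ?powR_ge0// -powRrM mulVf ?gt_eqF// powRr1//.
  have nv : nnfun (fun x => `|v x|) by split => //; exact: measurableT_comp.
  have [mR R0] := riesz_nonneg (N * p) hw.
  apply: (@le_trans _ _ (\int[mu]_(x in Om) ((2 `^ p)%:E * riesz (N * p) w x))%E).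
    apply: ae_le_integral_nonneg => //.
    - exact: measurable_funeM.
    - by move=> x Ox; rewrite mule_ge0 ?R0// lee_fin powR_ge0.
    apply: filterS vw => x vw Ox.
    apply: (@le_trans _ _ ((2 `^ p)%:E * ((`|v x| / 2) `^ p)%:E)%E).
      by rewrite -EFinM -powRM// ?divr_ge0// mulrC divfK// gt_eqF.
    apply: lee_wpmul2l; first by rewrite lee_fin powR_ge0.
    by apply: riesz_pointwise_convex => //; exact: vw.
  rewrite ge0_integralZl ?lee_fin ?powR_ge0// EFinM.
  apply: lee_wpmul2l; first by rewrite lee_fin powR_ge0.
  apply: le_trans (riesz_integral hw HC) _.
  by rewrite -[leRHS]mule1; apply: lee_wpmul2l; rewrite ?lee_fin.
rewrite powRr1 ?(ltW t0)//; apply: le_trans wt.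
apply: le_integral_nonneg => y Oy; first by rewrite lee_fin powR_ge0.
by rewrite powRr1 ?hw.2.
Qed.

Lemma riesz_Lq_Linf N q : 0 < N -> 1 < q -> kappa < (kappa - N) * q -> exists2 C : R, 0 <= C &
  forall t w x, 0 < t -> nnfun w -> (pint q w <= (t `^ q)%:E)%E -> Om x ->
  (riesz N w x <= (C * t)%:E)%E.
Proof.
move=> N0 q1 kq; have q0 : 0 < q := lt_trans ltr01 q1.
pose q' := q / (q - 1).
have q10 : 0 < q - 1 by rewrite subr_gt0.
have q'0 : 0 < q' by rewrite divr_gt0.
have qq' : q^-1 + q'^-1 = 1.
  by rewrite /q'; field; rewrite gt_eqF// gt_eqF.
(* N q' < kappa is the hypothesis kappa < (kappa - N) q rewritten. *)
have [|C C0 HC] := riesz_bound HM (e := N * q').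
  by rewrite mulr_gt0//= /q' mulrA ltr_pdivrMr//; lra.
exists (C + 1); first by rewrite addr_ge0.
move=> t w x t0 hw wt Ox.
have ti0 : 0 <= t^-1 by rewrite invr_ge0 ltW.
suff H : (riesz N (fun y => (w y * t^-1)%R) x <= (C + 1)%:E)%E.
  move: H; rewrite rieszZ// => /(lee_wpmul2l (_ : 0%E <= t%:E)%E).
  rewrite lee_fin (ltW t0) => /(_ isT); rewrite muleA -EFinM divff ?gt_eqF// mul1e.
  by rewrite -EFinM mulrC.
have [mw w0] := nnfunZ ti0 hw; have [mp pp] := nonneg_measurable_powR q mw.
have [mp' pp'] := nonneg_measurable_powR (- (N * q')) (measurable_dist HM x).
apply: (@le_trans _ _ (\int[mu]_(y in Om) ((dist x y `^ (- (N * q')))%:E + ((w y * t^-1) `^ q)%:E))%E).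
  apply: le_integral_nonneg => y Oy; first by rewrite mule_ge0 ?lee_fin ?powR_ge0// w0.
  rewrite -EFinM -EFinD lee_fin.
  apply: le_trans (conjugate_powR (powR_ge0 _ _) (w0 _ Oy) q'0 q0 _) _.
    by rewrite addrC.
  have inv1 r : 0 < r -> r^-1 <= 1 -> forall a : R, 0 <= a -> a / r <= a.
    by move=> r0 r1 a a0; rewrite ler_piMr.
  have s1 : q'^-1 <= 1 by rewrite -qq' lerDr invr_ge0 ltW.
  have s2 : q^-1 <= 1 by rewrite -qq' lerDl invr_ge0 ltW.
  rewrite -powRrM mulNr lerD//.
    by apply: inv1 => //; exact: powR_ge0.
  by apply: inv1 => //; exact: powR_ge0.
rewrite ge0_integralD// EFinD; apply: leeD; first exact: HC.
rewrite pintZ//; apply: le_trans (_ : ((t^-1 `^ q)%:E * (t `^ q)%:E <= _)%E).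
  by apply: lee_wpmul2l => //; rewrite lee_fin powR_ge0.
by rewrite -EFinM -powRM ?(ltW t0)// mulVf ?gt_eqF// powR1.
Qed.

(* Cut the integral at |x-y| = r: for |x-y| < r use w <= c, for |x-y| >= r use
   Young's inequality; r and the weight s in Young's inequality are the powers of
   c that balance the terms. *)
Lemma riesz_truncated N p : 0 < N -> N < kappa -> 1 < p -> p * (kappa - N) < kappa ->
  exists2 C : R, 0 <= C & forall w x (c : R), nnfun w -> Om x -> 0 <= c -> (pint p w <= 1)%E ->
    (riesz N (fun y => if w y <= c then w y else 0)%R x <=
      (C * c `^ (1 - p * (kappa - N) / kappa))%:E)%E.
Proof.
move=> N0 Nk p1 pk; have k0 := md_kappa HM; have [A A0 HA] := md_growth HM.
have p0 : 0 < p := lt_trans ltr01 p1.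
pose p' := p / (p - 1).
have p10 : 0 < p - 1 by rewrite subr_gt0.
have p'0 : 0 < p' by rewrite divr_gt0.
have pp' : p^-1 + p'^-1 = 1 by rewrite /p'; field; rewrite gt_eqF// gt_eqF.
have [|C1 C10 HC1] := integral_powR_near mu A0 (kappa := kappa) (rho := N); first by rewrite N0.
(* N p' > kappa, needed for decay away from x, is equivalent to p (kappa - N) < kappa. *)
have [|C2 C20 HC2] := integral_powR_far mu A0 (kappa := kappa) (rho := N * p').
  rewrite (ltW k0)/= /p' mulrA ltr_pdivlMr//; lra.
exists (C1 + (C2 + 1)); first by rewrite !addr_ge0.
move=> w x c hw Ox c0 w1; have [mw w0] := hw.
have mdx := measurable_dist HM x.
have mdx' e : measurable_fun Om (fun y => (dist x y `^ e)%:E).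
  by have [] := nonneg_measurable_powR e mdx.
set theta := 1 - _.
have theta0 : 0 < theta by rewrite subr_gt0 ltr_pdivrMr// mul1r.
pose wc y := if w y <= c then w y else 0.
have mwc : measurable_fun Om wc.
  apply: measurable_fun_if => //; first by apply: measurable_fun_ler => //; exact: measurable_cst.
  by apply: measurable_funS mw => //; exact: subIsetl.
have wc0 y : Om y -> 0 <= wc y by move=> Oy; rewrite /wc; case: ifPn => // _; exact: w0.
have hwc : nnfun wc by [].
have wcc y : wc y <= c by rewrite /wc; case: ifPn.
have wcw y : Om y -> wc y <= w y by move=> Oy; rewrite /wc; case: ifPn => // _; exact: w0.
move: c0; rewrite le_eqVlt => /orP[/eqP c0|c0].
  rewrite -c0 powR0 ?mulr0 ?gt_eqF//.
  rewrite [leLHS](_ : _ = 0%E)//; apply: integral0_eq => y Oy.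
  rewrite (_ : (if _ then _ else _) = 0) ?mule0//.
  by case: ifPn => // wy; apply/eqP; rewrite eq_le wy w0.
pose r := c `^ (- (p / kappa)); have r0 : 0 < r by exact: powR_gt0.
pose s := c `^ (- (theta / p)); have s0 : 0 < s by exact: powR_gt0.
have e1 : c * r `^ (kappa - N) = c `^ theta.
  rewrite /r -powRrM -{1}(powRr1 (ltW c0)) -powRDp//; congr (_ `^ _).
  by rewrite /theta; field; rewrite gt_eqF.
have e2 : s `^ (- p) = c `^ theta.
  by rewrite /s -powRrM; congr (_ `^ _); field; rewrite gt_eqF.
have e3 : s `^ p' * r `^ (kappa - N * p') = c `^ theta.
  rewrite /s /r -!powRrM -powRDp//; congr (_ `^ _).
  by rewrite /theta /p'; field; rewrite !gt_eqF.
pose D1 := Om `&` [set y | dist x y < r]; pose D2 := Om `&` [set y | r <= dist x y].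
have mD1 : measurable D1.
  rewrite /D1 (_ : [set y | _] = dist x @^-1` `]-oo, r[); first exact: mdx.
  by apply/seteqP; split => y /=; rewrite in_itv.
have mD2 : measurable D2.
  rewrite /D2 (_ : [set y | _] = dist x @^-1` `[r, +oo[); first exact: mdx.
  by apply/seteqP; split => y /=; rewrite in_itv/= ?andbT.
have D12 : Om = D1 `|` D2.
  apply/seteqP; split => [y Oy|y [[]|[]]//].
  by have [h|h] := ltP (dist x y) r; [left|right].
have mI : measurable_fun Om (fun y => (dist x y `^ (- N))%:E * (wc y)%:E)%E.
  by apply: emeasurable_funM => //; exact: (nnfunE hwc).1.
have I0 y : Om y -> (0 <= (dist x y `^ (- N))%:E * (wc y)%:E)%E.
  by move=> Oy; rewrite mule_ge0 ?lee_fin ?powR_ge0// wc0.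
have -> : riesz N (fun y => if w y <= c then w y else 0)%R x =
    (\int[mu]_(y in D1) ((dist x y `^ (- N))%:E * (wc y)%:E) +
     \int[mu]_(y in D2) ((dist x y `^ (- N))%:E * (wc y)%:E))%E.
  rewrite -ge0_integral_setU//; rewrite -?D12//.
  apply/disj_set2P; rewrite -subset0 => y [[_ /= h1] [_ /= h2]].
  by move: (lt_le_trans h1 h2); rewrite ltxx.
rewrite mulrDl EFinD; apply: leeD.
  apply: (@le_trans _ _ (\int[mu]_(y in D1) (c%:E * (dist x y `^ (- N))%:E))%E).
    apply: le_integral_nonneg => y [Oy _]; first exact: I0.
    by rewrite muleC; apply: lee_wpmul2r; rewrite lee_fin ?powR_ge0.
  rewrite ge0_integralZl ?lee_fin ?(ltW c0)//; last 2 first.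
  - by apply: measurable_funS (mdx' _) => //; exact: subIsetl.
  - by move=> y _; rewrite lee_fin powR_ge0.
  apply: (@le_trans _ _ (c%:E * (C1 * r `^ (kappa - N))%:E)%E).
    apply: lee_wpmul2l; first by rewrite lee_fin ltW.
    by apply: HC1 => // t t0; exact: HA.
  by rewrite -EFinM lee_fin mulrCA e1.
rewrite mulrDl EFinD mul1r.
have [mp pp] := nonneg_measurable_powR p mw.
apply: (@le_trans _ _ (\int[mu]_(y in D2) ((s `^ p')%:E * (dist x y `^ (- (N * p')))%:E
    + (s `^ (- p))%:E * (w y `^ p)%:E))%E).
  apply: le_integral_nonneg => y [Oy _]; first exact: I0.
  rewrite -!EFinM -EFinD lee_fin.
  have h1 : 0 <= dist x y `^ (- N) * s by rewrite mulr_ge0 ?powR_ge0.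
  have h2 : 0 <= w y / s by rewrite divr_ge0 ?w0// ltW.
  apply: (@le_trans _ _ (dist x y `^ (- N) * s * (w y / s))).
    rewrite (_ : _ * s * _ = dist x y `^ (- N) * w y); last by field; rewrite gt_eqF.
    by apply: ler_wpM2l; [exact: powR_ge0|exact: wcw].
  apply: le_trans (conjugate_powR h1 h2 p'0 p0 _) _; first by rewrite addrC.
  have inv1 q : 0 < q -> q^-1 <= 1 -> forall a : R, 0 <= a -> a / q <= a.
    by move=> q0 q1 a a0; rewrite ler_piMr.
  have s1 : p'^-1 <= 1 by rewrite -pp' lerDr invr_ge0 ltW.
  have s2 : p^-1 <= 1 by rewrite -pp' lerDl invr_ge0 ltW.
  apply: lerD.
    rewrite powRM ?powR_ge0 ?(ltW s0)// -powRrM mulNr [leRHS]mulrC.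
    by apply: inv1 => //; rewrite mulr_ge0 ?powR_ge0.
  rewrite powRM ?w0 ?invr_ge0 ?(ltW s0)// -(powR_inv1 (ltW s0)) -powRrM mulN1r [leRHS]mulrC.
  by apply: inv1 => //; rewrite mulr_ge0 ?powR_ge0.
rewrite ge0_integralD//; last 4 first.
- by move=> y _; rewrite mule_ge0// lee_fin powR_ge0.
- by apply: measurable_funS (measurable_funeM _ (mdx' _)) => //; exact: subIsetl.
- by move=> y _; rewrite mule_ge0// lee_fin powR_ge0.
- by apply: measurable_funS (measurable_funeM _ mp) => //; exact: subIsetl.
apply: leeD.
  rewrite ge0_integralZl ?lee_fin ?powR_ge0//; last 2 first.
  - by apply: measurable_funS (mdx' _) => //; exact: subIsetl.
  - by move=> y _; rewrite lee_fin powR_ge0.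
  apply: (@le_trans _ _ ((s `^ p')%:E * (C2 * r `^ (kappa - N * p'))%:E)%E).
    apply: lee_wpmul2l; first by rewrite lee_fin powR_ge0.
    by apply: HC2 => // t t0; exact: HA.
  by rewrite -EFinM lee_fin mulrCA e3.
rewrite ge0_integralZl ?lee_fin ?powR_ge0//; last 2 first.
- by apply: measurable_funS mp => //; exact: subIsetl.
- by move=> y _; rewrite lee_fin powR_ge0.
rewrite e2 -[leRHS]mule1; apply: lee_wpmul2l; first by rewrite lee_fin powR_ge0.
apply: le_trans w1; apply: ge0_subset_integral => //; first exact: subIsetl.
Qed.

(* Split the domain of integration according to w(y)^p <= h(x)^r or not, and bound
   the inner integral over the truncated function by riesz_truncated. *)
Lemma riesz_bilinear N p r : 0 < N -> N < kappa -> 1 < p -> 1 < r ->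
  p^-1 + r^-1 = 1 + (kappa - N) / kappa -> exists2 C : R, 0 <= C &
  forall w h, nnfun w -> nnfun h -> (pint p w <= 1)%E -> (pint r h <= 1)%E ->
  (\int[mu]_(x in Om) ((h x)%:E * riesz N w x) <= C%:E)%E.
Proof.
move=> N0 Nk p1 r1 pr; have k0 := md_kappa HM.
have p0 : 0 < p := lt_trans ltr01 p1; have r0 : 0 < r := lt_trans ltr01 r1.
have bk : (kappa - N) / kappa = p^-1 + r^-1 - 1 by rewrite pr; ring.
have ip : p^-1 < 1 by rewrite invf_lt1.
have ir : r^-1 < 1 by rewrite invf_lt1.
have crit q : 0 < q -> (kappa - N) / kappa < q^-1 -> q * (kappa - N) < kappa.
  by move=> q0; rewrite ltr_pdivrMr// mulrC => H; rewrite mulrC -ltr_pdivlMr.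
have [|C1 C10 HC1] := riesz_truncated N0 Nk p1; first by apply: crit => //; rewrite bk; lra.
have [|C2 C20 HC2] := riesz_truncated N0 Nk r1; first by apply: crit => //; rewrite bk; lra.
(* [riesz_truncated] at the height h(x)^(r/p), multiplied by h(x), gives exactly h(x)^r by the
   relation between p and r; [e2] is the same with w and h exchanged. *)
have e1 : 1 + r / p * (1 - p * (kappa - N) / kappa) = r.
  by rewrite -[p * _ / _]mulrA bk; field; rewrite !gt_eqF.
have e2 : 1 + p / r * (1 - r * (kappa - N) / kappa) = p.
  by rewrite -[r * _ / _]mulrA bk; field; rewrite !gt_eqF.
exists (C1 + C2); first by rewrite addr_ge0.
move=> w h hw hh w1 h1; have [mw w0] := hw; have [mh h0] := hh.
pose F1 x y := (h x * (dist x y `^ (- N) * (if w y <= h x `^ (r / p) then w y else 0)))%:E.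
(* In the region w(y) > h(x)^(r/p) one has h(x) <= w(y)^(p/r), so h is the truncated function there
   and the roles are exchanged. *)
pose F2 x y := (w y * (dist x y `^ (- N) * (if h x <= w y `^ (p / r) then h x else 0)))%:E.
have m1 (u : E -> R) : measurable_fun Om u -> measurable_fun (Om `*` Om) (fun z : E * E => u z.1).
  by move=> /measurable_EFinP/(measurable_fun_fst mOm)/measurable_EFinP.
have m2 (u : E -> R) : measurable_fun Om u -> measurable_fun (Om `*` Om) (fun z : E * E => u z.2).
  by move=> /measurable_EFinP/(measurable_fun_snd mOm)/measurable_EFinP.
have mOO : measurable (Om `*` Om) by exact: measurableX.
have mdN : measurable_fun (Om `*` Om) (fun z : E * E => dist z.1 z.2 `^ (- N)).
  exact: measurable_funS (hK (- N)).1.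
have mF1 : measurable_fun (Om `*` Om) (fun z : E * E => F1 z.1 z.2).
  apply/measurable_EFinP; apply: measurable_funM; first exact: m1.
  apply: measurable_funM => //; apply: measurable_fun_if => //.
    by apply: measurable_fun_ler; [exact: m2|exact: (m1 _ (measurable_fun_powR (r / p) mh))].
  by apply: measurable_funS (m2 _ mw) => //; exact: subIsetl.
have mF2 : measurable_fun (Om `*` Om) (fun z : E * E => F2 z.1 z.2).
  apply/measurable_EFinP; apply: measurable_funM; first exact: m2.
  apply: measurable_funM => //; apply: measurable_fun_if => //.
    by apply: measurable_fun_ler; [exact: m1|exact: (m2 _ (measurable_fun_powR (p / r) mw))].
  by apply: measurable_funS (m1 _ mh) => //; exact: subIsetl.
have F10 x y : Om x -> Om y -> (0 <= F1 x y)%E.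
  move=> Ox Oy; rewrite lee_fin mulr_ge0 ?h0// mulr_ge0 ?powR_ge0//.
  by case: ifPn => // _; exact: w0.
have F20 x y : Om x -> Om y -> (0 <= F2 x y)%E.
  move=> Ox Oy; rewrite lee_fin mulr_ge0 ?w0// mulr_ge0 ?powR_ge0//.
  by case: ifPn => // _; exact: h0.
have split x y : Om x -> Om y ->
    ((h x)%:E * ((dist x y `^ (- N))%:E * (w y)%:E) <= F1 x y + F2 x y)%E.
  move=> Ox Oy; rewrite -!EFinM -EFinD lee_fin.
  have [wh|hw'] := leP (w y) (h x `^ (r / p)).
    by rewrite lerDl -lee_fin; exact: F20.
  rewrite mulr0 mulr0 add0r ifT; first by rewrite [leLHS](_ : _ = w y * (dist x y `^ (- N) * h x))//; ring.
  rewrite -(powRr1 (h0 _ Ox)) -(_ : r / p * (p / r) = 1); last by field; rewrite !gt_eqF.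
  rewrite powRrM; apply: powR_le; rewrite ?powR_ge0 ?divr_ge0// ltW//.
have [mpw pw0] := nonneg_measurable_powR p mw.
have [mrh rh0] := nonneg_measurable_powR r mh.
have B1 x : Om x -> (\int[mu]_(y in Om) F1 x y <= (C1 * h x `^ r)%:E)%E.
  move=> Ox; have := HC1 w x (h x `^ (r / p)) hw Ox (powR_ge0 _ _) w1.
  move=> /(lee_wpmul2l (_ : 0 <= (h x)%:E)%E); rewrite lee_fin h0// => /(_ isT) H.
  apply: le_trans (_ : (_ <= (h x)%:E * _)%E) (le_trans H _).
    rewrite -ge0_integralZl ?lee_fin ?h0//.
    - apply: (measurable_Kint_integrand x (hK (- N))); apply/measurable_EFinP.
      apply: measurable_fun_if => //; first by apply: measurable_fun_ler => //; exact: measurable_cst.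
      by apply: measurable_funS mw => //; exact: subIsetl.
    - move=> y Oy; rewrite -EFinM lee_fin mulr_ge0 ?powR_ge0//.
      by case: ifPn => // _; exact: w0.
  rewrite -EFinM lee_fin mulrCA ler_wpM2l// -powRrM.
  have [->|hx0] := eqVneq (h x) 0; first by rewrite mul0r powR_ge0.
  have hx : 0 < h x by rewrite lt_neqAle eq_sym hx0 h0.
  by rewrite -{1}(powRr1 (ltW hx)) -powRDp// e1.
have B2 y : Om y -> (\int[mu]_(x in Om) F2 x y <= (C2 * w y `^ p)%:E)%E.
  move=> Oy; have := HC2 h y (w y `^ (p / r)) hh Oy (powR_ge0 _ _) h1.
  move=> /(lee_wpmul2l (_ : 0 <= (w y)%:E)%E); rewrite lee_fin w0// => /(_ isT) H.
  have hc : measurable_fun Om (fun x => if h x <= w y `^ (p / r) then h x else 0).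
    apply: measurable_fun_if => //; first by apply: measurable_fun_ler => //; exact: measurable_cst.
    by apply: measurable_funS mh => //; exact: subIsetl.
  have hm := measurable_Kint_integrand y (hK (- N)) ((measurable_EFinP _ _).2 hc).
  apply: le_trans (_ : (_ <= (w y)%:E * _)%E) (le_trans H _).
    apply: (@le_trans _ _ (\int[mu]_(x in Om) ((w y)%:E * ((dist y x `^ (- N))%:E *
        (if h x <= w y `^ (p / r) then h x else 0)%:E)))%E).
      apply: le_integral_nonneg => x Ox; first exact: F20.
      by rewrite (md_distC HM) /F2 -!EFinM; exact: lexx.
    rewrite ge0_integralZl; [exact: lexx|exact: mOm|exact: hm| |by rewrite lee_fin w0].
    move=> x Ox; rewrite -EFinM lee_fin; apply: mulr_ge0; first exact: powR_ge0.
    by case: ifPn => // _; exact: h0.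
  rewrite -EFinM lee_fin mulrCA ler_wpM2l// -powRrM.
  have [->|wy0] := eqVneq (w y) 0; first by rewrite mul0r powR_ge0.
  have wy : 0 < w y by rewrite lt_neqAle eq_sym wy0 w0.
  by rewrite -{1}(powRr1 (ltW wy)) -powRDp// e2.
have mFi1 := @measurable_integral_in _ _ _ _ _ mu Om Om F1 mOm mOm F10 mF1.
have mFi2 := @measurable_integral_in _ _ _ _ _ mu Om Om F2 mOm mOm F20 mF2.
apply: (@le_trans _ _ (\int[mu]_(x in Om) \int[mu]_(y in Om) F1 x y +
    \int[mu]_(x in Om) \int[mu]_(y in Om) F2 x y)%E).
  rewrite -ge0_integralD//; last 2 first.
  - by move=> x Ox; apply: integral_ge0 => y Oy; exact: F10.
  - by move=> x Ox; apply: integral_ge0 => y Oy; exact: F20.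
  apply: le_integral_nonneg => x Ox.
    by rewrite mule_ge0 ?lee_fin ?h0//; exact: (riesz_nonneg N hw).2.
  have mk := measurable_Kint_integrand x (hK (- N)) (nnfunE hw).1.
  have k0' y : Om y -> (0 <= (dist x y `^ (- N))%:E * (w y)%:E)%E.
    by move=> Oy; rewrite mule_ge0 ?lee_fin ?powR_ge0 ?w0.
  rewrite -ge0_integralD//; last 4 first.
  - by move=> y Oy; exact: F10.
  - exact: (@measurable_fun_slice _ _ _ _ _ Om Om F1).
  - by move=> y Oy; exact: F20.
  - exact: (@measurable_fun_slice _ _ _ _ _ Om Om F2).
  rewrite -ge0_integralZl ?lee_fin ?h0//.
  apply: le_integral_nonneg => y Oy; last exact: split.
  by apply: mule_ge0; [rewrite lee_fin h0|exact: k0'].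
rewrite EFinD; apply: leeD.
  apply: (@le_trans _ _ (\int[mu]_(x in Om) (C1%:E * (h x `^ r)%:E))%E).
    apply: le_integral_nonneg => x Ox; last exact: B1.
    by apply: integral_ge0 => y Oy; exact: F10.
  rewrite (ge0_integralZl mu mOm (nonneg_measurable_powR r mh).1); last 2 first.
  - by move=> x _; rewrite lee_fin powR_ge0.
  - by rewrite lee_fin.
  by rewrite -[leRHS]mule1; apply: lee_wpmul2l; [rewrite lee_fin|exact: h1].
rewrite (@tonelli_in _ _ _ _ _ mu mu Om Om F2)//.
apply: (@le_trans _ _ (\int[mu]_(y in Om) (C2%:E * (w y `^ p)%:E))%E).
  apply: le_integral_nonneg => y Oy; last exact: B2.
  by apply: integral_ge0 => x Ox; exact: F20.
rewrite (ge0_integralZl mu mOm (nonneg_measurable_powR p mw).1); last 2 first.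
- by move=> x _; rewrite lee_fin powR_ge0.
- by rewrite lee_fin.
by rewrite -[leRHS]mule1; apply: lee_wpmul2l; [rewrite lee_fin|exact: w1].
Qed.

(** Duality: the bilinear bound is tested with a multiple of g^(q-1), where g = min(|v|, M). The
    truncation makes the q-integral of g finite, as Om has finite measure, so that division by its
    q-norm s is legitimate; the outcome is s <= C, and monotone convergence removes M. *)
Lemma riesz_hls N p q : 0 < N -> N < kappa -> 1 < p -> p < kappa / (kappa - N) ->
  q^-1 = p^-1 - (kappa - N) / kappa -> exists2 C : R, 0 <= C &
  forall t w v, 0 < t -> nnfun w -> measurable_fun Om v -> (pint p w <= (t `^ p)%:E)%E ->
  {ae mu, forall x, Om x -> (`|v x|%:E <= riesz N w x)%E} ->
  (pint q (fun x => `|v x|) <= ((C * t) `^ q)%:E)%E.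
Proof.
move=> N0 Nk p1 pk qE; have k0 := md_kappa HM.
have p0 : 0 < p := lt_trans ltr01 p1.
have b0 : 0 < kappa - N by rewrite subr_gt0.
have bk0 : 0 < (kappa - N) / kappa by exact: divr_gt0.
have iq0 : 0 < q^-1.
  by rewrite qE subr_gt0 -[ltLHS]invrK ltf_pV2 ?posrE ?invr_gt0// invf_div.
have q0 : 0 < q by rewrite -invr_gt0.
have iq1 : q^-1 < 1.
  have : p^-1 < 1 by rewrite invf_lt1.
  by rewrite qE; lra.
have q1 : 1 < q by rewrite -[ltLHS]invr1 -[ltRHS]invrK ltf_pV2 ?posrE ?invr_gt0.
pose r := q / (q - 1).
have q10 : 0 < q - 1 by rewrite subr_gt0.
have r1 : 1 < r by rewrite ltr_pdivlMr// mul1r gtrBl.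
have pr : p^-1 + r^-1 = 1 + (kappa - N) / kappa.
  have -> : r^-1 = 1 - q^-1 by rewrite /r; field; rewrite !gt_eqF.
  by rewrite qE; ring.
have [C C0 HC] := riesz_bilinear N0 Nk p1 r1 pr.
exists C => // t w v t0 hw mv wt vw.
apply: (@riesz_homogeneous N p q _ C0 _ t w v) => //.
clear t w v t0 hw mv wt vw; move=> w v hw mv w1 vw.
pose g (M : nat) x := Num.min `|v x| M%:R.
have mnv : measurable_fun Om (fun x => `|v x|) by exact: measurableT_comp.
have g0 M x : 0 <= g M x by rewrite le_min normr_ge0 ler0n.
have hg M : nnfun (g M) by split => //; apply: measurable_minr => //; exact: measurable_cst.
have bound M : (pint q (g M) <= (C `^ q)%:E)%E.
  have [mgq gq0] := nonneg_measurable_powR q (hg M).1.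
  have fin : (pint q (g M) < +oo)%E.
    apply: (@le_lt_trans _ _ ((M%:R `^ q)%:E * mu Om)%E); last first.
      by rewrite lte_mul_pinfty ?lee_fin ?powR_ge0// (md_fin HM).
    apply: (integral_nonneg_le_cst _ mOm) => x Ox; rewrite gq0//= lee_fin.
    by apply: powR_le; rewrite ?(ltW q0)// ge_min lexx orbT.
  have J0 : (0 <= pint q (g M))%E by apply: integral_ge0.
  have [J JE] : exists J : R, pint q (g M) = J%:E.
    by exists (fine (pint q (g M))); rewrite fineK// ge0_fin_numE.
  rewrite JE lee_fin in J0 *; rewrite le_eqVlt in J0; case/orP: J0 => [/eqP<-|J0].
    exact: powR_ge0.
  pose s := J `^ q^-1; have s0 : 0 < s by exact: powR_gt0.
  have sq : s `^ q = J by rewrite /s -powRrM mulVf ?gt_eqF// powRr1// ltW.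
  (* r (q - 1) = q, so the r-integral of h is the q-integral of g / s. *)
  pose h x := (g M x / s) `^ (q - 1).
  have gs0 x : 0 <= g M x / s by rewrite divr_ge0// ltW.
  have hh : nnfun h.
    split; last by move=> x _; exact: powR_ge0.
    apply: measurable_fun_powR; apply: measurable_funM; first exact: (hg M).1.
    exact: measurable_cst.
  have h1 : (pint r h <= 1)%E.
    have -> : pint r h = pint q (fun x => g M x * s^-1).
      apply: eq_integral => x _; rewrite /h -powRrM; congr (_ `^ _)%:E.
      by rewrite /r; field; rewrite gt_eqF.
    rewrite pintZ ?invr_ge0 ?(ltW s0)// JE -EFinM -sq -powRM ?invr_ge0 ?(ltW s0)//.
    by rewrite mulVf ?gt_eqF// powR1.
  have := HC w h hw hh w1 h1 => H.
  have lower : (((s `^ (1 - q))%:E * J%:E) <= \int[mu]_(x in Om) ((h x)%:E * riesz N w x))%E.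
    rewrite -JE -ge0_integralZl ?lee_fin ?powR_ge0//.
    have [mr r0'] := riesz_nonneg N hw.
    have [mhr hr0] := nonneg_measurableM (nnfunE hh) (riesz_nonneg N hw).
    apply: ae_le_integral_nonneg => //.
      by move=> x Ox; rewrite mule_ge0 ?gq0// lee_fin powR_ge0.
    apply: filterS vw => x vw Ox; apply: (@le_trans _ _ ((h x)%:E * (g M x)%:E)%E).
      rewrite -!EFinM lee_fin /h powRM ?invr_ge0 ?(ltW s0)//.
      rewrite -(powR_inv1 (ltW s0)) -powRrM mulN1r opprB.
      have [->|gx0] := eqVneq (g M x) 0; first by rewrite powR0 ?gt_eqF// mulr0 !mulr0.
      have gx : 0 < g M x by rewrite lt_neqAle eq_sym gx0 g0.
      have -> : g M x `^ q = g M x `^ (q - 1) * g M x.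
        by rewrite -{3}(powRr1 (ltW gx)) -powRDp// subrK.
      by rewrite [leRHS]mulrAC mulrC.
    apply: lee_wpmul2l; first by rewrite lee_fin powR_ge0.
    by apply: le_trans (vw Ox); rewrite lee_fin ge_min lexx.
  move: (le_trans lower H); rewrite -EFinM lee_fin -{1}sq -powRDp//.
  rewrite (_ : 1 - q + q = 1); last by ring.
  by rewrite powRr1 ?(ltW s0)// => sC; rewrite lee_fin -sq; apply: powR_le => //; exact: ltW.
pose f (M : nat) x := (g M x `^ q)%:E.
have cvgf x : Om x -> f ^~ x @ \oo --> (`|v x| `^ q)%:E.
  move=> Ox; apply: cvg_near_cst; exists (Num.bound `|v x|) => // k /= xk.
  rewrite /f /g min_l//; apply: le_trans (ltW (archi_boundP (normr_ge0 _))) _.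
  by rewrite ler_nat.
have mf M : measurable_fun Om (f M) := (nonneg_measurable_powR q (hg M).1).1.
have ndf x : Om x -> nondecreasing_seq (f ^~ x).
  move=> Ox k l kl; rewrite lee_fin; apply: powR_le; rewrite ?(ltW q0)//.
  by rewrite le_min !ge_min lexx/= ler_nat kl orbT.
rewrite (eq_integral (fun x => limn (f ^~ x))); last first.
  by move=> x /set_mem Ox; apply/esym/cvg_lim => //; exact: cvgf.
rewrite monotone_convergence//; last by move=> M x Ox; rewrite lee_fin powR_ge0.
apply: lime_le; last by apply: nearW => M; exact: bound.
apply: ereal_nondecreasing_is_cvgn => k l kl.
by apply: le_integral_nonneg => x Ox; [rewrite lee_fin powR_ge0|exact: ndf].
Qed.

End riesz_potential.

(** * Comparison with the Green function *)

(** Used with a = 2s - n > 0: the power of the distance is then smallest at the smallest distance,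
    while the boundary factor is smallest at the largest one. *)
Lemma green_model_mono (R : realType) (rho r a dp dq dx dy gamma : R) :
  0 < rho -> 0 <= a -> 0 <= dp -> 0 <= dq -> 0 <= gamma ->
  rho / 2 <= r -> r <= 2 * rho -> dp / 2 <= dx -> dq / 2 <= dy ->
  (rho / 2) `^ a * Num.min ((dp / 2) `^ gamma * (dq / 2) `^ gamma / (2 * rho) `^ (2 * gamma)) 1 <=
  r `^ a * Num.min (dx `^ gamma * dy `^ gamma / r `^ (2 * gamma)) 1.
Proof.
move=> rho0 a0 dp0 dq0 g0 r1 r2 d1 d2.
have gg : 0 <= 2 * gamma by rewrite mulr_ge0.
have r0 : 0 < r by apply: lt_le_trans r1; rewrite divr_gt0.
apply: ler_pM; rewrite ?powR_ge0//.
- by rewrite le_min ler01 andbT divr_ge0 ?mulr_ge0 ?powR_ge0.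
- by apply: powR_le; rewrite // ?divr_ge0 ?(ltW rho0).
rewrite le_min !ge_min lexx orbT andbT; apply/orP; left.
apply: ler_pM; rewrite ?invr_ge0 ?mulr_ge0 ?powR_ge0//.
  by apply: ler_pM; rewrite ?powR_ge0//; apply: powR_le; rewrite // divr_ge0.
by rewrite lef_pV2 ?posrE ?powR_gt0 ?mulr_gt0//; apply: powR_le => //; exact: ltW.
Qed.

Section euclidean_domain.
Context (R : realType) (n : nat) (Om : set 'rV[R]_n).
Local Notation E := 'rV[R]_n.
Local Notation leb := (lebesgue_row R n).
Local Notation edist := (fun x y : E => enorm (x - y)).
Hypotheses (n0 : (0 < n)%N) (bOm : bounded_set Om) (COm : C11_open_set Om).
Variables (s gamma : R) (G : E -> E -> R).
Hypothesis hK1 : K1 Om s gamma G.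

Let oOm : open Om := COm.1.
Let mOm : measurable Om. Proof. exact: open_measurable_row. Qed.

Lemma open_other_point (x : E) : Om x -> exists2 y, Om y & y <> x.
Proof.
move=> Ox; have [e e0 He] := open_enormP oOm Ox.
pose u : E := delta_mx ord0 (Ordinal n0).
have u1 : enorm u = 1 by exact: enorm_delta.
exists (x + (e / 2) *: u).
  apply: He; rewrite opprD addrA subrr add0r enormN enormZ u1 mulr1 ger0_norm; lra.
move=> H; have : (e / 2) *: u = 0 by apply: (addrI x); rewrite H addr0.
move=> /(congr1 (@enorm R n)); rewrite enormZ u1 mulr1 enorm0 ger0_norm; lra.
Qed.

(** Read off from (K1): if δ(x) were 0, the upper bound for G(x,y) at another point y would be 0,
    since 0^γ = 0, whereas G is positive. This also covers the convention for an empty frontier. *)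
Lemma delta_gt0 (x : E) : Om x -> 0 < delta Om x.
Proof.
move=> Ox; have [y Oy yx] := open_other_point Ox.
have [/andP[g0 _] _ Gpos _ [C C0 HC]] := hK1.
have xy : off_diag Om (x, y) by split => //; exact/nesym.
have := Gpos _ _ xy; have /andP[_] := HC _ _ xy.
move=> h1 h2; rewrite lt_neqAle dist_to_ge0 andbT eq_sym; apply/eqP => dx.
move: (lt_le_trans h2 h1); rewrite /green_kernel_model.
by rewrite [delta Om x]dx powR0 ?gt_eqF// !mul0r min_l// mulr0 mulr0 ltxx.
Qed.

Lemma row_metric_domain : metric_domain leb Om (delta Om) edist n%:R.
Proof.
have [M M0 HM] := bounded_enorm bOm.
split.
- by rewrite ltr0n.
- exact: mOm.
- exact: measurable_set1_row.
- by move=> x; exact: lebesgue_row_set1.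
- exact: lebesgue_row_bounded.
- exact: measurable_delta.
- exact: measurable_enorm_diff.
- by move=> x y; exact: enormB.
- by move=> x; rewrite subrr enorm0.
- by move=> x y; exact: enorm_gt0.
- by move=> z x y; exact: enorm_triangle.
- exact: delta_gt0.
- move=> x y; have := dist_to_lip (frontier Om) x y.
  by rewrite ler_norml => /andP[_]; rewrite lerBlDl.
(* A frontier point lies within 1 of a point of Om, and two points of Om are at distance at most 2
   M. *)
- exists (2 * M + 1); first by lra.
  move=> x y Ox Oy; split.
    apply: le_trans (enorm_triangle 0 x y) _; rewrite subr0 sub0r enormN.
    by have := HM _ Ox; have := HM _ Oy; lra.
  have [[z Fz]|Fz] := pselect (exists z, frontier Om z); last first.
    rewrite /delta /dist_to [X in inf X](_ : _ = set0) ?inf0; first lra.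
    by apply/seteqP; split => // t [z Hz _]; apply: Fz; exists z.
  apply: le_trans (dist_to_le x Fz) _.
  have [z' Oz' zz'] := (closure_enormP Om z).1 Fz.1 1 ltr01.
  apply: le_trans (enorm_triangle z' x z) _.
  rewrite (enormB z').
  apply: le_trans (lerD (enorm_triangle 0 x z') (ltW zz')) _; rewrite subr0 sub0r enormN.
  by have := HM _ Ox; have := HM _ Oz'; lra.
- exists (2 ^+ n); first by rewrite exprn_ge0.
  move=> x t t0; apply: le_trans (lebesgue_row_ball x t0).
  apply: le_measure; rewrite ?inE; last exact: subIsetr.
    by apply: measurableI => //; exact: measurable_ball_row.
  exact: measurable_ball_row.
Qed.

(** Open balls of the sup norm: their volume is explicit, and equal for both centres in the test
    below. *)
Definition cube (x : E) (eta : R) : set E := [set y | forall i, `]x ord0 i - eta, x ord0 i + eta[%classic (y ord0 i)].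

Lemma lebesgue_row_cube x eta : 0 < eta -> leb (cube x eta) = ((2 * eta) ^+ n)%:E.
Proof.
move=> e0; rewrite /cube (lebesgue_row_box (A := fun i => `]x ord0 i - eta, x ord0 i + eta[%classic))//.
rewrite (eq_bigr (fun=> (2 * eta)%:E)); last first.
  move=> i _; rewrite lebesgue_measure_itv/= lte_fin ifT; last lra.
  by rewrite -EFinB; congr EFin; ring.
by rewrite prodEFin prodr_const card_ord.
Qed.

Lemma measurable_cube x eta : measurable (cube x eta).
Proof.
rewrite (_ : cube x eta = \bigcap_(i in [set: 'I_n])
    (@row_coord R n i @^-1` `]x ord0 i - eta, x ord0 i + eta[)); last first.
  by apply/seteqP; split => y /= H i; [move=> _|]; exact: H.
apply: fin_bigcap_measurable => // i _.
rewrite -[X in measurable X]setTI; exact: measurable_row_coord.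
Qed.

Lemma cube_enorm x eta y : 0 < eta -> cube x eta y -> enorm (x - y) <= n%:R * eta.
Proof.
move=> e0 H; apply: le_trans (enorm_le_norm _) _; rewrite ler_wpM2l ?ler0n//.
apply: norm_le_coord; first exact: ltW.
move=> i; have := H i; rewrite /= in_itv/= !mxE => /andP[h1 h2].
by rewrite ler_norml; apply/andP; split; lra.
Qed.

Let measurable_off : measurable_fun (off_diag Om) (fun z => G z.1 z.2).
Proof. by case: hK1. Qed.

Let green_ge0 x y : off_diag Om (x, y) -> 0 <= G x y.
Proof. by case: hK1 => _ _ H _ _ xy; exact/ltW/H. Qed.

Lemma open_cube (x : E) (e : R) : Om x -> 0 < e -> exists2 eta, 0 < eta & cube x eta `<=` Om /\
  forall y, cube x eta y -> enorm (x - y) < e.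
Proof.
move=> Ox e0; have [r r0 Hr] := open_enormP oOm Ox.
have n1 : 0 < n%:R :> R by rewrite ltr0n.
pose t := Num.min r e; have t0 : 0 < t by rewrite lt_min r0.
have d0 : 0 < t / (2 * n%:R) by rewrite divr_gt0// mulr_gt0.
exists (t / (2 * n%:R)) => //.
have H y : cube x (t / (2 * n%:R)) y -> enorm (x - y) < t.
  move=> /(cube_enorm d0) /le_lt_trans; apply.
  rewrite (_ : _ * _ = t / 2); last by field; rewrite gt_eqF.
  by rewrite ltr_pdivrMr// ltr_pMr//; lra.
split=> y /H; rewrite lt_min => /andP[h1 h2] //; exact: Hr.
Qed.

Variables (lam : nat -> R) (phi : nat -> E -> R).
Hypothesis EB : green_eigenbasis Om G lam phi.
Hypothesis SA : L2_self_adjoint Om (green_op Om G).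
Hypothesis CO : L2_compact Om (green_op Om G).

Let Om_point : exists x, Om x.
Proof.
apply: contrapT => H; have Om0 : Om = set0.
  by apply/seteqP; split => // x Ox; apply: H; exists x.
have := eigen_orthonormal EB 0%N 0%N; rewrite /inner /Rintegral Om0 integral_set0 /=.
by move=> /esym/eqP; rewrite oner_eq0.
Qed.

(* For [n < 2 s] the kernel is bounded and vanishes on the diagonal, so testing
   the positive operator with the difference of the indicators of two distant
   small cubes gives a negative value. *)
Lemma green_dimension : 2 * s <= n%:R.
Proof.
rewrite leNgt; apply/negP => ns.
have HM := row_metric_domain; have [/andP[g0 _] _ Gpos _ [C C0 HC]] := hK1.
have [D D0 HD] := md_bounded HM.
have [p Op] := Om_point; have [q Oq qp] := open_other_point Op.
pose a := - (n%:R - 2 * s); have a0 : 0 < a by rewrite oppr_gt0 subr_lt0.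
pose rho := enorm (p - q); have rho0 : 0 < rho by apply: enorm_gt0; exact/nesym.
have dp := delta_gt0 Op; have dq := delta_gt0 Oq.
(* A lower bound for the model between points near p and points near q, so that G >= c0 = low / C
   across. *)
pose low := (rho / 2) `^ a * Num.min ((delta Om p / 2) `^ gamma * (delta Om q / 2) `^ gamma /
  (2 * rho) `^ (2 * gamma)) 1.
have low0 : 0 < low.
  rewrite mulr_gt0// ?powR_gt0 ?divr_gt0// lt_min ltr01 andbT.
  by rewrite divr_gt0 ?mulr_gt0 ?powR_gt0 ?divr_gt0 ?mulr_gt0.
pose c0 := C^-1 * low; have c00 : 0 < c0 by rewrite mulr_gt0 ?invr_gt0.
(* The entry rho / 4 keeps the cubes apart; the second one gives C (2e)^a <= c0 / 2, a bound for the
   kernel inside one cube; the last two keep δ above half its value at the centre. *)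
pose e := Num.min (Num.min (rho / 4) ((c0 / (2 * C)) `^ a^-1 / 2)) (Num.min (delta Om p / 2) (delta Om q / 2)).
have t1 : 0 < (c0 / (2 * C)) `^ a^-1 by rewrite powR_gt0// divr_gt0// mulr_gt0.
have e0 : 0 < e.
  by rewrite /e !lt_min; apply/andP; split; apply/andP; split; rewrite divr_gt0.
have [/andP[e1 e2] /andP[e3 e4]] : (e <= rho / 4) && (e <= (c0 / (2 * C)) `^ a^-1 / 2) /\
    (e <= delta Om p / 2) && (e <= delta Om q / 2).
  by rewrite -!le_min /e; split; rewrite ge_min lexx ?orbT.
have [eta1 eta10 [Hp1 Hp2]] := open_cube Op e0; have [eta2 eta20 [Hq1 Hq2]] := open_cube Oq e0.
pose eta := Num.min eta1 eta2; have eta0 : 0 < eta by rewrite lt_min eta10.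
have sub x t t' : t <= t' -> cube x t `<=` cube x t'.
  move=> tt y H i; have := H i; rewrite /= !in_itv/= => /andP[h1 h2].
  by apply/andP; split; lra.
pose P := cube p eta; pose Q := cube q eta.
have PO : P `<=` Om by apply: subset_trans Hp1; apply: sub; rewrite ge_min lexx.
have QO : Q `<=` Om by apply: subset_trans Hq1; apply: sub; rewrite ge_min lexx orbT.
have Pe y : P y -> enorm (p - y) < e by move=> Py; apply: Hp2; apply: sub Py; rewrite ge_min lexx.
have Qe y : Q y -> enorm (q - y) < e by move=> Qy; apply: Hq2; apply: sub Qy; rewrite ge_min lexx orbT.
have mP : measurable P by exact: measurable_cube.
have mQ : measurable Q by exact: measurable_cube.
pose m := (2 * eta) ^+ n; have m0 : 0 < m by rewrite exprn_gt0// mulr_gt0.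
have dlip x y : delta Om x <= delta Om y + enorm (x - y) := md_dlip HM x y.
have GC x y : off_diag Om (x, y) -> G x y <= C * enorm (x - y) `^ a.
  move=> xy; have /andP[_ h] := HC _ _ xy; apply: le_trans h _.
  apply: ler_wpM2l; first exact: ltW.
  apply: ler_piMr; first exact: powR_ge0.
  by rewrite ge_min lexx orbT.
have near x y z : e <= rho -> Om x -> Om y -> x <> y -> enorm (z - x) < e -> enorm (z - y) < e -> G x y <= c0 / 2.
  move=> _ Ox Oy xy zx zy; apply: le_trans (GC _ _ _) _ => //.
  have xye : enorm (x - y) <= 2 * e.
    by apply: le_trans (enorm_triangle z x y) _; rewrite enormB; lra.
  apply: (@le_trans _ _ (C * (c0 / (2 * C)))).
    rewrite ler_wpM2l ?(ltW C0)//.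
    have cc : 0 <= c0 / (2 * C) by apply/ltW; rewrite divr_gt0// mulr_gt0.
    rewrite -[leRHS](powRr1 cc) -[X in _ <= _ `^ X](mulVf (lt0r_neq0 a0)) powRrM; apply: powR_le; rewrite ?(ltW a0) ?enorm_ge0//.
    by lra.
  by rewrite le_eqVlt; apply/orP; left; apply/eqP; field; rewrite gt_eqF.
have far x y : Om x -> Om y -> enorm (p - x) < e -> enorm (q - y) < e -> c0 <= G x y /\ c0 <= G y x.
  move=> Ox Oy px qy.
  have r1 : rho / 2 <= enorm (x - y).
    have := enorm_triangle x p q; rewrite -/rho; have := enorm_triangle y x q.
    by rewrite (enormB y q); lra.
  have r2 : enorm (x - y) <= 2 * rho.
    have := enorm_triangle p x y; rewrite (enormB x p); have := enorm_triangle q p y.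
    by rewrite -/rho; lra.
  have d1 : delta Om p / 2 <= delta Om x by have := dlip p x; lra.
  have d2 : delta Om q / 2 <= delta Om y by have := dlip q y; lra.
  have xy : x <> y by move=> xy; rewrite xy subrr enorm0 in r1; lra.
  have r0 : 0 < enorm (x - y) by exact: enorm_gt0.
  have lowG u v : off_diag Om (u, v) -> enorm (u - v) = enorm (x - y) ->
      delta Om u `^ gamma * delta Om v `^ gamma = delta Om x `^ gamma * delta Om y `^ gamma ->
      c0 <= G u v.
    move=> uv e5 e6; have /andP[h _] := HC _ _ uv; apply: le_trans h.
    apply: ler_wpM2l; first by rewrite invr_ge0 ltW.
    rewrite /green_kernel_model e5 e6.
    exact: (green_model_mono rho0 (ltW a0) (ltW dp) (ltW dq) (ltW g0) r1 r2 d1 d2).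
  split; first exact: lowG.
  by apply: lowG; [split => //; exact/nesym|exact: enormB|exact: mulrC].
have PQ : P `&` Q = set0.
  apply/seteqP; split => // y [/Pe h1 /Qe h2].
  by have := enorm_triangle y p q; rewrite -/rho (enormB y); lra.
pose f (y : E) : R := \1_P y - \1_Q y.
have m1P : measurable_fun Om (\1_P : E -> R) by exact: measurable_indic.
have m1Q : measurable_fun Om (\1_Q : E -> R) by exact: measurable_indic.
have mf : measurable_fun Om f by exact: measurable_funB.
have fP y : P y -> (\1_P y = 1 :> R) * (\1_Q y = 0 :> R).
  move=> Py; rewrite !indicE mem_set// memNset// => Qy.
  by have : set0 y by rewrite -PQ.
have fQ y : Q y -> (\1_P y = 0 :> R) * (\1_Q y = 1 :> R).
  move=> Qy; rewrite !indicE (mem_set Qy) memNset// => Py.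
  by have : set0 y by rewrite -PQ.
have fN y : ~ P y -> ~ Q y -> (\1_P y = 0 :> R) * (\1_Q y = 0 :> R).
  by move=> Py Qy; rewrite !indicE !memNset.
have muQ : leb Q = m%:E by exact: lebesgue_row_cube.
have muP : leb P = m%:E by exact: lebesgue_row_cube.
have IP : (\int[leb]_(y in Om) (\1_P y)%:E = m%:E)%E.
  by rewrite integral_indic// setIidl//; exact: muP.
have IQ : (\int[leb]_(y in Om) (\1_Q y)%:E = m%:E)%E.
  by rewrite integral_indic// setIidl//; exact: muQ.
have iP : leb.-integrable Om (EFin \o (\1_P : E -> R)).
  apply/integrableP; split; first exact/measurable_EFinP.
  under eq_integral do rewrite /= ger0_norm//.
  by rewrite IP ltry.
have iQ : leb.-integrable Om (EFin \o (\1_Q : E -> R)).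
  apply/integrableP; split; first exact/measurable_EFinP.
  under eq_integral do rewrite /= ger0_norm//.
  by rewrite IQ ltry.
have iPQ (u v : R) : leb.-integrable Om (EFin \o (fun y => u * \1_P y + v * \1_Q y)).
  have -> : EFin \o (fun y => u * \1_P y + v * \1_Q y) =
      (fun y => (u%:E * (EFin \o (\1_P : E -> R)) y + v%:E * (EFin \o (\1_Q : E -> R)) y)%E) by [].
  by apply: integrableD => //; exact: integrableZl.
have IPQ (u v : R) : \int[leb]_(y in Om) (u * \1_P y + v * \1_Q y) = (u + v) * m.
  rewrite RintegralD//=; [|exact: (integrableZl mOm _ iP)|exact: (integrableZl mOm _ iQ)].
  by rewrite !RintegralZl// /Rintegral IP IQ /=; ring.
have f1 y : `|f y| <= 1.
  have [Py|Py] := pselect (P y); first by rewrite /f (fP _ Py).1 (fP _ Py).2 subr0 normr1.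
  have [Qy|Qy] := pselect (Q y); first by rewrite /f (fQ _ Qy).1 (fQ _ Qy).2 sub0r normrN1.
  by rewrite /f (fN _ Py Qy).1 (fN _ Py Qy).2 subrr normr0 ler01.
have [L2f _] := bounded_L2 HM ler01 mf (nearW _ (fun y _ => f1 y)).
have og0 x y : 0 <= offG Om G x y by rewrite /offG; case: pselect => // xy; exact: green_ge0.
have ogD x y : Om x -> Om y -> offG Om G x y <= C * D `^ a.
  move=> Ox Oy; rewrite /offG; case: pselect => [xy|xy]; last by rewrite mulr_ge0 ?powR_ge0 ?(ltW C0).
  apply: le_trans (GC _ _ xy) _; rewrite ler_wpM2l ?(ltW C0)//.
  by apply: powR_le; rewrite ?(ltW a0) ?enorm_ge0//; have [] := HD _ _ Ox Oy.
have iG x : Om x -> leb.-integrable Om (EFin \o (fun y => offG Om G x y * f y)).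
  move=> Ox; apply/integrableP; split.
    exact: (measurable_offG_integrand HM measurable_off green_ge0 x mf).
  apply: (@le_lt_trans _ _ ((C * D `^ a)%:E * leb Om)%E); last first.
    by rewrite lte_mul_pinfty ?lee_fin ?mulr_ge0 ?powR_ge0 ?(ltW C0)// (md_fin HM).
  apply: integral_nonneg_le_cst => // y Oy.
   rewrite /= !lee_fin normr_ge0/= normrM ger0_norm// -[leRHS]mulr1.
  by apply: ler_pM => //; exact: ogD.
have er : e <= rho by lra.
(* The cube containing x contributes at most c0 / 2 times its volume m, the other one at most -c0 m.
   Tested against f, each cube then gives at most -(c0 / 2) m^2, a negative total. *)
have GP x : P x -> green_op Om G f x <= - (c0 / 2 * m).
  move=> Px; have Ox := PO _ Px.
  rewrite [leLHS](_ : _ = \int[leb]_(y in Om) (offG Om G x y * f y)); last first.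
    exact: (GopE HM measurable_off green_ge0 Ox mf).
  rewrite (_ : - _ = (c0 / 2 + - c0) * m); last by field.
  rewrite -IPQ; apply: le_Rintegral => //; first exact: iG.
  move=> y Oy /=; have [Py|Py] := pselect (P y).
    rewrite /f (fP _ Py).1 (fP _ Py).2 subr0 mulr0 addr0 !mulr1 /offG.
    case: pselect => [xy|xy]; last by rewrite divr_ge0 ?(ltW c00).
    by have [_ _ nxy] := xy; apply: (near x y p) => //; exact: Pe.
  have [Qy|Qy] := pselect (Q y).
    rewrite /f (fQ _ Qy).1 (fQ _ Qy).2 sub0r mulrN1 mulr0 add0r mulr1 lerN2.
    have xy : y <> x by move=> yx; apply: Py; rewrite yx.
    by rewrite offG_neq//; have [] := far x y Ox Oy (Pe _ Px) (Qe _ Qy).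
  by rewrite /f (fN _ Py Qy).1 (fN _ Py Qy).2 subrr !mulr0 addr0.
have GQ x : Q x -> c0 / 2 * m <= green_op Om G f x.
  move=> Qx; have Ox := QO _ Qx.
  rewrite [leRHS](_ : _ = \int[leb]_(y in Om) (offG Om G x y * f y)); last first.
    exact: (GopE HM measurable_off green_ge0 Ox mf).
  rewrite (_ : _ * m = (c0 + - (c0 / 2)) * m); last by field.
  rewrite -IPQ; apply: le_Rintegral => //; first exact: iG.
  move=> y Oy /=; have [Py|Py] := pselect (P y).
    rewrite /f (fP _ Py).1 (fP _ Py).2 subr0 mulr0 addr0 !mulr1.
    have xy : y <> x by move=> yx; have : set0 y by rewrite -PQ; split => //; rewrite yx.
    by rewrite offG_neq//; have [] := far y x Oy Ox (Pe _ Py) (Qe _ Qx).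
  have [Qy|Qy] := pselect (Q y).
    rewrite /f (fQ _ Qy).1 (fQ _ Qy).2 sub0r mulrN1 mulr0 add0r mulr1 lerN2 /offG.
    case: pselect => [xy|xy]; last by rewrite divr_ge0 ?(ltW c00).
    by have [_ _ nxy] := xy; apply: (near x y q) => //; exact: Qe.
  by rewrite /f (fN _ Py Qy).1 (fN _ Py Qy).2 subrr !mulr0 addr0.
have L2G : fmem (Lp Om 2%:E) (green_op Om G f) by exact: CO.1.
have : inner Om (green_op Om G f) f <= - (c0 * m * m).
  rewrite (_ : - _ = (- (c0 / 2 * m) + - (c0 / 2 * m)) * m); last by field.
  rewrite -IPQ; apply: le_Rintegral => //; first exact: (L2_integrable mOm L2G L2f).
  move=> y Oy /=; have [Py|Py] := pselect (P y).
    rewrite /f (fP _ Py).1 (fP _ Py).2 subr0 mulr0 addr0 !mulr1; exact: GP.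
  have [Qy|Qy] := pselect (Q y).
    by rewrite /f (fQ _ Qy).1 (fQ _ Qy).2 sub0r mulrN1 mulr0 add0r mulr1 lerN2; exact: GQ.
  by rewrite /f (fN _ Py Qy).1 (fN _ Py Qy).2 subrr !mulr0 addr0.
have := green_inner_ge0 oOm EB SA CO L2f; have : 0 < c0 * m * m by apply: mulr_gt0 => //; exact: mulr_gt0.
lra.
Qed.

Lemma green_Phi : exists2 C : R, 0 < C &
  forall x y, off_diag Om (x, y) ->
    G x y <= C * Phi (delta Om) edist (n%:R - 2 * s) gamma 1 x y /\
    Phi (delta Om) edist (n%:R - 2 * s) gamma 1 x y <= C * G x y.
Proof.
have HM := row_metric_domain; have [/andP[g0 _] _ Gpos _ [C C0 HC]] := hK1.
pose B := 20 `^ gamma * 20 `^ gamma : R.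
have B0 : 0 < B by rewrite mulr_gt0 ?powR_gt0.
exists (C * (B + 1)); first by rewrite mulr_gt0// addr_gt0.
move=> x y xy; have [Ox Oy nxy] := xy.
have := @Phi1_le_model R E Om (delta Om) edist (md_distC HM) (md_distxx HM) (md_dist_gt0 HM)
  (md_d0 HM) (md_dlip HM) (n%:R - 2 * s) gamma g0 x y Ox Oy nxy.
have := HC x y xy; rewrite /= -/(green_kernel_model Om s gamma x y).
have := Gpos x y xy; have := Phi_ge0 (delta Om) edist (n%:R - 2 * s) gamma 1 x y.
rewrite -/B; move: (green_kernel_model _ _ _ _ _) (Phi _ _ _ _ _ _ _) (G x y) => m p g.
move=> p0 gpos /andP[h1 h2] /andP[h3 h4].
split.
  apply: le_trans h2 _; rewrite -mulrA ler_wpM2l ?(ltW C0)//; apply: le_trans h4 _.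
  by rewrite ler_wpM2r// lerDl.
apply: le_trans h3 _; have h5 : m <= C * g by rewrite -ler_pdivrMl.
apply: le_trans h5 _; rewrite -mulrA ler_wpM2l ?(ltW C0)// ler_peMl ?(ltW gpos)//.
by rewrite lerDr ltW.
Qed.

End euclidean_domain.

(** * Mapping properties *)

Lemma Kint_sym disp (E : measurableType disp) (R : realType)
    (mu : {sigma_finite_measure set E -> \bar R}) (Om : set E) (w : E -> \bar R) (x : E)
    (k : E -> E -> R) : (forall y z, k y z = k z y) ->
  Kint mu Om (fun y x => k x y) w x = Kint mu Om k w x.
Proof. by move=> kC; apply: eq_integral => y _; rewrite kC. Qed.

Section bounded_operators.
Context (R : realType) (n : nat) (Om : set 'rV[R]_n).
Local Notation E := 'rV[R]_n.
Local Notation leb := (lebesgue_row R n).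
Implicit Types (f : E -> R) (T : (E -> R) -> E -> R).

Lemma Lpnorm_oo_le (D : set E) f (c : R) : 0 <= c ->
  (Lpnorm D +oo%E f <= c%:E)%E <-> {ae leb, forall x, D x -> `|f x| <= c}.
Proof.
move=> c0; rewrite /Lpnorm unlock /=; case: ifPn => [_|].
  split.
    move=> /ess_supP; apply: filterS => x /=; rewrite patchE lee_fin => + Dx.
    by rewrite mem_set.
  move=> H; apply/ess_supP; apply: filterS H => x H /=; rewrite patchE lee_fin.
  by case: ifPn => [/set_mem/H//|_]; rewrite normr0.
(* If the whole space had measure 0, the norm would be 0 by definition and every set negligible. *)
rewrite -leNgt => T0; split => [_|_]; last by rewrite lee_fin.
exists setT; split => //; apply/eqP; rewrite eq_le T0/=; exact: measure_ge0.
Qed.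

Lemma Lpnorm_fin (D : set E) p f : (Lpnorm D p f < +oo)%E ->
  exists2 P : R, 0 <= P & Lpnorm D p f = P%:E.
Proof.
move=> Pf; exists (fine (Lpnorm D p f)); first exact/fine_ge0/Lpnorm_ge0.
by rewrite fineK// ge0_fin_numE// Lpnorm_ge0.
Qed.

Lemma le_mul_eps (c P : R) (Q : \bar R) : 0 <= c ->
  (forall t, P < t -> (Q <= (c * t)%:E)%E) -> (Q <= (c * P)%:E)%E.
Proof.
move=> c0 H; apply/lee_addgt0Pr => e e0.
have c1 : 0 < c + 1 by rewrite ltr_wpDl.
apply: le_trans (H (P + e / (c + 1)) _) _; first by rewrite ltrDl divr_gt0.
rewrite -EFinD lee_fin mulrDr lerD2l mulrCA ger_pMr// ler_pdivrMr// mul1r lerDl.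
exact: ler01.
Qed.

(* Replacing the norm of f by positive reals t above it makes it possible to
   rescale by t even when the norm vanishes. *)
Lemma bounded_by_scaled (NX NY : (E -> R) -> \bar R) T (c : R) : 0 <= c ->
  (forall f, (0 <= NX f)%E) ->
  (forall f t, fmem (normed_by Om NX) f -> 0 < t -> (NX f <= t%:E)%E ->
     measurable_fun Om (T f) /\ (NY (T f) <= (c * t)%:E)%E) ->
  bounded_by c (normed_by Om NX) (normed_by Om NY) T.
Proof.
move=> c0 NX0 H f Xf; have [mf ff] := Xf; have f0 := NX0 f; rewrite /= in ff *.
have NXf : NX f = (fine (NX f))%:E by rewrite fineK// ge0_fin_numE.
have P0 : 0 <= fine (NX f) by exact: fine_ge0.
have [|mT NT] := H f (fine (NX f) + 1) Xf (ltr_wpDl P0 ltr01).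
  by rewrite NXf lee_fin lerDl.
split; first by split => //; apply: le_lt_trans NT _; rewrite ltry.
rewrite NXf -EFinM; apply: le_mul_eps => // t Pt.
have t0 : 0 < t := le_lt_trans P0 Pt.
by have [|_] := H f t Xf t0; first by rewrite NXf lee_fin ltW.
Qed.

End bounded_operators.

(** * Global bounds for operators dominated by Phi_1 *)

Section kernel_estimates.
Context (R : realType) (n : nat) (Om : set 'rV[R]_n).
Local Notation E := 'rV[R]_n.
Local Notation leb := (lebesgue_row R n).
Variables (d : E -> R) (dist : E -> E -> R) (kappa : R).
Hypothesis HM : metric_domain leb Om d dist kappa.
Variables (N gamma : R).
Hypotheses (N0 : 0 < N) (Nk : N < kappa) (g0 : 0 < gamma).
Local Notation Phi := (Phi d dist N gamma).
Local Notation Kint := (Kint leb Om).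
Local Notation nonneg_measurable := (nonneg_measurable Om).
Local Notation nnfun := (nnfun Om).
Local Notation riesz := (riesz leb Om dist).
Local Notation "'abs f" := (fun x => `|f x|%:E) (at level 9).
Local Notation wint w := (\int[leb]_(y in Om) ((d y `^ gamma)%:E * w y))%E.
Local Notation pint p w := (\int[leb]_(x in Om) (w x `^ p)%:E)%E.
Implicit Types (f v w : E -> R) (T : (E -> R) -> E -> R).

Let mOm : measurable Om := md_Om HM.
Let hP t : measurable_kernel (Phi t) := measurable_kernel_Phi HM N gamma t.
Let hd := nonneg_measurable_dgamma HM gamma.
Let KintC (w : E -> \bar R) x : Kint (fun y x => Phi 1 x y) w x = Kint (Phi 1) w x.
Proof.
apply: (Kint_sym leb Om w x).
exact: (@PhiC _ _ d dist (md_distC HM) N gamma 1).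
Qed.

Let nabs f : measurable_fun Om f -> nonneg_measurable 'abs f.
Proof. exact: nonneg_measurable_norm. Qed.

Definition in_L1d f := measurable_fun Om f /\ (wint 'abs f < +oo)%E.

(* The only property of the resolvent used for the mapping bounds. *)
Definition green_dominated (K : R) T := forall f, in_L1d f ->
  measurable_fun Om (T f) /\
  {ae leb, forall x, Om x -> (`|T f x|%:E <= K%:E * Kint (Phi 1) 'abs f x)%E}.

Lemma nnfun_abs f : measurable_fun Om f -> nnfun (fun x => `|f x|).
Proof. by move=> mf; split => //; exact: measurableT_comp. Qed.

Lemma Kint_Phi1_riesz w x : nnfun w -> Om x ->
  (Kint (Phi 1) (fun y => (w y)%:E) x <= riesz N w x)%E.
Proof.
move=> [mw w0] Ox; apply: le_integral_nonneg => y Oy.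
  by rewrite mule_ge0 ?lee_fin ?Phi_ge0 ?w0.
apply: lee_wpmul2r; first by rewrite lee_fin w0.
have H := @Phi1_le_riesz _ _ _ _ _ (md_distC HM) (md_distxx HM) (md_dist_gt0 HM) (md_d0 HM) N gamma g0 x y Ox Oy.
rewrite lee_fin; exact: H.
Qed.

Lemma dominated_riesz K T f : 0 < K -> green_dominated K T -> in_L1d f ->
  measurable_fun Om (T f) /\
  {ae leb, forall x, Om x -> (`|T f x|%:E <= riesz N (fun y => (`|f y| * K)%R) x)%E}.
Proof.
move=> K0 hT Lf; have [mT HT] := hT f Lf; split => //; have hf := nnfun_abs Lf.1.
apply: filterS HT => x HT Ox; apply: le_trans (HT Ox) _.
rewrite (rieszZ HM N x (ltW K0) hf); apply: lee_wpmul2l; first by rewrite lee_fin ltW.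
exact: Kint_Phi1_riesz.
Qed.

Let Dg := (sval (cid2 (md_bounded HM))) `^ gamma.
Let Dg0 : 0 <= Dg. Proof. exact: powR_ge0. Qed.

Let dg_le x : Om x -> d x `^ gamma <= Dg.
Proof.
rewrite /Dg; case: cid2 => /= D D0 H Ox; apply: powR_le; rewrite ?(ltW g0)//.
  by rewrite ltW// (md_d0 HM).
by have [] := H _ _ Ox Ox.
Qed.

Lemma wint_le_int f : measurable_fun Om f ->
  (wint 'abs f <= Dg%:E * \int[leb]_(x in Om) `|f x|%:E)%E.
Proof.
move=> mf; have [m1 p1] := nabs mf.
move: Dg Dg0 dg_le => D D0 dD.
apply: (@le_trans _ _ (\int[leb]_(x in Om) (D%:E * `|f x|%:E))%E).
  apply: le_integral_nonneg => x Ox; first by rewrite mule_ge0 ?p1// lee_fin powR_ge0.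
  by apply: lee_wpmul2r; rewrite ?p1// lee_fin dD.
by rewrite ge0_integralZl_EFin.
Qed.

Lemma Lp_in_L1d p f : 1 <= p -> fmem (Lp Om p%:E) f -> in_L1d f.
Proof.
move=> p1 [mf]; have p0 : 0 < p := lt_le_trans ltr01 p1.
move=> /(Lpnorm_lty _ _ p0) pf; split => //.
apply: le_lt_trans (wint_le_int mf) _; rewrite lte_mul_pinfty//.
have [mp pp] := nonneg_measurable_powR p (nnfun_abs mf).1.
(* |f| <= |f|^p + 1, and Om has finite measure. *)
apply: (@le_lt_trans _ _ (\int[leb]_(x in Om) ((`|f x| `^ p)%:E + 1%:E))%E).
  apply: le_integral_nonneg => x Ox; first by rewrite lee_fin.
  rewrite -EFinD lee_fin; have [f1|f1] := leP `|f x| 1.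
    by rewrite ler_wpDl// powR_ge0.
  rewrite ler_wpDr// -[leLHS]powRr1//; exact: ler_powR (ltW f1) _ _ p1.
rewrite ge0_integralD//.
by rewrite lte_add_pinfty// integral_cst// mul1e (md_fin HM).
Qed.

Lemma dominated_L1_Lp p : 1 <= p -> N * p < kappa -> exists2 C : R, 0 <= C &
  forall K T, 0 < K -> green_dominated K T -> bounded_by (C * K) (Lp Om 1%E) (Lp Om p%:E) T.
Proof.
move=> p1 Npk; have [C C0 HC] := riesz_L1_Lp HM N0 p1 Npk; exists C => // K T K0 hT.
have p0 : 0 < p := lt_le_trans ltr01 p1.
apply: bounded_by_scaled; [by rewrite mulr_ge0// ltW|by move=> f; exact: Lpnorm_ge0|].
move=> f t Xf t0 ft; have Lf := Lp_in_L1d (lexx 1) Xf; have [mf _] := Lf.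
have [mT HT] := dominated_riesz K0 hT Lf; split => //.
rewrite Lpnorm1E in ft.
have hf := nnfun_abs mf; have hw := nnfunZ (ltW K0) hf.
apply/(Lpnorm_le_cst _ _ p0); first by rewrite !mulr_ge0// ltW.
rewrite -mulrA; apply: (HC _ _ _ _ hw mT _ HT); first exact: mulr_gt0.
have -> : (\int[leb]_(x in Om) (`|f x| * K)%:E = K%:E * \int[leb]_(x in Om) (`|f x|)%:E)%E.
  have [m1 q1] := nabs mf; rewrite -ge0_integralZl ?lee_fin ?(ltW K0)//.
  by apply: eq_integral => x _; rewrite -EFinM mulrC.
by rewrite EFinM; apply: lee_wpmul2l => //; rewrite lee_fin ltW.
Qed.

Let scaled_pint p f K t : 0 < p -> 0 < K -> 0 < t -> measurable_fun Om f ->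
  (Lpnorm Om p%:E f <= t%:E)%E -> (pint p (fun x => `|f x| * K) <= ((K * t) `^ p)%:E)%E.
Proof.
move=> p0 K0 t0 mf /(Lpnorm_le_cst _ _ p0 (ltW t0)) H.
rewrite (pintZ HM p (ltW K0) (nnfun_abs mf)) powRM ?(ltW K0) ?(ltW t0)// EFinM.
by apply: lee_wpmul2l => //; rewrite lee_fin powR_ge0.
Qed.

Lemma dominated_hls p q : 1 < p -> p < kappa / (kappa - N) ->
  q^-1 = p^-1 - (kappa - N) / kappa -> exists2 C : R, 0 <= C &
  forall K T, 0 < K -> green_dominated K T -> bounded_by (C * K) (Lp Om p%:E) (Lp Om q%:E) T.
Proof.
move=> p1 pk qE; have [C C0 HC] := riesz_hls HM N0 Nk p1 pk qE; exists C => // K T K0 hT.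
have p0 : 0 < p := lt_trans ltr01 p1.
have q0 : 0 < q.
  have k0 := md_kappa HM; have b0 : 0 < kappa - N by rewrite subr_gt0.
  rewrite -invr_gt0 qE subr_gt0 -[ltLHS]invrK ltf_pV2 ?posrE ?invr_gt0// ?divr_gt0//.
  by rewrite invf_div.
apply: bounded_by_scaled; [by rewrite mulr_ge0// ltW|by move=> f; exact: Lpnorm_ge0|].
move=> f t Xf t0 ft; have Lf := Lp_in_L1d (ltW p1) Xf; have [mf _] := Lf.
have [mT HT] := dominated_riesz K0 hT Lf; split => //.
have hw := nnfunZ (ltW K0) (nnfun_abs mf).
apply/(Lpnorm_le_cst _ _ q0); first by rewrite !mulr_ge0// ltW.
rewrite -mulrA; apply: (HC _ _ _ _ hw mT _ HT); first exact: mulr_gt0.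
exact: scaled_pint.
Qed.

Lemma dominated_Lq_Linf q : 1 < q -> kappa < (kappa - N) * q -> exists2 C : R, 0 <= C &
  forall K T, 0 < K -> green_dominated K T -> bounded_by (C * K) (Lp Om q%:E) (Lp Om +oo%E) T.
Proof.
move=> q1 kq; have [C C0 HC] := riesz_Lq_Linf HM N0 q1 kq; exists C => // K T K0 hT.
have q0 : 0 < q := lt_trans ltr01 q1.
apply: bounded_by_scaled; [by rewrite mulr_ge0// ltW|by move=> f; exact: Lpnorm_ge0|].
move=> f t Xf t0 ft; have Lf := Lp_in_L1d (ltW q1) Xf; have [mf _] := Lf.
have [mT HT] := dominated_riesz K0 hT Lf; split => //.
have hw := nnfunZ (ltW K0) (nnfun_abs mf).
apply/Lpnorm_oo_le; first by rewrite !mulr_ge0// ltW.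
apply: filterS HT => x HT Ox; rewrite -lee_fin; apply: le_trans (HT Ox) _.
rewrite -mulrA; apply: (HC _ _ _ _ hw _ Ox); first exact: mulr_gt0.
exact: scaled_pint.
Qed.

Hypothesis strip : exists2 C : R, 0 <= C &
  forall t, 0 < t -> (leb (Om `&` [set x | (d x < t)%R]) <= (C * t)%:E)%E.

Let nw a : nnfun (fun x => d x `^ a).
Proof. by split => [|x _]; [apply/measurable_EFinP; exact: (nonneg_measurable_dgamma HM a).1|exact: powR_ge0]. Qed.

(** The integrand is δ^(γ+a). For γ + a >= 0 it is bounded; otherwise the strips of volume O(t) are
    a growth bound of exponent 1, and γ + a > -1 is the condition for integrability near the
    boundary. *)
Lemma weight_lty a : - 1 - gamma < a -> (wint (fun x => (d x `^ a)%:E) < +oo)%E.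
Proof.
move=> a1; have e x : Om x -> ((d x `^ gamma)%:E * (d x `^ a)%:E = (d x `^ (gamma + a))%:E)%E.
  by move=> Ox; rewrite -EFinM -powRDp// (md_d0 HM).
rewrite (eq_integral (fun x => (d x `^ (gamma + a))%:E)); last by move=> x /set_mem; exact: e.
have [D D0 HD] := md_bounded HM.
have [ga|ga] := leP 0 (gamma + a).
  apply: (@le_lt_trans _ _ ((D `^ (gamma + a))%:E * leb Om)%E); last first.
    by rewrite lte_mul_pinfty ?lee_fin ?powR_ge0// (md_fin HM).
  apply: integral_nonneg_le_cst => // x Ox; rewrite lee_fin powR_ge0 lee_fin.
  by apply: powR_le => //; [exact/ltW/(md_d0 HM)|have [] := HD _ _ Ox Ox].
have [A A0 HA] := strip.
have [|C C0 HC] := integral_powR_near leb A0 (kappa := 1) (rho := - (gamma + a)).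
  by rewrite oppr_gt0 ga/=; lra.
have := HC Om d mOm (measurable_funTS (md_d HM)) (fun x Ox => ltW (md_d0 HM Ox)).
move=> /(_ _ (D + 1) _); rewrite opprK (_ : Om `&` _ = Om); last first.
  by apply/seteqP; split => [x []//|x Ox]; split => //=; have [_] := HD _ _ Ox Ox; lra.
move=> H; apply: le_lt_trans (H _ _) (ltry _); last by lra.
by move=> t t0; rewrite powRr1 ?(ltW t0)//; exact: HA.
Qed.

Variables (G : E -> E -> R) (CG : R).
Hypotheses
  (mG : measurable_fun (off_diag Om) (fun z => G z.1 z.2))
  (CG0 : 0 < CG)
  (G_ge0 : forall x y, off_diag Om (x, y) -> 0 <= G x y)
  (GC : forall x y, off_diag Om (x, y) ->
     G x y <= CG * Phi 1 x y)
  (CGP : forall x y, off_diag Om (x, y) ->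
     Phi 1 x y <= CG * G x y).
Local Notation G0 := (green_op Om G).

Lemma green_op_ge0 w x : nnfun w -> Om x -> 0 <= G0 w x.
Proof.
move=> [mw w0] Ox; rewrite [leRHS](GopE HM mG G_ge0 Ox mw).
apply: Rintegral_ge0 => y Oy; rewrite mulr_ge0 ?w0//.
exact: (measurable_kernel_offG HM mG G_ge0).2.
Qed.

(** The lower bound of (K1), integrated. It is stated a.e. because the real-valued Green integral is
    0 by convention where it diverges; a finite weighted integral confines this to a null set. *)
Lemma Kint_Phi1_le_green w : nnfun w -> (wint (fun x => (w x)%:E) < +oo)%E ->
  {ae leb, forall x, Om x -> (Kint (Phi 1) (fun y => (w y)%:E) x <= (CG * G0 w x)%:E)%E}.
Proof.
move=> hw wf; have [mw w0] := hw.
have wabs x : Om x -> `|w x| = w x by move=> Ox; rewrite ger0_norm ?w0.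
apply: filterS (Kint_Phi1_ae_fin HM N0 Nk g0 (nnfunE hw) wf) => x Kf Ox; have {}Kf := Kf Ox.
have Kabs : (Kint (Phi 1) 'abs w x < +oo)%E.
  apply: le_lt_trans Kf; rewrite /Kint; apply: le_integral_nonneg => y Oy.
    by rewrite mule_ge0 ?lee_fin ?Phi_ge0.
  by rewrite wabs.
have iw := Gop_integrable HM mG CG0 G_ge0 GC Ox mw Kabs.
have -> : G0 w x = \int[leb]_(y in Om) (offG Om G x y * w y).
  exact: (GopE HM mG G_ge0 Ox mw).
have hO := measurable_kernel_offG HM mG G_ge0.
rewrite EFinM /Rintegral fineK; last exact: integrable_fin_num.
have mO := measurable_offG_integrand HM mG G_ge0 x mw.
have O0 y : Om y -> (0 <= (offG Om G x y * w y)%:E)%E.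
  by move=> Oy; rewrite lee_fin mulr_ge0 ?w0// hO.2.
rewrite -ge0_integralZl ?lee_fin ?(ltW CG0)//; apply: ae_le_integral_nonneg => //.
- exact: measurable_funeM.
- by move=> y Oy; rewrite mule_ge0 ?lee_fin ?Phi_ge0 ?w0.
- by move=> y Oy; apply: mule_ge0; [rewrite lee_fin ltW|exact: O0].
apply: filterS (ae_neq (md_set1 HM) (md_mu1 HM) x) => y yx Oy.
rewrite -!EFinM lee_fin mulrA ler_wpM2r ?w0// offG_neq//.
by apply: CGP; split => //; exact/nesym.
Qed.

(** A bound of Hopf type: the rank-one kernel Phi_0 lies below a multiple of Phi_1, hence of the
    Green function. It embeds L^1 with the weight G0(δ^a) into L^1(Ω;δ^γ), where the resolvent is
    defined. *)
Lemma green_weight_lower a : - 1 - gamma < a -> exists2 c : R, 0 <= c &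
  {ae leb, forall x, Om x -> d x `^ gamma <= c * G0 (fun x => d x `^ a) x}.
Proof.
move=> a1; have Wf := weight_lty a1.
have hw := nw a; have hw' := nnfunE hw; have [mdw dw0] := nonneg_measurableM hd hw'.
have W0 : (0 <= wint (fun x => (d x `^ a)%:E))%E by apply: integral_ge0.
have [W WE] : exists W : R, wint (fun x => (d x `^ a)%:E) = W%:E.
  by exists (fine (wint (fun x => (d x `^ a)%:E))); rewrite fineK// ge0_fin_numE.
rewrite WE lee_fin in W0; move: W0; rewrite le_eqVlt => /orP[/eqP W0|W0].
  (* The integrand is positive on Om, so a vanishing integral makes Om a null set, and any constant
     will do. *)
  exists 0 => //; rewrite -W0 in WE.
  have : (\int[leb]_(x in Om) `|(d x `^ gamma)%:E * (d x `^ a)%:E| = 0)%E.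
    rewrite (_ : 0%E = 0%:E)// -WE.
    by apply: eq_integral => x /set_mem Ox; rewrite gee0_abs// dw0.
  move=> /(ae_eq_integral_abs leb mOm mdw); apply: filterS => x /= H Ox.
  have := H Ox; have dx := md_d0 HM Ox; rewrite -EFinM => -[] /eqP.
  by rewrite gt_eqF// mulr_gt0// powR_gt0.
have [C C0 HC] := Kint_Phi0_le HM N0 g0.
exists (C * CG / W); first by rewrite divr_ge0 ?(ltW W0)// mulr_ge0 ?(ltW C0)// ltW.
apply: filterS (Kint_Phi1_le_green hw Wf) => x H Ox.
have := HC _ x hw' Ox; rewrite (Kint_Phi0E HM N gamma x hw') WE -EFinM => H'.
have := le_trans H' (lee_wpmul2l _ (H Ox)); rewrite lee_fin (ltW C0) => /(_ isT).
rewrite -EFinM lee_fin => H3.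
by rewrite mulrAC ler_pdivlMr// -mulrA.
Qed.

(** By Tonelli and symmetry of the kernel, the integral of δ^a Phi_1 |f| equals that of |f| Phi_1
    δ^a, and Phi_1 δ^a <= CG G0(δ^a) a.e. *)
Lemma dominated_weight_L1 a : - 1 - gamma < a -> exists2 C : R, 0 <= C &
  forall K T, 0 < K -> green_dominated K T ->
  bounded_by (C * K) (L1w Om (G0 (fun x => d x `^ a))) (L1w Om (fun x => d x `^ a)) T.
Proof.
move=> a1; have hw := nw a; have Wf := weight_lty a1; set wa := fun x => d x `^ a in hw Wf *.
have [c c0 Hc] := green_weight_lower a1.
exists CG; first exact: ltW.
move=> K T K0 hT; have G0w x := @green_op_ge0 wa x hw.
have mGw : measurable_fun Om (G0 wa) by exact: (measurable_Gop HM mG G_ge0 hw.1).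
apply: bounded_by_scaled; [by rewrite mulr_ge0// ltW|by move=> f; exact: Lpnorm_ge0|].
move=> f t [mf ff] t0 ft; rewrite Lpnorm1E in ft.
have nf := nabs mf.
have fG : (\int[leb]_(x in Om) (`|f x|%:E * (G0 wa x)%:E) <= t%:E)%E.
  apply: le_trans ft; apply: le_integral_nonneg => x Ox.
    by rewrite mule_ge0 ?lee_fin ?G0w.
  by rewrite -EFinM lee_fin normrM (ger0_norm (G0w _ Ox)).
have nG : nonneg_measurable (fun x => (G0 wa x)%:E).
  by split; [exact/measurable_EFinP|move=> x Ox; rewrite lee_fin G0w].
have [mfG fG0] := nonneg_measurableM nf nG.
have Lf : in_L1d f.
  split => //; apply: (@le_lt_trans _ _ (c%:E * \int[leb]_(x in Om) (`|f x|%:E * (G0 wa x)%:E))%E).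
    rewrite -ge0_integralZl//; apply: ae_le_integral_nonneg => //.
    - exact: measurable_funeM.
    - by move=> x Ox; rewrite mule_ge0 ?lee_fin ?powR_ge0.
    - by move=> x Ox; apply: mule_ge0; [rewrite lee_fin|exact: fG0].
    apply: filterS Hc => x Hc Ox; rewrite -!EFinM lee_fin mulrCA mulrC ler_wpM2l//.
    exact: Hc.
  by rewrite lte_mul_pinfty//; apply: le_lt_trans fG _; rewrite ltry.
have [mT HT] := hT f Lf; split => //; rewrite Lpnorm1E.
have hK := Kint_nonneg leb mOm (hP 1) nf.
have nw' := nnfunE hw; have [mwK wK0] := nonneg_measurableM nw' hK.
apply: (@le_trans _ _ (\int[leb]_(x in Om) (K%:E * ((wa x)%:E * Kint (Phi 1) 'abs f x)))%E).
  apply: ae_le_integral_nonneg => //.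
  - exact: measurable_funeM.
  - by move=> x Ox; rewrite mule_ge0 ?lee_fin ?(ltW K0)// wK0.
  apply: filterS HT => x HT Ox; rewrite normrM (ger0_norm (hw.2 _ Ox)) mulrC EFinM muleCA.
  by apply: lee_wpmul2l; [rewrite lee_fin hw.2|exact: HT].
rewrite ge0_integralZl ?lee_fin ?(ltW K0)//.
rewrite [leRHS](_ : _ = (K%:E * (CG * t)%:E)%E); last by rewrite -EFinM; congr EFin; ring.
apply: lee_wpmul2l; first by rewrite lee_fin ltW.
rewrite (@Kint_dual _ _ _ leb Om mOm _ _ _ (hP 1) nf nw').
apply: (@le_trans _ _ (\int[leb]_(y in Om) (CG%:E * (`|f y|%:E * (G0 wa y)%:E)))%E).
  apply: ae_le_integral_nonneg => //.
  - exact: measurable_funeM.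
  - move=> y Oy; rewrite mule_ge0 ?lee_fin//; apply: integral_ge0 => x Ox.
    by rewrite mule_ge0 ?lee_fin ?Phi_ge0 ?powR_ge0.
  - by move=> y Oy; apply: mule_ge0; [rewrite lee_fin ltW|exact: fG0].
  apply: filterS (Kint_Phi1_le_green hw Wf) => y H Oy; rewrite muleCA.
  apply: lee_wpmul2l; first by rewrite lee_fin.
  rewrite -EFinM; apply: le_trans (H Oy); rewrite le_eqVlt; apply/orP; left; apply/eqP.
  exact: KintC.
rewrite ge0_integralZl ?lee_fin ?(ltW CG0)// EFinM.
by apply: lee_wpmul2l => //; rewrite lee_fin ltW.
Qed.

(** Dual to the previous bound: |f| <= t δ^a passes through the positive kernel, and Phi_1 δ^a is
    again replaced by G0(δ^a). The datum lies in L^1(Ω;δ^γ) by [weight_lty]. *)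
Lemma dominated_weight_Linf a : - 1 - gamma < a -> exists2 C : R, 0 <= C &
  forall K T, 0 < K -> green_dominated K T ->
  bounded_by (C * K) (wLinf Om (fun x => d x `^ a)) (wLinf Om (G0 (fun x => d x `^ a))) T.
Proof.
move=> a1; have hw := nw a; have Wf := weight_lty a1; set wa := fun x => d x `^ a in hw Wf *.
exists CG; first exact: ltW.
move=> K T K0 hT; have G0w x := @green_op_ge0 wa x hw.
have nw' := nnfunE hw; have [mdw dw0] := nonneg_measurableM hd nw'.
apply: bounded_by_scaled; [by rewrite mulr_ge0// ltW|by move=> f; exact: Lpnorm_ge0|].
move=> f t [mf ff] t0 /(Lpnorm_oo_le _ _ (ltW t0)) ft; have nf := nabs mf.
have tw : nonneg_measurable (fun y => t%:E * (wa y)%:E)%E.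
  by apply: nonneg_measurableZ => //; exact: ltW.
have {}ft : {ae leb, forall x, Om x -> (`|f x|%:E <= t%:E * (wa x)%:E)%E}.
  apply: filterS ft => x ft Ox; have w0 : 0 < wa x by rewrite powR_gt0// (md_d0 HM).
  have := ft Ox; rewrite normrM (gtr0_norm (_ : 0 < (wa x)^-1)) ?invr_gt0// ler_pdivrMr//.
have Lf : in_L1d f.
  split => //; apply: (@le_lt_trans _ _ (t%:E * wint (fun x => (wa x)%:E))%E); last first.
    by rewrite lte_mul_pinfty// lee_fin ltW.
  rewrite -ge0_integralZl ?lee_fin ?(ltW t0)//; apply: ae_le_integral_nonneg => //.
  - exact: measurable_funeM.
  - by move=> x Ox; rewrite mule_ge0 ?lee_fin ?powR_ge0.
  - by move=> x Ox; apply: mule_ge0; [rewrite lee_fin ltW|exact: dw0].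
  apply: filterS ft => x ft Ox; rewrite muleCA; apply: lee_wpmul2l; rewrite ?lee_fin ?powR_ge0//.
  exact: ft.
have [mT HT] := hT f Lf; split => //.
apply/Lpnorm_oo_le; first by rewrite !mulr_ge0// ltW.
apply: filterS2 HT (Kint_Phi1_le_green hw Wf) => x HT HK Ox.
have H : `|T f x| <= CG * K * t * G0 wa x.
  rewrite -lee_fin; apply: le_trans (HT Ox) _.
  have := @Kint_le _ _ _ leb Om mOm _ _ _ x (hP 1) nf tw ft.
  rewrite (@KintZ _ _ _ leb Om mOm _ _ x _ (hP 1) nw' (ltW t0)) => H.
  apply: le_trans (lee_wpmul2l _ (le_trans H (lee_wpmul2l _ (HK Ox)))) _.
  - by rewrite lee_fin ltW.
  - by rewrite lee_fin ltW.
  by rewrite -!EFinM lee_fin le_eqVlt; apply/orP; left; apply/eqP; ring.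
(* Where [G0 wa] vanishes the quotient is 0, since the inverse of 0 is 0. *)
have := G0w x Ox; rewrite le_eqVlt => /orP[/eqP <-|gw0].
  by rewrite invr0 mulr0 normr0 !mulr_ge0// ltW.
by rewrite normrM (gtr0_norm (_ : 0 < (G0 wa x)^-1)) ?invr_gt0// ler_pdivrMr.
Qed.

End kernel_estimates.

(** * Interior estimates on a set K away from the boundary *)

Section local_estimates.
Context (R : realType) (n : nat) (Om : set 'rV[R]_n).
Local Notation E := 'rV[R]_n.
Local Notation leb := (lebesgue_row R n).
Variables (d : E -> R) (dist : E -> E -> R) (kappa : R).
Hypothesis HM : metric_domain leb Om d dist kappa.
Variables (N gamma : R).
Hypotheses (N0 : 0 < N) (Nk : N < kappa) (g0 : 0 < gamma).
Local Notation Phi := (Phi d dist N gamma).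
Local Notation Kint := (Kint leb Om).
Local Notation nonneg_measurable := (nonneg_measurable Om).
Local Notation nnfun := (nnfun Om).
Local Notation riesz := (riesz leb Om dist).
Local Notation "'abs f" := (fun x => `|f x|%:E) (at level 9).
Local Notation wint w := (\int[leb]_(y in Om) ((d y `^ gamma)%:E * w y))%E.
Local Notation pint p w := (\int[leb]_(x in Om) (w x `^ p)%:E)%E.
Local Notation in_L1d := (in_L1d Om d gamma).
Local Notation green_dominated := (green_dominated Om d dist N gamma).
Implicit Types (f v w : E -> R) (T : (E -> R) -> E -> R).

Let mOm : measurable Om := md_Om HM.
Let hd := nonneg_measurable_dgamma HM gamma.

Lemma Phi1_le_compact (c : R) x y : 0 < c -> Om x -> Om y -> c <= d x ->
  Phi 1 x y <= c `^ (- gamma) * (d y `^ gamma * dist x y `^ (- N)).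
Proof.
move=> c0 Ox Oy cx.
have H := @Phi1_le_ratio _ _ _ _ _ (md_distxx HM) (md_dist_gt0 HM) (md_d0 HM) N gamma g0 x y Ox Oy.
have cg : c `^ gamma <= d x `^ gamma by apply: powR_le; rewrite ?(ltW g0) ?(ltW c0).
have cg0 : 0 < c `^ gamma by exact: powR_gt0.
rewrite powRN ler_pdivlMl//; apply: le_trans H.
by rewrite ler_wpM2r// Phi_ge0.
Qed.

Lemma pint_patch (D : set E) p f : 0 < p -> measurable D -> D `<=` Om ->
  pint p ((fun y => `|f y|) \_ D) = (\int[leb]_(x in D) (`|f x| `^ p)%:E)%E.
Proof.
move=> p0 mD DO; rewrite -[in RHS](setIidr DO) integral_mkcondr.
apply: eq_integral => x _; rewrite !patchE; case: ifPn => // _.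
by rewrite powR0// gt_eqF.
Qed.

Lemma nnfun_patch (D : set E) f : measurable D -> measurable_fun Om f ->
  nnfun ((fun y => `|f y|) \_ D).
Proof.
move=> mD mf; split; last by move=> x _; rewrite patchE; case: ifPn.
apply/(measurable_restrict (fun y => `|f y|)) => //.
by apply: measurable_funS (measurableT_comp _ mf) => //; exact: subIsetl.
Qed.

Variables (K : set E) (c : R).
Hypotheses (mK : measurable K) (KO : K `<=` Om) (c0 : 0 < c) (Kc : forall x, K x -> c <= d x).

Lemma Lpnorm_restrict p f (t : R) : 0 < p -> 0 <= t ->
  (pint p (fun x => `|(f \_ K) x|) <= (t `^ p)%:E)%E -> (Lpnorm K p%:E f <= t%:E)%E.
Proof.
move=> p0 t0 H; apply/(Lpnorm_le_cst _ _ p0 t0); apply: le_trans H.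
rewrite -(pint_patch f p0 mK KO); apply: le_integral_nonneg => x Ox.
  by rewrite lee_fin powR_ge0.
by rewrite !patchE; case: ifPn => // _; rewrite normr0.
Qed.

(** On K the distance δ(x) is at least c, so the weight can be moved to y: there |T f| is at most a
    Riesz potential of δ^γ |f|, which is integrable. [riesz_L1_Lp] is applied to T f cut off outside
    K. *)
Lemma local_L1_Lp B T p : 0 < B -> green_dominated B T -> 1 <= p -> N * p < kappa ->
  exists2 C : R, 0 <= C & forall f t, in_L1d f -> 0 < t -> (wint 'abs f <= t%:E)%E ->
    (Lpnorm K p%:E (T f) <= (C * t)%:E)%E.
Proof.
move=> B0 hT p1 Npk; have [C C0 HC] := riesz_L1_Lp HM N0 p1 Npk.
have p0 : 0 < p := lt_le_trans ltr01 p1.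
pose b := B * c `^ (- gamma); have b0 : 0 < b by rewrite mulr_gt0// powR_gt0.
exists (C * b); first by rewrite mulr_ge0// ltW.
move=> f t Lf t0 ft; have [mf ff] := Lf; have [mT HT] := hT f Lf.
have Cbt : 0 <= C * b * t := mulr_ge0 (mulr_ge0 C0 (ltW b0)) (ltW t0).
apply: (Lpnorm_restrict p0 Cbt).
pose w y := d y `^ gamma * `|f y|.
have hw' : nnfun w.
  split; last by move=> y _; rewrite mulr_ge0 ?powR_ge0.
  apply: measurable_funM; last exact: measurableT_comp.
  by apply/measurable_EFinP; exact: hd.1.
have hw := nnfunZ (ltW b0) hw'.
have mv : measurable_fun Om (T f \_ K).
  by apply/(measurable_restrict (T f)) => //; apply: measurable_funS mT => //; exact: subIsetl.
rewrite -mulrA; apply: (HC (b * t) (fun y => w y * b) (T f \_ K)) => //; first exact: mulr_gt0.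
  have -> : (\int[leb]_(x in Om) (w x * b)%:E = b%:E * wint 'abs f)%E.
    have [mdf df0] := nonneg_measurableM hd (nonneg_measurable_norm mf).
    rewrite -ge0_integralZl_EFin ?(ltW b0)//; apply: eq_integral => x _.
    by rewrite -!EFinM mulrC.
  by rewrite [leRHS]EFinM; apply: lee_wpmul2l => //; rewrite lee_fin ltW.
apply: filterS HT => x HT Ox; rewrite patchE; case: ifPn => [/set_mem Kx|_]; last first.
  by rewrite normr0; exact: (riesz_nonneg HM N hw).2.
apply: le_trans (HT Ox) _; rewrite (rieszZ HM N x (ltW b0) hw') EFinM -muleA.
apply: lee_wpmul2l; first by rewrite lee_fin ltW.
have mR := measurable_Kint_integrand x (measurable_kernel_dist HM (- N)) (nnfunE hw').1.
rewrite /riesz -ge0_integralZl_EFin ?powR_ge0//; last first.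
  by move=> y Oy; rewrite -EFinM lee_fin !mulr_ge0 ?powR_ge0.
apply: le_integral_nonneg => y Oy; first by rewrite mule_ge0 ?lee_fin ?Phi_ge0.
rewrite -!EFinM lee_fin /w mulrA -mulrA; apply: le_trans (ler_wpM2r (normr_ge0 _) _) _.
  exact: (Phi1_le_compact c0 Ox Oy (Kc Kx)).
by rewrite le_eqVlt; apply/orP; left; apply/eqP; move: (dist x y `^ _) (d y `^ _) `|f y| (c `^ _) => *; ring.
Qed.

Variables (K0 : set E) (e : R).
Hypotheses (mK0 : measurable K0) (K0O : K0 `<=` Om) (e0 : 0 < e)
  (KK0 : forall x y, K x -> dist x y < e -> K0 y).

Let b := c `^ (- gamma) * e `^ (- N).
Let b0 : 0 <= b. Proof. by rewrite mulr_ge0// powR_ge0. Qed.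

(** For y in K0 the Riesz bound is used. Any other y in Om is at distance at least e from x, so the
    kernel is at most b δ(y)^γ and only the weighted norm of f matters. *)
Lemma Kint_Phi1_split f x : K x -> measurable_fun Om f ->
  (Kint (Phi 1) 'abs f x <= riesz N ((fun y => `|f y|) \_ K0)%R x + b%:E * wint 'abs f)%E.
Proof.
move=> Kx mf; have Ox := KO Kx; have hf0 := nnfun_patch mK0 mf.
have [mdf df0] := nonneg_measurableM hd (nonneg_measurable_norm mf).
rewrite -ge0_integralZl_EFin// /riesz.
have mR := measurable_Kint_integrand x (measurable_kernel_dist HM (- N)) (nnfunE hf0).1.
have R0 y : Om y -> (0 <= (dist x y `^ (- N))%:E * (((fun y => `|f y|) \_ K0) y)%:E)%E.
  by move=> Oy; rewrite mule_ge0 ?lee_fin ?powR_ge0// hf0.2.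
have B0 y : Om y -> (0 <= b%:E * ((d y `^ gamma)%:E * `|f y|%:E))%E.
  by move=> Oy; rewrite mule_ge0 ?lee_fin//; exact: df0.
rewrite -ge0_integralD//; last exact: measurable_funeM.
apply: le_integral_nonneg => y Oy; first by rewrite mule_ge0 ?lee_fin ?Phi_ge0.
have [K0y|K0y] := pselect (K0 y).
  apply: (@le_trans _ _ ((dist x y `^ (- N))%:E * (((fun y => `|f y|) \_ K0) y)%:E)%E); last first.
    by rewrite leeDl// B0.
  rewrite patchE mem_set// -!EFinM lee_fin ler_wpM2r//.
  exact: (@Phi1_le_riesz _ _ _ _ _ (md_distC HM) (md_distxx HM) (md_dist_gt0 HM) (md_d0 HM) N gamma g0 x y Ox Oy).
apply: (@le_trans _ _ (b%:E * ((d y `^ gamma)%:E * `|f y|%:E))%E); last first.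
  by rewrite leeDr// R0.
rewrite -!EFinM lee_fin mulrA ler_wpM2r//.
apply: le_trans (Phi1_le_compact c0 Ox Oy (Kc Kx)) _.
have xye : e <= dist x y by rewrite leNgt; apply/negP => /(KK0 Kx).
have h := powRN_le (ltW N0) e0 xye.
rewrite /b -mulrA ler_wpM2l ?powR_ge0// mulrC ler_wpM2r ?powR_ge0//.
Qed.

Lemma local_bound B T f : 0 < B -> green_dominated B T -> in_L1d f ->
  {ae leb, forall x, K x -> (`|T f x|%:E <=
     riesz N (fun y => (((fun y => `|f y|) \_ K0) y * B)%R) x + (B * b)%:E * wint 'abs f)%E}.
Proof.
move=> B0 hT Lf; have [mf ff] := Lf; have [mT HT] := hT f Lf.
apply: filterS HT => x HT Kx; apply: le_trans (HT (KO Kx)) _.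
rewrite (rieszZ HM N x (ltW B0) (nnfun_patch mK0 mf)) EFinM -muleA.
have R0 := (riesz_nonneg HM N (nnfun_patch mK0 mf)).2 x (KO Kx).
have [mdf df0] := nonneg_measurableM hd (nonneg_measurable_norm mf).
have W0 : (0 <= b%:E * wint 'abs f)%E by rewrite mule_ge0 ?lee_fin//; exact: integral_ge0.
rewrite -ge0_muleDr//; apply: lee_wpmul2l; first by rewrite lee_fin ltW.
exact: Kint_Phi1_split.
Qed.

Lemma local_Lq_Linf B T q : 0 < B -> green_dominated B T -> 1 < q ->
  kappa < (kappa - N) * q ->
  exists2 C : R, 0 <= C & forall f t, in_L1d f -> 0 < t -> (wint 'abs f <= t%:E)%E ->
    (Lpnorm K0 q%:E f <= t%:E)%E -> (Lpnorm K +oo%E (T f) <= (C * t)%:E)%E.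
Proof.
move=> B0 hT q1 kq; have [C C0 HC] := riesz_Lq_Linf HM N0 q1 kq.
have q0 : 0 < q := lt_trans ltr01 q1.
exists (C * B + B * b); first by rewrite addr_ge0// mulr_ge0// ltW.
move=> f t Lf t0 ft fq; have [mf _] := Lf.
have hf0 := nnfun_patch mK0 mf.
apply/Lpnorm_oo_le; first by rewrite mulr_ge0 ?(ltW t0)// addr_ge0// mulr_ge0// ltW.
apply: filterS (local_bound B0 hT Lf) => x H Kx; rewrite -lee_fin; apply: le_trans (H Kx) _.
rewrite mulrDl EFinD; apply: leeD.
  rewrite -mulrA; apply: (HC _ _ x _ (nnfunZ (ltW B0) hf0) _ (KO Kx)); first exact: mulr_gt0.
  rewrite (pintZ HM q (ltW B0) hf0) powRM ?(ltW B0) ?(ltW t0)// EFinM.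
  apply: lee_wpmul2l; first by rewrite lee_fin powR_ge0.
  by rewrite pint_patch//; exact: ((Lpnorm_le_cst _ _ q0 (ltW t0)).1 fq).
rewrite [leRHS]EFinM; apply: lee_wpmul2l => //.
by rewrite lee_fin mulr_ge0// ltW.
Qed.

(** Here the constant precedes B and T, because the final interior estimate has to be uniform in λ,
    which enters only through B. *)
Lemma local_Linf : exists2 C : R, 0 <= C & forall B T f t,
    0 < B -> green_dominated B T -> in_L1d f -> 0 < t -> (wint 'abs f <= t%:E)%E ->
    {ae leb, forall x, K0 x -> `|f x| <= t} -> (Lpnorm K +oo%E (T f) <= (C * B * t)%:E)%E.
Proof.
have [|C C0 HC] := riesz_bound HM (e := N); first by rewrite N0.
exists (C + b); first by rewrite addr_ge0.
move=> B T f t B0 hT Lf t0 ft fK0; have [mf _] := Lf.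
have hf0 := nnfun_patch mK0 mf.
apply/Lpnorm_oo_le; first by rewrite !mulr_ge0 ?(ltW t0) ?(ltW B0)// addr_ge0.
apply: filterS (local_bound B0 hT Lf) => x H Kx; rewrite -lee_fin; apply: le_trans (H Kx) _.
rewrite -mulrA mulrDl EFinD; apply: leeD; last first.
  have -> : (b * (B * t))%:E = ((B * b)%:E * t%:E)%E by rewrite -EFinM mulrCA mulrA.
  apply: lee_wpmul2l => //.
  by rewrite lee_fin mulr_ge0// ltW.
rewrite (rieszZ HM N x (ltW B0) hf0) mulrCA EFinM.
apply: lee_wpmul2l; first by rewrite lee_fin ltW.
have [mR R0] := nonneg_measurable_powR (- N) (measurable_dist HM x).
apply: (@le_trans _ _ (\int[leb]_(y in Om) (t%:E * (dist x y `^ (- N))%:E))%E); last first.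
  rewrite ge0_integralZl_EFin ?(ltW t0)// mulrC EFinM; apply: lee_wpmul2l.
    by rewrite lee_fin ltW.
  exact/HC/KO.
apply: ae_le_integral_nonneg => //.
- exact: measurable_funeM.
- by move=> y Oy; rewrite mule_ge0 ?lee_fin ?powR_ge0// hf0.2.
- by move=> y Oy; rewrite mule_ge0 ?lee_fin ?powR_ge0// ltW.
apply: filterS fK0 => y fK0 Oy; rewrite muleC; apply: lee_wpmul2r.
  by rewrite lee_fin powR_ge0.
rewrite lee_fin patchE; case: ifPn => [/set_mem/fK0//|_]; exact: ltW.
Qed.

(** On K, |T f| is at most a Riesz potential plus the constant u coming from the far part. The
    excess of |T f| over u is dominated by the potential alone, so [riesz_hls] applies to it; u is
    added back using that Om has finite measure. *)
Lemma local_hls B T p q : 0 < B -> green_dominated B T -> 1 < p -> p < kappa / (kappa - N) ->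
  q^-1 = p^-1 - (kappa - N) / kappa ->
  exists2 C : R, 0 <= C & forall f t, in_L1d f -> 0 < t -> (wint 'abs f <= t%:E)%E ->
    (Lpnorm K0 p%:E f <= t%:E)%E -> (Lpnorm K q%:E (T f) <= (C * t)%:E)%E.
Proof.
move=> B0 hT p1 pk qE; have [C C0 HC] := riesz_hls HM N0 Nk p1 pk qE.
have p0 : 0 < p := lt_trans ltr01 p1.
have k0 := md_kappa HM; have N'0 : 0 < kappa - N by rewrite subr_gt0.
have iq0 : 0 < q^-1.
  by rewrite qE subr_gt0 -[ltLHS]invrK ltf_pV2 ?posrE ?invr_gt0// ?divr_gt0// invf_div.
have q0 : 0 < q by rewrite -invr_gt0.
have iq1 : q^-1 <= 1.
  have i1 : p^-1 < 1 by rewrite invf_lt1.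
  have i2 : 0 < (kappa - N) / kappa by exact: divr_gt0.
  by rewrite qE; lra.
have q1 : 1 <= q by rewrite -[leLHS]invr1 -[leRHS]invrK lef_pV2 ?posrE.
have muf : leb Om = (fine (leb Om))%:E.
  by rewrite fineK// ge0_fin_numE ?(md_fin HM).
pose m := fine (leb Om); have m0 : 0 <= m by exact: fine_ge0.
pose A := C * B + B * b * m `^ q^-1.
have A0 : 0 <= A by rewrite addr_ge0// !mulr_ge0 ?powR_ge0// ltW.
(* One factor 2 comes from (x + y)^q <= 2^q (x^q + y^q), the other from 2 z^q <= (2z)^q with q >=
   1. *)
exists (4 * A); first by rewrite mulr_ge0.
move=> f t Lf t0 ft fp; have [mf _] := Lf; have [mT _] := hT f Lf.
have hf0 := nnfun_patch mK0 mf.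
pose u := B * b * t; have u0 : 0 <= u := mulr_ge0 (mulr_ge0 (ltW B0) b0) (ltW t0).
pose v1 := (fun x => Num.max (`|T f x| - u) 0) \_ K.
have mv1 : measurable_fun Om v1.
  apply/(measurable_restrict (fun x => Num.max (`|T f x| - u) 0)) => //.
  apply: (measurable_funS mOm); first exact: subIsetl.
  apply: measurable_maxr => //; apply: measurable_funB => //; exact: measurableT_comp.
have v10 x : 0 <= v1 x by rewrite /v1 patchE; case: ifPn => // _; rewrite le_max lexx orbT.
have Hv1 : (pint q (fun x => `|v1 x|) <= ((C * (B * t)) `^ q)%:E)%E.
  apply: (HC _ _ _ _ (nnfunZ (ltW B0) hf0) mv1); first exact: mulr_gt0.
    rewrite (pintZ HM p (ltW B0) hf0) powRM ?(ltW B0) ?(ltW t0)// EFinM.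
    apply: lee_wpmul2l; first by rewrite lee_fin powR_ge0.
    by rewrite pint_patch//; exact: ((Lpnorm_le_cst _ _ p0 (ltW t0)).1 fp).
  apply: filterS (local_bound B0 hT Lf) => x H Ox; rewrite ger0_norm// /v1 patchE.
  have R0 := (riesz_nonneg HM N (nnfunZ (ltW B0) hf0)).2 x Ox.
  case: ifPn => [/set_mem Kx|_] //.
  have [le1|lt1] := leP (`|T f x| - u) 0; first exact: R0.
  rewrite EFinB leeBlDr//; apply: le_trans (H Kx) _; apply: leeD => //.
  by rewrite /u [leRHS]EFinM; apply: lee_wpmul2l => //; rewrite lee_fin mulr_ge0// ltW.
apply: Lpnorm_restrict => //; first by rewrite !mulr_ge0// ltW.
have [mq q0'] := nonneg_measurable_powR q (nnfun_abs mv1).1.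
apply: (@le_trans _ _ (\int[leb]_(x in Om) ((2 `^ q)%:E * ((`|v1 x| `^ q)%:E + (u `^ q)%:E)))%E).
  apply: le_integral_nonneg => x Ox; first by rewrite lee_fin powR_ge0.
  rewrite -EFinD -EFinM lee_fin.
  have Tv : `|(T f \_ K) x| <= `|v1 x| + u.
    rewrite /v1 !patchE; case: ifPn => _; last by rewrite normr0 addr_ge0.
    by rewrite -lerBlDr; apply: le_trans (ler_norm _); rewrite le_max lexx.
  apply: (@le_trans _ _ ((2 * Num.max `|v1 x| u) `^ q)).
    apply: powR_le; rewrite ?(ltW q0)//; apply: le_trans Tv _.
    by rewrite mulr_natl mulr2n lerD// le_max lexx ?orbT.
  rewrite powRM ?le_max ?normr_ge0//; apply: ler_wpM2l; first exact: powR_ge0.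
  by rewrite /Num.max; case: ifPn => _; rewrite ?lerDl ?lerDr powR_ge0.
rewrite ge0_integralZl_EFin ?powR_ge0//; last 2 first.
- by move=> x Ox; rewrite adde_ge0 ?lee_fin ?powR_ge0.
- by apply: emeasurable_funD.
rewrite ge0_integralD//; last by move=> x _; rewrite lee_fin powR_ge0.
have Iu : (\int[leb]_(x in Om) (u `^ q)%:E = (u `^ q * m)%:E)%E.
  transitivity ((u `^ q)%:E * leb Om)%E; first exact: integral_cst.
  by rewrite muf -EFinM.
rewrite Iu.
have bd : (pint q (fun x => `|v1 x|) + (u `^ q * m)%:E <= ((2 * (A * t)) `^ q)%:E)%E.
  apply: (@le_trans _ _ (((A * t) `^ q)%:E + ((A * t) `^ q)%:E)%E).
    apply: leeD.
      apply: le_trans Hv1 _; rewrite lee_fin; apply: powR_le; rewrite ?(ltW q0)//.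
        by rewrite !mulr_ge0// ltW.
      by rewrite mulrA ler_wpM2r ?(ltW t0)// lerDl !mulr_ge0 ?powR_ge0// ltW.
    rewrite lee_fin -[X in _ * X](powRr1 m0) -(mulVf (lt0r_neq0 q0)) powRrM -powRM ?powR_ge0//.
    apply: powR_le; rewrite ?(ltW q0)//; first by rewrite mulr_ge0// powR_ge0.
    by rewrite /u mulrAC ler_wpM2r ?(ltW t0)// lerDr !mulr_ge0// ltW.
  have : 0 <= A * t := mulr_ge0 A0 (ltW t0).
  rewrite -EFinD lee_fin; move: (A * t) => z z0; rewrite -mulr2n powRM// -[leLHS]mulr_natl.
  rewrite ler_wpM2r ?powR_ge0// -[leLHS]powRr1//.
  by apply: ler_powR => //; rewrite ler1n.
apply: le_trans (lee_wpmul2l _ bd) _; first by rewrite lee_fin powR_ge0.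
rewrite -EFinM -powRM ?mulr_ge0 ?(ltW t0)// lee_fin le_eqVlt; apply/orP; left; apply/eqP.
by congr (_ `^ _); ring.
Qed.

End local_estimates.

Lemma le_scaled (R : realType) (C : R) (P Q : \bar R) : 0 <= C -> (0 <= P)%E -> (P < +oo)%E ->
  (forall t, 0 < t -> (P <= t%:E)%E -> (Q <= (C * t)%:E)%E) -> (Q <= C%:E * P)%E.
Proof.
move=> C0; case: P => [P| |]// P0 _ H; rewrite -EFinM; apply: le_mul_eps => // t Pt.
rewrite lee_fin in P0.
by apply: H; [exact: le_lt_trans Pt|rewrite lee_fin ltW].
Qed.

(** * Transfer of the bounds to the resolvent, uniformly in λ *)

Section mapping.
Context (R : realType) (n : nat) (Om : set 'rV[R]_n).
Local Notation E := 'rV[R]_n.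
Local Notation leb := (lebesgue_row R n).
Local Notation L2 := (fmem (Lp Om 2%:E)).
Variables (d : E -> R) (dist : E -> E -> R) (kappa : R).
Hypothesis HM : metric_domain leb Om d dist kappa.
Variables (N gamma : R).
Hypotheses (N0 : 0 < N) (Nk : N < kappa) (g0 : 0 < gamma).
Variables (G : E -> E -> R) (CG : R).
Hypotheses
  (mG : measurable_fun (off_diag Om) (fun z => G z.1 z.2))
  (CG0 : 0 < CG)
  (G_ge0 : forall x y, off_diag Om (x, y) -> 0 <= G x y)
  (GC : forall x y, off_diag Om (x, y) ->
     G x y <= CG * Phi d dist N gamma 1 x y).
Hypothesis oOm : open Om.
Variables (lam : nat -> R) (phi : nat -> E -> R).
Hypothesis EB : green_eigenbasis Om G lam phi.
Hypothesis SA : L2_self_adjoint Om (green_op Om G).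
Hypothesis CO : L2_compact Om (green_op Om G).
Local Notation L1dw := (L1w Om (fun x => d x `^ gamma)).
Local Notation wint w := (\int[leb]_(y in Om) ((d y `^ gamma)%:E * w y))%E.

Let resolvent l (T : (E -> R) -> E -> R) := [/\ linear_on Om L1dw T,
      exists C : R, bounded_by C L1dw L1dw T &
      forall f, L2 f -> is_spectral_sum Om lam phi l f (T f)].

Let maps (X Y : fspace R n) := exists C : R -> R -> R, forall l T, ~ Sigma lam l ->
  resolvent l T -> bounded_by (C (lambda_bar lam l) (dist_Sigma lam l)) X Y T.

Local Notation green_dominated := (green_dominated Om d dist N gamma).

Let gap l : ~ Sigma lam l -> 0 < dist_Sigma lam l.
Proof. exact: (dist_Sigma_gt0 (eigen_cvgy EB)). Qed.

Lemma fmem_L1d f : fmem L1dw f <-> in_L1d Om d gamma f.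
Proof. by rewrite /= wintE. Qed.

Lemma resolvent_existence l : ~ Sigma lam l -> exists T, resolvent l T.
Proof.
move=> Sl; eexists.
exact: (resolvent_iterP HM N0 Nk g0 mG CG0 G_ge0 GC oOm EB SA CO (gap Sl) (dist_Sigma_le lam l)).
Qed.

Lemma resolvent_uniqueness l T T' f : resolvent l T -> resolvent l T' -> fmem L1dw f ->
  T f = T' f %[ae leb in Om].
Proof.
move=> hT hT' /fmem_L1d Lf.
exact: (resolvent_unique HM g0 oOm EB hT hT' Lf).
Qed.

(** For each pair (a, b) of values of λ-bar and d_Σ, [resolvent_key] is applied with |l| <= |a| + b
    and gap b; choice collects the constants into a function of the pair. For b <= 0 there is no
    admissible l and 1 will do. *)
Lemma resolvent_dominated : exists K : R -> R -> R, (forall a b, 0 < K a b) /\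
  forall l T, ~ Sigma lam l -> resolvent l T ->
    green_dominated (K (lambda_bar lam l) (dist_Sigma lam l)) T.
Proof.
have H (ab : R * R) : exists k : R, 0 < k /\ forall l T, ~ Sigma lam l -> resolvent l T ->
    lambda_bar lam l = ab.1 -> dist_Sigma lam l = ab.2 -> green_dominated k T.
  case: ab => a b /=; have [b0|b0] := leP b 0.
    exists 1; split => // l T Sl _ _ lb; have := gap Sl; rewrite lb => b0'.
    by have := lt_le_trans b0' b0; rewrite ltxx.
  have Lam0 : 0 <= `|a| + b by rewrite addr_ge0// ltW.
  have [K K0 HK] := resolvent_key HM N0 Nk g0 mG CG0 G_ge0 GC oOm EB SA CO b0 Lam0.
  exists (K + 1); split; first by rewrite ltr_wpDl.
  move=> l T Sl hT la lb f Lf.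
  have lLam : `|l| <= `|a| + b.
    rewrite -la -lb; apply: (normr_le_lambda_bar (eigen_cvgy EB) _ (eigen_pos EB)).
    exact: (eigen_le EB).
  have gl j : b <= `|lam j - l| by rewrite -lb; exact: dist_Sigma_le.
  have [mT HT] := HK l T f lLam gl hT Lf; split => //.
  apply: filterS HT => x HT Ox; apply: le_trans (HT Ox) _; apply: lee_wpmul2r.
    apply: integral_ge0 => y Oy; rewrite mule_ge0// lee_fin//; exact: Phi_ge0.
  by rewrite lee_fin lerDl.
have [K HK] := choice H.
exists (fun a b => K (a, b)); split; first by move=> a b; have [] := HK (a, b).
by move=> l T Sl hT; have [_ H'] := HK (lambda_bar lam l, dist_Sigma lam l); exact: (H' l T Sl hT erefl erefl).
Qed.

Lemma maps_dominated X Y :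
  (exists2 C : R, 0 <= C & forall K T, 0 < K -> green_dominated K T -> bounded_by (C * K) X Y T) ->
  maps X Y.
Proof.
move=> [C C0 HC]; have [K [K0 HK]] := resolvent_dominated.
by exists (fun a b => C * K a b) => l T Sl hT; apply: HC => //; exact: HK.
Qed.

(** The multiplier λ_j/(λ_j - l) = 1 + l/(λ_j - l) is bounded by 1 + |l|/d_Σ(l), and |l| <= |λ-bar|
    + d_Σ(l). *)
Lemma maps_L2_H2 : maps (Lp Om 2%:E) (H2 Om lam phi).
Proof.
exists (fun a b => 1 + (`|a| + b) / b) => l T Sl [_ _ hT] f hf.
have mOm := md_Om HM; have us := hT f hf; have L2u := us.1.
have dS := gap Sl; set b := dist_Sigma lam l in dS *; set a := lambda_bar lam l.
pose A := 1 + (`|a| + b) / b.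
have A0 : 0 <= A by rewrite addr_ge0// divr_ge0 ?(ltW dS)// addr_ge0// ltW.
have lLam : `|l| <= `|a| + b.
  by apply: (normr_le_lambda_bar (eigen_cvgy EB) _ (eigen_pos EB)); exact: (eigen_le EB).
have I0 : 0 <= inner Om f f := inner_ge0 Om f.
have cj j : lam j ^+ 2 * inner Om (T f) (phi j) ^+ 2 <= A ^+ 2 * inner Om f (phi j) ^+ 2.
  rewrite (spectral_sum_coef oOm EB us) -!exprMn.
  have gl : b <= `|lam j - l| by exact: dist_Sigma_le.
  have ln0 : lam j - l != 0 by rewrite -normr_gt0 (lt_le_trans dS).
  rewrite -(real_normK (num_real (lam j * _))) -(real_normK (num_real (A * _))).
  rewrite ler_pXn2r ?nnegrE// mulrCA !normrM mulrC ler_wpM2r// (ger0_norm A0).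
  rewrite -normrM (_ : lam j / (lam j - l) = 1 + l / (lam j - l)); last by field.
  apply: le_trans (ler_normD _ _) _; rewrite normr1 lerD2l normrM normfV.
  by rewrite ler_pM ?invr_ge0// lef_pV2// posrE (lt_le_trans dS).
have S : (\sum_(0 <= j <oo) ((lam j) ^+ 2 * (inner Om (T f) (phi j)) ^+ 2)%:E <=
    (A ^+ 2 * inner Om f f)%:E)%E.
  apply: lime_le.
    by apply: is_cvg_nneseries => j _ _; rewrite lee_fin mulr_ge0 ?sqr_ge0.
  apply: nearW => M; rewrite sumEFin lee_fin big_mkord.
  apply: le_trans (_ : A ^+ 2 * \sum_(j < M) inner Om f (phi j) ^+ 2 <= _).
    by rewrite mulr_sumr; apply: ler_sum => j _; exact: cj.
  by rewrite ler_wpM2l ?sqr_ge0//; exact: (bessel oOm EB).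
have H : (H2norm Om lam phi (T f) <= A%:E * Lpnorm Om 2%:E f)%E.
  rewrite (Lpnorm2E mOm hf) -EFinM /H2norm.
  have -> : A * Num.sqrt (inner Om f f) = (A ^+ 2 * inner Om f f) `^ 2^-1.
    by rewrite powR12_sqrt ?mulr_ge0 ?sqr_ge0// sqrtrM ?sqr_ge0// sqrtr_sqr ger0_norm.
  rewrite -poweR_EFin; apply: gt0_ler_poweR; rewrite ?in_itv/= ?invr_ge0 ?leey ?lee_fin//.
  - by rewrite andbT; apply: nneseries_ge0 => j _ _; rewrite lee_fin mulr_ge0 ?sqr_ge0.
  - by rewrite mulr_ge0 ?sqr_ge0.
split => //; split => //; apply: le_lt_trans H _.
by rewrite lte_mul_pinfty//; exact: hf.2.
Qed.

Hypothesis dE : d = delta Om.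
Hypothesis distE : dist = (fun x y => enorm (x - y)).

Let compact_data (K : set E) : compact K -> K `<=` Om ->
  measurable K /\ exists2 c : R, 0 < c & forall x, K x -> c <= d x.
Proof.
move=> cK KO; split; first exact: compact_measurable_row.
apply: compact_pos_min => //; first by move=> x y; rewrite dE; exact: dist_to_lip.
by move=> x Kx; exact/(md_d0 HM)/KO.
Qed.

Let fnormE f : fnorm L1dw f = wint (fun x => `|f x|%:E).
Proof. by rewrite /= wintE. Qed.

Let L1d_lty f : fmem L1dw f -> (fnorm L1dw f < +oo)%E.
Proof. by case. Qed.

Let L1d_ge0 f : (0 <= fnorm L1dw f)%E.
Proof. exact: Lpnorm_ge0. Qed.

Lemma loc_L1_Lp B T p : 0 < B -> green_dominated B T -> 1 <= p -> N * p < kappa ->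
  continuous_to_loc Om L1dw p%:E T.
Proof.
move=> B0 hT p1 Npk.
have main K : compact K -> K `<=` Om -> exists C : R, forall f, fmem L1dw f ->
    (Lpnorm K p%:E (T f) <= C%:E * fnorm L1dw f)%E.
  move=> cK KO; have [mK [c c0 Kc]] := compact_data cK KO.
  have [C C0 HC] := local_L1_Lp HM N0 g0 mK KO c0 Kc B0 hT p1 Npk.
  exists C => f Xf; apply: le_scaled => // [|t t0 ft]; first exact: L1d_lty.
  by apply: HC; [exact/fmem_L1d|exact: t0|rewrite -fnormE].
split => // f Xf; split; first by have [] := hT f ((fmem_L1d f).1 Xf).
move=> K cK KO; have [C HC] := main K cK KO; apply: le_lt_trans (HC f Xf) _.
have := L1d_lty Xf; have := L1d_ge0 f; case: (fnorm L1dw f) => [r| |]// _ _.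
by rewrite -EFinM ltry.
Qed.

(** [compact_thicken] provides the compact neighbourhood K0 of K inside Om on which the seminorm of
    the datum is taken. *)
Let loc_of_local T (p q : \bar R) :
  (forall f, fmem L1dw f -> measurable_fun Om (T f)) ->
  (forall K K0 (c e : R), measurable K -> K `<=` Om -> 0 < c -> (forall x, K x -> c <= d x) ->
     measurable K0 -> K0 `<=` Om -> 0 < e -> (forall x y, K x -> dist x y < e -> K0 y) ->
     exists2 C : R, 0 <= C & forall f t, in_L1d Om d gamma f -> 0 < t ->
       (wint (fun x => `|f x|%:E) <= t%:E)%E -> (Lpnorm K0 p f <= t%:E)%E ->
       (Lpnorm K q (T f) <= (C * t)%:E)%E) ->
  continuous_loc_to_loc Om L1dw p q T.
Proof.
move=> mT H.
have main K : compact K -> K `<=` Om -> exists (K0 : set E) (C : R), [/\ compact K0, K0 `<=` Om &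
    forall f, fmem L1dw f -> Lploc Om p f ->
      (Lpnorm K q (T f) <= C%:E * (fnorm L1dw f + Lpnorm K0 p f))%E].
  move=> cK KO; have [mK [c c0 Kc]] := compact_data cK KO.
  have [K0 [e [e0 cK0 K0O KK0]]] := compact_thicken cK oOm KO.
  have [mK0 _] := compact_data cK0 K0O.
  have [C C0 HC] := H K K0 c e mK KO c0 Kc mK0 K0O e0 (ltac:(by rewrite distE)).
  exists K0, C; split => // f Xf [_ lf].
  have P0 := Lpnorm_ge0 K0 p f; have F0 := L1d_ge0 f.
  apply: le_scaled => //.
  - exact: adde_ge0.
  - by rewrite lte_add_pinfty//; [exact: L1d_lty|exact: lf].
  move=> t t0 ft; apply: HC => //; first exact/fmem_L1d.
    by rewrite -fnormE; apply: le_trans ft; exact: leeDl.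
  by apply: le_trans ft; exact: leeDr.
split.
  move=> f Xf lf; split; first exact: mT.
  move=> K cK KO; have [K0 [C [cK0 K0O HC]]] := main K cK KO.
  apply: le_lt_trans (HC f Xf lf) _.
  have := L1d_lty Xf; have := L1d_ge0 f; have := lf.2 K0 cK0 K0O; have := Lpnorm_ge0 K0 p f.
  case: (fnorm L1dw f) => [r| |]//; case: (Lpnorm K0 p f) => [r'| |]// _ _ _ _.
  by rewrite -EFinD -EFinM ltry.
by move=> K cK KO; exact: main.
Qed.

Lemma loc_hls B T p q : 0 < B -> green_dominated B T -> 1 < p -> p < kappa / (kappa - N) ->
  q^-1 = p^-1 - (kappa - N) / kappa -> continuous_loc_to_loc Om L1dw p%:E q%:E T.
Proof.
move=> B0 hT p1 pk qE; apply: loc_of_local.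
  by move=> f /fmem_L1d Lf; have [] := hT f Lf.
move=> K K0 c e mK KO c0 Kc mK0 K0O e0 KK0.
exact: (local_hls HM N0 Nk g0 mK KO c0 Kc mK0 K0O e0 KK0 B0 hT p1 pk qE).
Qed.

Lemma loc_Linf B T q : 0 < B -> green_dominated B T -> 1 < q -> kappa < (kappa - N) * q ->
  continuous_loc_to_loc Om L1dw q%:E +oo%E T.
Proof.
move=> B0 hT q1 kq; apply: loc_of_local.
  by move=> f /fmem_L1d Lf; have [] := hT f Lf.
move=> K K0 c e mK KO c0 Kc mK0 K0O e0 KK0.
exact: (local_Lq_Linf HM N0 g0 KO c0 Kc mK0 K0O e0 KK0 B0 hT q1 kq).
Qed.

(** K and K0 are arbitrary sets, so the estimate is proved for the closure of K and a compact K1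
    that contains a neighbourhood of it and lies in the interior of K0, where f is controlled by its
    norm on K0. *)
Lemma interior_Linf (K K0 : set E) : well_inside K K0 -> compactly_inside K0 Om ->
  exists C : R -> R -> R, forall l T, ~ Sigma lam l -> resolvent l T ->
    forall f, fmem L1dw f -> Lploc Om +oo%E f ->
      (Lpnorm K +oo (T f) <=
        (C (lambda_bar lam l) (dist_Sigma lam l))%:E *
        (Lpnorm K0 +oo f + Lpnorm Om 1 (fun x => (f x * d x `^ gamma)%R)))%E.
Proof.
move=> KK0 [cK0 K0O].
have K0sub : K0 `<=` closure K0 := @subset_closure _ K0.
have K0i : K0° `<=` K0 := @interior_subset _ K0.
have cK : compact (closure K).
  apply: (subclosed_compact _ cK0); first exact: closed_closure.
  by move=> x /KK0/K0i/K0sub.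
have KO : closure K `<=` Om by move=> x /KK0/K0i/K0sub/K0O.
have [K1 [e [e0 cK1 K1i KK1]]] := compact_thicken cK (open_interior K0) KK0.
have K1O : K1 `<=` Om by move=> x /K1i/K0i/K0sub/K0O.
have [mK [c c0 Kc]] := compact_data cK KO; have [mK1 _] := compact_data cK1 K1O.
have KK1' x y : closure K x -> dist x y < e -> K1 y by rewrite distE; exact: KK1.
have [C C0 HC] := local_Linf HM N0 Nk g0 KO c0 Kc mK1 e0 KK1'.
have [B [B0 HB]] := resolvent_dominated.
exists (fun a b => C * B a b) => l T Sl hT f Xf lf.
have hB := HB l T Sl hT; set b := B _ _ in hB *; have b0 : 0 < b by exact: B0.
have P0 := Lpnorm_ge0 K0 +oo%E f; have F0 := L1d_ge0 f; rewrite /= in F0.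
apply: le_scaled => //; first by rewrite mulr_ge0// ltW.
- exact: adde_ge0.
- rewrite lte_add_pinfty//; last exact: L1d_lty.
  have fin := lf.2 _ cK0 K0O; have [P PP PE] := Lpnorm_fin fin.
  apply: (@le_lt_trans _ _ P%:E); last exact: ltry.
  apply/(Lpnorm_oo_le _ _ PP); have : (Lpnorm (closure K0) +oo f <= P%:E)%E by rewrite PE.
  by move=> /(Lpnorm_oo_le _ _ PP); apply: filterS => x H /K0sub.
move=> t t0 ft.
have fK0 : (Lpnorm K0 +oo f <= t%:E)%E by apply: le_trans ft; exact: leeDl.
have fw : (wint (fun x => `|f x|%:E) <= t%:E)%E.
  by rewrite -wintE; apply: le_trans ft; exact: leeDr.
have := HC b T f t b0 hB ((fmem_L1d f).1 Xf) t0 fw.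
have Cbt : 0 <= C * b * t by rewrite mulr_ge0 ?(ltW t0)// mulr_ge0// ltW.
move=> H; apply/(Lpnorm_oo_le _ _ Cbt).
have /(Lpnorm_oo_le _ _ Cbt) : (Lpnorm (closure K) +oo (T f) <= (C * b * t)%:E)%E.
  apply: H; move: fK0 => /(Lpnorm_oo_le _ _ (ltW t0)); apply: filterS => x H /K1i/K0i.
  exact: H.
by apply: filterS => x H' Kx; apply: H'; exact: subset_closure.
Qed.

End mapping.

Theorem theorem2p2 (R : realType) (n : nat) (s gamma : R) (Om : set 'rV[R]_n)
    (G : 'rV[R]_n -> 'rV[R]_n -> R) (lam : nat -> R)
    (phi : nat -> 'rV[R]_n -> R) :
  (0 < n)%N -> 0 < s < 1 -> n%:R != 2 * s ->
  bounded_set Om -> C11_open_set Om ->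
  K1 Om s gamma G ->
  L2_compact Om (green_op Om G) -> L2_self_adjoint Om (green_op Om G) ->
  green_eigenbasis Om G lam phi ->
  let d := delta Om in
  let G0 := green_op Om G in
  let L1d := L1delta Om gamma in
  let resolvent := is_resolvent Om lam phi gamma in
  let maps := resolvent_bounded Om lam phi gamma in
  (forall l, ~ Sigma lam l ->
    (exists T, resolvent l T) /\
    (forall T T', resolvent l T -> resolvent l T' ->
      forall f, fmem L1d f -> T f = T' f %[ae lebesgue_row R n in Om])) /\
  (forall a : R, -1 - gamma < a ->
    maps (L1w Om (G0 (fun x => d x `^ a))) (L1w Om (fun x => d x `^ a))) /\
  (forall p : R, 1 <= p < n%:R / (n%:R - 2 * s) ->
    maps (Lp Om 1%E) (Lp Om p%:E)) /\
  maps (Lp Om 2%:E) (H2 Om lam phi) /\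
  (forall p0 p1 : R, 1 < p0 < n%:R / (2 * s) ->
    p1^-1 = p0^-1 - 2 * s / n%:R ->
    maps (Lp Om p0%:E) (Lp Om p1%:E)) /\
  (forall q : R, 1 <= q -> n%:R / (2 * s) < q ->
    maps (Lp Om q%:E) (Lp Om +oo%E)) /\
  (forall a : R, -1 - gamma < a ->
    maps (wLinf Om (fun x => d x `^ a)) (wLinf Om (G0 (fun x => d x `^ a)))) /\
  (forall l T, ~ Sigma lam l -> resolvent l T ->
    [/\ (forall p : R, 1 < p < n%:R / (n%:R - 2 * s) ->
          continuous_to_loc Om L1d p%:E T),
        (forall p0 p1 : R, 1 < p0 < n%:R / (2 * s) ->
          p1^-1 = p0^-1 - 2 * s / n%:R ->
          continuous_loc_to_loc Om L1d p0%:E p1%:E T) &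
        (forall q : R, 1 <= q -> n%:R / (2 * s) < q ->
          continuous_loc_to_loc Om L1d q%:E +oo%E T)]) /\
  (forall K K0 : set 'rV[R]_n,
    well_inside K K0 -> compactly_inside K0 Om ->
    exists C : R -> R -> R, forall l T, ~ Sigma lam l -> resolvent l T ->
      forall f, fmem L1d f -> Lploc Om +oo%E f ->
        (Lpnorm K +oo (T f) <=
          (C (lambda_bar lam l) (dist_Sigma lam l))%:E *
          (Lpnorm K0 +oo f + Lpnorm Om 1 (fun x => (f x * d x `^ gamma)%R)))%E).
Proof.
move=> n0 /andP[s0 s1] ns bOm COm hK1 CO SA EB /=.
have HM := row_metric_domain n0 bOm COm hK1; have oOm := COm.1.
have s2 : 0 < 2 * s by rewrite mulr_gt0.
(* The case n = 2s is excluded by hypothesis, the case n < 2s by [green_dimension]. *)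
have N0 : 0 < n%:R - 2 * s.
  by rewrite subr_gt0 lt_neqAle eq_sym ns (green_dimension n0 bOm COm hK1 EB SA CO).
(* The gain kappa - N of the abstract estimates is 2s here, so the critical exponent kappa / (kappa
   - N) becomes n / (2s). *)
have NE : n%:R - (n%:R - 2 * s) = 2 * s by rewrite subKr.
have Nk : n%:R - 2 * s < n%:R by rewrite gtrBl.
have strip := boundary_strip bOm COm (@delta_gt0 _ _ _ n0 COm _ _ _ hK1).
have [C C0 HC] := green_Phi n0 bOm COm hK1.
have [/andP[g0 _] mG Gpos _ _] := hK1.
have G_ge0 x y : off_diag Om (x, y) -> 0 <= G x y by move=> /Gpos/ltW.
have GC x y : off_diag Om (x, y) ->
    G x y <= C * Phi (delta Om) (fun x y => enorm (x - y)) (n%:R - 2 * s) gamma 1 x y.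
  by move=> /HC[].
have CGP x y : off_diag Om (x, y) ->
    Phi (delta Om) (fun x y => enorm (x - y)) (n%:R - 2 * s) gamma 1 x y <= C * G x y.
  by move=> /HC[].
have maps X Y := @maps_dominated _ _ _ _ _ _ HM _ _ N0 Nk g0 _ _ mG C0 G_ge0 GC oOm _ _ EB SA CO X Y.
have p_range p : p < n%:R / (n%:R - 2 * s) -> (n%:R - 2 * s) * p < n%:R.
  by rewrite ltr_pdivlMr// mulrC.
(* Since n > 2s, the condition q > n / (2s) already forces q > 1, the strict inequality that Young's
   inequality requires. *)
have q_range q : n%:R / (2 * s) < q ->
    1 < q /\ n%:R < (n%:R - (n%:R - 2 * s)) * q.
  move=> nq; split; last by move: nq; rewrite NE ltr_pdivrMr// mulrC.
  by apply: le_lt_trans nq; rewrite ler_pdivlMr// mul1r -subr_ge0 ltW.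
split; [|split; [|split; [|split; [|split; [|split; [|split; [|split]]]]]]].
- move=> l Sl; split.
    exact: (resolvent_existence HM N0 Nk g0 mG C0 G_ge0 GC oOm EB SA CO Sl).
  by move=> T T' hT hT' f; exact: (resolvent_uniqueness HM g0 oOm EB hT hT').
- by move=> a a1; apply: maps; exact: (dominated_weight_L1 HM N0 Nk g0 strip mG C0 G_ge0 GC CGP a1).
- by move=> p /andP[p1 /p_range pn]; apply: maps; exact: (dominated_L1_Lp HM N0 g0 p1 pn).
- exact: (maps_L2_H2 HM gamma oOm EB).
- move=> p0 p1 /andP[p01]; rewrite -NE => p0n pE; apply: maps.
  exact: (dominated_hls HM N0 Nk g0 p01 p0n pE).
- by move=> q _ /q_range[q1 nq]; apply: maps; exact: (dominated_Lq_Linf HM N0 g0 q1 nq).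
- by move=> a a1; apply: maps; exact: (dominated_weight_Linf HM N0 Nk g0 strip mG C0 G_ge0 GC CGP a1).
- move=> l T Sl hT.
  have [K [K0 HK]] := resolvent_dominated HM N0 Nk g0 mG C0 G_ge0 GC oOm EB SA CO.
  have k0 := K0 (lambda_bar lam l) (dist_Sigma lam l); have hk := HK l T Sl hT.
  split.
  + by move=> p /andP[p1 /p_range pn]; exact: (loc_L1_Lp HM N0 g0 erefl k0 hk (ltW p1) pn).
  + move=> p0 p1 /andP[p01]; rewrite -NE => p0n pE.
    exact: (loc_hls HM N0 Nk g0 oOm erefl erefl k0 hk p01 p0n pE).
  + by move=> q _ /q_range[q1 nq]; exact: (loc_Linf HM N0 g0 oOm erefl erefl k0 hk q1 nq).
- move=> K K0 KK0 K0O.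
  exact: (interior_Linf HM N0 Nk g0 mG C0 G_ge0 GC oOm EB SA CO erefl erefl KK0 K0O).
Qed.
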